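(* Let $p\in\{1,2,\ldots,\infty\}$. Let $Q\subset\mathbf{R}^n$ be a closed set, let $\mathcal A$ be a normally flat $C^{p+1}$-stratification of $Q$ of depth $m$, and let $f:\mathbf{R}^n\to\mathbf{R}$ and $\varepsilon:\mathbf{R}^n\to(0,\infty)$ be continuous functions. Let $V_1$ be any neighborhood of the support of $f$, and let $V_2$ be any neighborhood of the set $\bigcup_{M\in\mathcal A,\ \dim M<n}M$. Then there exists a function $g:\mathbf{R}^n\to\mathbf{R}$ satisfying all of the following properties. (1) Uniform closeness: $|f(x)-g(x)|<\varepsilon(x)$ for all $x\in\mathbf{R}^n$. (2) Smoothness and Lipschitzness: $g$ is $C^p$-smooth. Moreover, if $f$ is Lipschitz continuous, then so is $g$, and $\operatorname{lip} g\le 11^{m+1}\operatorname{lip} f$. (3) Enhanced tangency condition: each stratum $M\in\mathcal A$ has a neighborhood $U$ such that $g(x)=g(P_M(x))$ for all $x\in U$. (4) Support: the support of $g$ is contained in $V_1$. (5) Agreement on full-dimensional strata: if $f$ is $C^p$-smooth, then $g$ coincides with $f$ outside of $V_2$.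
   Context: $|\cdot|$ is the Euclidean norm. For $f:\mathbf R^n\to\mathbf R$, $\operatorname{lip} f:=\sup_{x\neq y}\frac{|f(x)-f(y)|}{|x-y|}$, and $f$ is Lipschitz continuous if $\operatorname{lip} f<\infty$. Here $p\in\{1,2,\ldots,\infty\}$. A set $M\subset\mathbf{R}^n$ is a $C^p$ manifold of dimension $r$ if each $\bar x\in M$ has an open neighborhood $U$ with $M\cap U=F^{-1}(0)$ for some $C^p$-smooth map $F:U\to\mathbf{R}^{n-r}$ whose derivative at $\bar x$ has full rank. A $C^p$-stratification $\mathcal A$ of a set $Q\subset\mathbf{R}^n$ is a partition of $Q$ into finitely many nonempty $C^p$ manifolds (not necessarily connected), called strata, satisfying the frontier condition: for any two distinct strata $L$ and $M$, if $L\cap \operatorname{cl}M\neq\emptyset$ then $L\subset(\operatorname{cl}M)\setminus M$. The strict partial order $\prec$ on $\mathcal A$ is defined by $L\prec M\iff L\subset(\operatorname{cl}M)\setminus M$. The depth of $\mathcal A$ is the maximal integer $m$ such that there exist strata $M_1\prec M_2\prec\cdots\prec M_m$. For $S\subset\mathbf{R}^n$, $d(x,S)=\inf_{y\in S}|x-y|$ and $P_S(x)=\{y\in S:|x-y|=d(x,S)\}$ is the metric projection; when $P_S(x)$ is a singleton it is identified with its element. (Every $C^{p+1}$ manifold $M$, $p\ge1$, has a neighborhood on which $P_M$ is single-valued and $C^p$-smooth.) A $C^{p+1}$-stratification $\mathcal A$ is normally flat if for any two strata $L,M\in\mathcal A$ with $L\prec M$ there are neighborhoods $V$ of $L$ and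 $U$ of $M$ such that $P_L(x)=P_L\circ P_M(x)$ for all $x\in V\cap U$. *)

(* Defs.v *)
From HB Require Import structures.
From mathcomp Require Import all_boot all_order all_algebra.
From mathcomp Require Import all_classical all_reals all_analysis.

Set Implicit Arguments.
Unset Strict Implicit.
Unset Printing Implicit Defensive.

Import Order.TTheory GRing.Theory Num.Theory.
Import numFieldNormedType.Exports.

Local Open Scope classical_set_scope.
Local Open Scope ring_scope.

(* The library norm on 'rV[R]_n is the sup norm, hence this definition; both
   norms induce the library topology, so open sets, closures, continuity and
   differentials need no redefinition. *)
Definition enorm (R : realType) (n : nat) (x : 'rV[R]_n) : R :=
  Num.sqrt (\sum_(i < n) x 0 i ^+ 2).

Definition lip (R : realType) (n : nat) (f : 'rV[R]_n -> R) : \bar R :=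
  ereal_sup [set (`|f z.1 - f z.2| / enorm (z.1 - z.2))%:E
            | z in [set z : 'rV[R]_n * 'rV[R]_n | z.1 <> z.2]].

Definition tsupport (R : realType) (n : nat) (f : 'rV[R]_n -> R) :
    set 'rV[R]_n :=
  closure [set x | f x <> 0].

(* Only meant for an open set U: then 'D_v f on U depends on f on U only. *)
Fixpoint is_Ck (R : realType) (n : nat) (W : normedModType R) (k : nat)
    (U : set 'rV[R]_n) (f : 'rV[R]_n -> W) : Prop :=
  if k is k'.+1 then
    (forall x, U x -> differentiable f x) /\
    (forall v : 'rV[R]_n, is_Ck k' U (fun x => 'D_v f x))
  else forall x, U x -> {for x, continuous f}.

(* Orders of smoothness: Some k is the finite order k, None is infinity;
   the order p + 1 is omap succn p. *)
Definition is_Cp (R : realType) (n : nat) (W : normedModType R)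
    (p : option nat) (U : set 'rV[R]_n) (f : 'rV[R]_n -> W) : Prop :=
  if p is Some k then is_Ck k U f else forall k : nat, is_Ck k U f.

Definition manifold (R : realType) (n : nat) (p : option nat) (r : nat)
    (M : set 'rV[R]_n) : Prop :=
  (r <= n)%N /\
  forall a, M a ->
    exists U : set 'rV[R]_n, exists F : 'rV[R]_n -> 'rV[R]_(n - r),
      [/\ open_nbhs a U, is_Cp p U F,
          M `&` U = [set x | U x /\ F x = 0]
        & \rank (jacobian F a) = (n - r)%N].

Definition strat_lt (R : realType) (n : nat) (L M : set 'rV[R]_n) : Prop :=
  L `<=` closure M `\` M.

Definition stratification (R : realType) (n : nat) (p : option nat)
    (Q : set 'rV[R]_n) (A : set (set 'rV[R]_n)) : Prop :=
  [/\ finite_set A, partition A id Q,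
      forall M, A M -> exists r : nat, manifold p r M
    & forall L M, A L -> A M -> L <> M ->
        L `&` closure M !=set0 -> strat_lt L M].

(* c 0, ..., c (k - 1) is an increasing chain of k strata *)
Definition strat_chain (R : realType) (n : nat) (A : set (set 'rV[R]_n))
    (k : nat) (c : nat -> set 'rV[R]_n) : Prop :=
  (forall i : nat, (i < k)%N -> A (c i)) /\
  (forall i : nat, (i.+1 < k)%N -> strat_lt (c i) (c i.+1)).

(* The empty chain is allowed, so that the empty stratification has depth 0. *)
Definition strat_depth (R : realType) (n : nat) (A : set (set 'rV[R]_n))
    (m : nat) : Prop :=
  (exists c, strat_chain A m c) /\
  (forall (k : nat) (c : nat -> set 'rV[R]_n), strat_chain A k c -> (k <= m)%N).

Definition set_dist (R : realType) (n : nat) (x : 'rV[R]_n)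
    (S : set 'rV[R]_n) : R :=
  inf [set enorm (x - y) | y in S].

Definition metric_proj (R : realType) (n : nat) (S : set 'rV[R]_n)
    (x : 'rV[R]_n) : set 'rV[R]_n :=
  [set y | S y /\ enorm (x - y) = set_dist x S].

(* The composition P_L o P_M is that of set-valued maps. Since P_L and P_M are
   single-valued near L and M, shrinking V and U shows that this agrees with
   the composition of partially defined single-valued maps. *)
Definition normally_flat (R : realType) (n : nat)
    (A : set (set 'rV[R]_n)) : Prop :=
  forall L M, A L -> A M -> strat_lt L M ->
    exists V U : set 'rV[R]_n,
      [/\ set_nbhs L V, set_nbhs M U
        & forall x, V x -> U x ->
            metric_proj L x = \bigcup_(y in metric_proj M x) metric_proj L y].

(* Main.v *)
Require Import Defs.
From HB Require Import structures.
From mathcomp Require Import all_boot all_order all_algebra.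
From mathcomp Require Import all_classical all_reals all_analysis.
From mathcomp Require Import ring lra.

Set Implicit Arguments.
Unset Strict Implicit.
Unset Printing Implicit Defensive.

Import Order.TTheory GRing.Theory Num.Theory.
Import numFieldNormedType.Exports.

Local Open Scope classical_set_scope.
Local Open Scope ring_scope.

(* The function f is first smoothed (unless it is C^p) and then corrected near the strata of
   dimension < n, by increasing depth.  Near a stratum M the correction replaces
   f by F = f + phi (f o P_M - f), where phi is 1 near M and vanishes at distance
   > rho / 2 from M, rho being the distance to the complement of the region where
   the correction is allowed.  Choosing phi as a function of d(., M) / rho gives
   phi the slope 6 / rho at most, while |f o P_M - f| <= K d(., M) <= K rho / 2
   where phi > 0; since f o P_M is 2 K-Lipschitz there, the pointwise (hence
   global) Lipschitz constant of F is at most 2 K + 3 K.  By normal flatness F = f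
   near the lower strata, so that their tangency is not destroyed.  A final
   smoothing, relative to a closed set near which F is already smooth, costs
   another 6 K; this is the factor 11 per stratum depth.

   P_M is smooth and 2-Lipschitz near M: in coordinates theta in which M is a
   linear subspace with orthogonal projection E, the map
   z |-> theta (z E) + (z - z E) (J_Phi (theta (z E)))^T, Phi = theta^-1, is a
   local diffeomorphism by the inverse function theorem and P_M reads z |-> z E.

   The mollifier is a convolution over a cube, written with iterated
   one-dimensional primitives. *)

(** * Calculus in R^n *)

(** The obstacle is that the neighborhood of M on which P_M is single-valued pinches off at the
    frontier of M, so that no cutoff of fixed width exists. A cutoff whose width is proportional to
    rho has slope of order 1 / rho, but it multiplies a difference of order rho; the product, hence
    the loss in the Lipschitz constant, stays bounded. As rho is merely Lipschitz, so is the cutoff,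
    which is why each stage has to end with a smoothing; the next stage needs a C^p function again,
    for f o P_M to be C^p. Since M is C^(p+1), P_M is C^p, and stages turn C^p functions into C^p
    functions without accumulating a loss.

    A smoothing raises the Lipschitz constant by any prescribed positive amount. Prescribing 6 K in
    a stage and 10 K in the initial smoothing makes each of the m + 1 steps cost the same factor 11.
    As the amount must be positive, a constant f is treated apart. *)

Section EuclideanNorm.
Context {R : realType} {n : nat}.
Implicit Types x y z : 'rV[R]_n.

Definition dotp x y : R := \sum_(i < n) x 0 i * y 0 i.

Lemma dotpE x y : dotp x y = (x *m y^T) 0 0.
Proof. by rewrite mxE; apply: eq_bigr => i _; rewrite mxE. Qed.

Lemma dotpC x y : dotp x y = dotp y x.
Proof. by apply: eq_bigr => i _; rewrite mulrC. Qed.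

Lemma dotpDl x y z : dotp (x + y) z = dotp x z + dotp y z.
Proof. by rewrite !dotpE mulmxDl mxE. Qed.

Lemma dotpZl a x z : dotp (a *: x) z = a * dotp x z.
Proof. by rewrite !dotpE -scalemxAl mxE. Qed.

Lemma dotpNl x z : dotp (- x) z = - dotp x z.
Proof. by rewrite -scaleN1r dotpZl mulN1r. Qed.

Lemma dotpDr x y z : dotp z (x + y) = dotp z x + dotp z y.
Proof. by rewrite dotpC dotpDl !(dotpC z). Qed.

Lemma dotpZr a x z : dotp z (a *: x) = a * dotp z x.
Proof. by rewrite dotpC dotpZl (dotpC z). Qed.

Lemma dotpNr x z : dotp z (- x) = - dotp z x.
Proof. by rewrite dotpC dotpNl (dotpC z). Qed.

Lemma dotp_ge0 x : 0 <= dotp x x.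
Proof. by apply: sumr_ge0 => i _; rewrite -expr2 sqr_ge0. Qed.

Lemma enorm_sqr x : enorm x ^+ 2 = dotp x x.
Proof.
rewrite /enorm sqr_sqrtr; first by apply: eq_bigr => i _; rewrite expr2.
by apply: sumr_ge0 => i _; rewrite sqr_ge0.
Qed.

Lemma enorm_ge0 x : 0 <= enorm x.
Proof. exact: sqrtr_ge0. Qed.

Lemma ler_coord_enorm x i : `|x 0 i| <= enorm x.
Proof.
rewrite -(ler_pXn2r (n := 2)) ?nnegrE ?enorm_ge0// enorm_sqr.
rewrite real_normK ?num_real// /dotp (bigD1 i)//= expr2 lerDl.
by apply: sumr_ge0 => j _; rewrite -expr2 sqr_ge0.
Qed.

Lemma ler_norm_enorm x : `|x| <= enorm x.
Proof.
rewrite /Num.Def.normr/= mx_normrE; apply: bigmax_le => [|[i j] _].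
  exact: enorm_ge0.
by rewrite ord1 ler_coord_enorm.
Qed.

Lemma ler_coord_norm x i : `|x 0 i| <= `|x|.
Proof.
by rewrite [leRHS]/Num.Def.normr/= mx_normrE; apply: (le_bigmax _ _ (0, i)).
Qed.

Lemma enorm0_eq0 x : enorm x = 0 -> x = 0.
Proof. by move=> x0; apply/normr0_eq0/le_anti; rewrite normr_ge0 -x0 ler_norm_enorm. Qed.

Lemma enorm0 : enorm (0 : 'rV[R]_n) = 0.
Proof.
apply/eqP; rewrite -(sqrf_eq0 (enorm _)) enorm_sqr /dotp big1// => i _.
by rewrite mxE mul0r.
Qed.

Lemma enormZ a x : enorm (a *: x) = `|a| * enorm x.
Proof.
apply/eqP; rewrite -(eqrXn2 (n := 2)) ?mulr_ge0 ?enorm_ge0//.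
by rewrite exprMn !enorm_sqr dotpZl dotpZr mulrA real_normK ?num_real.
Qed.

Lemma enormN x : enorm (- x) = enorm x.
Proof. by rewrite -scaleN1r enormZ normrN1 mul1r. Qed.

Lemma enormB x y : enorm (x - y) = enorm (y - x).
Proof. by rewrite -enormN opprB. Qed.

(** Cauchy-Schwarz: the square of the norm of |y|^2 x - (x . y) y is |y|^2 (|x|^2 |y|^2 - (x .
    y)^2). *)
Lemma dotp_enorm x y : dotp x y <= enorm x * enorm y.
Proof.
have [y0|yn0] := eqVneq (enorm y) 0.
  rewrite y0 mulr0 (enorm0_eq0 y0) dotpC -(scale0r 0) dotpZl mul0r.
  exact: lexx.
have y_gt0 : 0 < enorm y by rewrite lt_def yn0 enorm_ge0.
apply: (le_trans (ler_norm _)).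
rewrite -(ler_pXn2r (n := 2)) ?nnegrE ?mulr_ge0 ?enorm_ge0//.
rewrite real_normK ?num_real// exprMn.
have := dotp_ge0 (enorm y ^+ 2 *: x - dotp x y *: y).
rewrite !(dotpDl, dotpDr, dotpZl, dotpZr, dotpNl, dotpNr) -!enorm_sqr (dotpC y x).
set a := enorm x; set b := enorm y; set d := dotp x y => H.
have {}H : 0 <= b ^+ 2 * (a ^+ 2 * b ^+ 2 - d ^+ 2) by apply: le_trans H _; lra.
by rewrite -subr_ge0; rewrite pmulr_rge0// ?exprn_gt0// in H.
Qed.

Lemma ler_enormD x y : enorm (x + y) <= enorm x + enorm y.
Proof.
rewrite -(ler_pXn2r (n := 2)) ?nnegrE ?addr_ge0 ?enorm_ge0//.
rewrite enorm_sqr dotpDl !dotpDr (dotpC y x) -!enorm_sqr.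
by have := dotp_enorm x y; nra.
Qed.

Lemma ler_enormB x y z : enorm (x - z) <= enorm (x - y) + enorm (y - z).
Proof. by apply: le_trans (ler_enormD _ _); rewrite subrKA. Qed.

Lemma ler_enorm_sum I (r : seq I) (F : I -> 'rV[R]_n) :
  enorm (\sum_(i <- r) F i) <= \sum_(i <- r) enorm (F i).
Proof.
elim: r => [|a r IH]; first by rewrite !big_nil enorm0.
by rewrite !big_cons (le_trans (ler_enormD _ _))// lerD2l.
Qed.

(** The factor [n.+1], in place of n, is positive even for n = 0, so that one can divide by it. *)
Lemma enorm_le_norm x : enorm x <= n.+1%:R * `|x|.
Proof.
apply: (@le_trans _ _ (n%:R * `|x|)); last by rewrite ler_wpM2r// ler_nat.
have {1}-> : x = \sum_(i < n) x 0 i *: delta_mx 0 i.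
  by rewrite [LHS]matrix_sum_delta big_ord1.
apply: (le_trans (ler_enorm_sum _ _)).
rewrite -[n%:R]/(n%:R); apply: (@le_trans _ _ (\sum_(i < n) `|x|)).
  apply: ler_sum => i _; rewrite enormZ.
  have -> : enorm (delta_mx 0 i : 'rV[R]_n) = 1.
    apply/eqP; rewrite -(eqrXn2 (n := 2)) ?enorm_ge0// enorm_sqr expr1n.
    rewrite /dotp (bigD1 i)//= !mxE !eqxx mulr1 big1 ?addr0// => j ji.
    by rewrite mxE eqxx/= (negbTE ji) mul0r.
  by rewrite mulr1 ler_coord_norm.
by rewrite sumr_const card_ord mulr_natl.
Qed.

Lemma nbhs_enormP x (A : set 'rV[R]_n) :
  nbhs x A <-> exists2 e, 0 < e & forall y, enorm (y - x) < e -> A y.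
Proof.
split.
  move=> /(nbhs_normP x)[e /= e0 eA]; exists e => // y yx; apply: eA => /=.
  by rewrite distrC (le_lt_trans (ler_norm_enorm _)).
move=> [e e0 eA]; apply/(nbhs_normP x); exists (e / n.+1%:R) => /=.
  by rewrite divr_gt0.
move=> y /=; rewrite distrC => yx; apply: eA; apply: le_lt_trans (enorm_le_norm _) _.
by rewrite mulrC -ltr_pdivlMr.
Qed.

Lemma near_enorm x e : 0 < e -> \forall y \near x, enorm (y - x) < e.
Proof. by move=> e0; apply/nbhs_enormP; exists e. Qed.

End EuclideanNorm.

(** * Differentiability as an epsilon estimate, and its locality *)

Section EpsilonDifferential.
Context {R : realType} {V W : normedModType R}.
Implicit Types f g : V -> W.

Lemma diff_eps f x : differentiable f x -> forall e, 0 < e ->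
  \forall y \near x, `|f y - f x - 'd f x (y - x)| <= e * `|y - x|.
Proof.
move=> dfx e e0; have := diff_locally dfx.
move/eqaddoP => /(_ _ e0) H.
have {}H : \forall z \near x, `|f (z - x + x) - (f x + 'd f x (z - x))| <= e * `|z - x|.
  by rewrite (near_shift 0 x); near=> z; rewrite /= subr0 addrK; near: z.
by apply: filterS H => y; rewrite subrK opprD addrA.
Unshelve. all: by end_near.
Qed.

Lemma eps_diff f x (L : {linear V -> W}) : continuous L ->
  (forall e, 0 < e ->
    \forall y \near x, `|f y - f x - L (y - x)| <= e * `|y - x|) ->
  differentiable f x /\ 'd f x = L :> (V -> W).
Proof.
move=> cL H.
have E : f \o shift x = cst (f x) + L +o_ (0 : V) id.
  apply/eqaddoP => e e0; have := H e e0; rewrite (near_shift 0 x).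
  by apply: filterS => y /=; rewrite subr0 addrK opprD addrA.
have dE := diff_unique cL E; split=> //.
by apply/diff_locallyP; rewrite dE.
Qed.

Lemma near_eq_differentiable f g x : (\near x, f x = g x) ->
  differentiable f x -> differentiable g x.
Proof.
move=> fg dfx; have cdf := diff_continuous dfx.
have [] // := @eps_diff g x ('d f x) cdf.
move=> e e0; have H := diff_eps dfx e0.
have fgx := nbhs_singleton fg.
by apply: filterS2 fg H => y -> ; rewrite fgx.
Qed.

End EpsilonDifferential.

Lemma near_eq_continuous (T U : topologicalType) (f g : T -> U) x :
  (\near x, f x = g x) -> {for x, continuous f} -> {for x, continuous g}.
Proof.
move=> fg; rewrite /prop_for /continuous_at -(nbhs_singleton fg) => cf.
apply: cvg_trans cf; apply: near_eq_cvg; by apply: filterS fg => y ->.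
Qed.

Lemma continuous_eps (R : realType) (T : topologicalType) (W : normedModType R)
    (f : T -> W) x : {for x, continuous f} <->
  forall e, 0 < e -> \forall y \near x, `|f y - f x| <= e.
Proof.
split=> [cf e e0|H].
  by move/cvgrPdist_le: cf => /(_ e e0); apply: filterS => y; rewrite distrC.
by apply/cvgrPdist_le => e /H; apply: filterS => y; rewrite distrC.
Qed.

Lemma near_rV_norm (R : realType) (T : Type) (F : set_system T) m
    (g : T -> 'rV[R]_m) (e : R) : Filter F -> 0 <= e ->
  (forall j, \forall y \near F, `|g y 0 j| <= e) ->
  \forall y \near F, `|g y| <= e.
Proof.
move=> FF e0 /filter_forall; apply: filterS => y H.
rewrite /Num.Def.normr/= mx_normrE.
by apply: bigmax_le => // -[i j] _; rewrite ord1.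
Qed.

(** * Stability of the classes C^k under locality, algebra and composition *)

Section CkCalculus.
Context {R : realType}.

Lemma ck_sub n (W : normedModType R) k (U V : set 'rV[R]_n) (f : 'rV[R]_n -> W) :
  V `<=` U -> is_Ck k U f -> is_Ck k V f.
Proof.
move=> VU; elim: k f => [|k IH] f /=; first by move=> H x /VU/H.
by move=> [H1 H2]; split=> [x /VU/H1//|v]; exact: IH.
Qed.

(** [is_Ck] unfolds to conditions imposed at each point of the set separately. *)
Lemma ck_local n (W : normedModType R) k (U : set 'rV[R]_n) (f : 'rV[R]_n -> W) :
  (forall x, U x -> exists V, V x /\ is_Ck k V f) -> is_Ck k U f.
Proof.
elim: k f => [|k IH] f /= H.
  by move=> x /H[V [Vx]]; exact.
split=> [x /H[V [Vx [+ _]]]|v]; first exact.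
by apply: IH => x /H[V [Vx [_ cV]]]; exists V; split.
Qed.

Lemma open_near_eq n (W : normedModType R) (U : set 'rV[R]_n)
    (f g : 'rV[R]_n -> W) x : open U -> U x -> (forall y, U y -> f y = g y) ->
  \near x, f x = g x.
Proof.
by move=> oU Ux fg; apply: filterS (open_nbhs_nbhs (conj oU Ux)) => y /fg.
Qed.

Lemma ck_eq n (W : normedModType R) k (U : set 'rV[R]_n) (f g : 'rV[R]_n -> W) :
  open U -> (forall x, U x -> f x = g x) -> is_Ck k U f -> is_Ck k U g.
Proof.
move=> oU; elim: k f g => [|k IH] f g fg /=.
  by move=> H x Ux; exact: near_eq_continuous (open_near_eq oU Ux fg) (H x Ux).
move=> [H1 H2]; split=> [x Ux|v].
  exact: near_eq_differentiable (open_near_eq oU Ux fg) (H1 x Ux).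
by apply: IH (H2 v) => x Ux; exact/near_eq_derive/(open_near_eq oU).
Qed.

Lemma ckS n (W : normedModType R) k (U : set 'rV[R]_n) (f : 'rV[R]_n -> W) :
  is_Ck k.+1 U f -> is_Ck k U f.
Proof.
elim: k f => [|k IH] f.
  by move=> [H _] x Ux; exact/differentiable_continuous/H.
by move=> [H1 H2]; split=> // v; exact/IH/H2.
Qed.

Lemma ck_le n (W : normedModType R) k l (U : set 'rV[R]_n) (f : 'rV[R]_n -> W) :
  (k <= l)%N -> is_Ck l U f -> is_Ck k U f.
Proof.
move=> /subnK <-; elim: (l - k)%N => [//|d IH]; rewrite addSn => /ckS; exact: IH.
Qed.

Lemma ck_continuous n (W : normedModType R) k (U : set 'rV[R]_n)
    (f : 'rV[R]_n -> W) : is_Ck k U f -> forall x, U x -> {for x, continuous f}.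
Proof. by move=> /(ck_le (leq0n k)). Qed.

Lemma ck_cst n (W : normedModType R) k (U : set 'rV[R]_n) (c : W) :
  is_Ck k U (fun=> c).
Proof.
elim: k c => [|k IH] c /=; first by move=> x _; exact: cst_continuous.
split=> [x _|v]; first exact: differentiable_cst.
have -> : (fun x : 'rV[R]_n => 'D_v (fun=> c) x) = (fun=> 0); last exact: IH.
by apply/funext => x; exact: derive_cst.
Qed.

Lemma ck_add n (W : normedModType R) k (U : set 'rV[R]_n) (f g : 'rV[R]_n -> W) :
  open U -> is_Ck k U f -> is_Ck k U g -> is_Ck k U (fun x => f x + g x).
Proof.
move=> oU; elim: k f g => [|k IH] f g /=.
  by move=> cf cg x Ux; exact: continuousD (cf x Ux) (cg x Ux).
move=> [f1 f2] [g1 g2]; split=> [x Ux|v].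
  by apply: differentiableD; [exact: f1|exact: g1].
apply: ck_eq (IH _ _ (f2 v) (g2 v)) => //= x Ux.
by rewrite -[RHS]/('D_v (f + g) x) deriveD//; apply: diff_derivable; (exact: f1) || (exact: g1).
Qed.

Lemma ck_mul n k (U : set 'rV[R]_n) (f g : 'rV[R]_n -> R) :
  open U -> is_Ck k U f -> is_Ck k U g -> is_Ck k U (fun x => f x * g x).
Proof.
move=> oU; elim: k f g => [|k IH] f g.
  by move=> cf cg x Ux; exact: continuousM (cf x Ux) (cg x Ux).
move=> cf cg; have := (cf, cg) => -[[f1 f2] [g1 g2]]; split=> [x Ux|v].
  by apply: differentiableM; [exact: f1|exact: g1].
have := ck_add oU (IH _ _ (ckS cf) (g2 v)) (IH _ _ (ckS cg) (f2 v)).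
apply: ck_eq => //= x Ux.
by rewrite -[RHS]/('D_v (f * g) x) deriveM//; apply: diff_derivable; (exact: f1) || (exact: g1).
Qed.

Lemma ck_scale n k (U : set 'rV[R]_n) (f : 'rV[R]_n -> R) c :
  open U -> is_Ck k U f -> is_Ck k U (fun x => c * f x).
Proof. by move=> oU; exact: ck_mul (ck_cst _ _ _). Qed.

Lemma ck_opp n k (U : set 'rV[R]_n) (f : 'rV[R]_n -> R) :
  open U -> is_Ck k U f -> is_Ck k U (fun x => - f x).
Proof.
move=> oU /(ck_scale (-1) oU); apply: ck_eq => // x _; exact: mulN1r.
Qed.

Lemma ck_sub2 n k (U : set 'rV[R]_n) (f g : 'rV[R]_n -> R) :
  open U -> is_Ck k U f -> is_Ck k U g -> is_Ck k U (fun x => f x - g x).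
Proof. by move=> oU cf cg; exact: ck_add oU cf (ck_opp oU cg). Qed.

Lemma ck_sum n k (U : set 'rV[R]_n) I (r : seq I) (P : pred I)
    (f : I -> 'rV[R]_n -> R) :
  open U -> (forall i, is_Ck k U (f i)) ->
  is_Ck k U (fun x => \sum_(i <- r | P i) f i x).
Proof.
move=> oU cf; elim: r => [|a r IH].
  by apply: ck_eq (ck_cst k U 0) => // x _; rewrite big_nil.
case Pa : (P a).
  by apply: ck_eq (ck_add oU (cf a) IH) => // x _; rewrite big_cons Pa.
by apply: ck_eq IH => // x _; rewrite big_cons Pa.
Qed.

Lemma ck_prod n k (U : set 'rV[R]_n) I (r : seq I) (P : pred I)
    (f : I -> 'rV[R]_n -> R) :
  open U -> (forall i, is_Ck k U (f i)) ->
  is_Ck k U (fun x => \prod_(i <- r | P i) f i x).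
Proof.
move=> oU cf; elim: r => [|a r IH].
  by apply: ck_eq (ck_cst k U (1 : R)) => // x _; rewrite big_nil.
case Pa : (P a).
  by apply: ck_eq (ck_mul oU (cf a) IH) => // x _; rewrite big_cons Pa.
by apply: ck_eq IH => // x _; rewrite big_cons Pa.
Qed.

Lemma derive_coord n (i : 'I_n) (v x : 'rV[R]_n) :
  'D_v (fun x : 'rV[R]_n => x 0 i) x = v 0 i.
Proof.
have /derive_mx : derivable (id : 'rV[R]_n -> 'rV[R]_n) x v by exact: derivable_id.
by rewrite derive_id => /rowP /(_ i); rewrite mxE => ->.
Qed.

Lemma ck_coord n k (U : set 'rV[R]_n) (i : 'I_n) :
  is_Ck k U (fun x : 'rV[R]_n => x 0 i).
Proof.
case: k => [|k] /=; first by move=> x _; exact: coord_continuous.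
split=> [x _|v]; first exact: differentiable_coord.
have -> : (fun x => 'D_v (fun x : 'rV[R]_n => x 0 i) x) = (fun=> v 0 i).
  by apply/funext => x; exact: derive_coord.
exact: ck_cst.
Qed.

Lemma differentiable_rVP n m (f : 'rV[R]_n -> 'rV[R]_m) x :
  differentiable f x <-> forall j, differentiable (fun y => f y 0 j) x.
Proof.
split=> [df j|H].
  exact: differentiable_comp df (differentiable_coord _ _ _).
have -> : f = (fun y => \sum_(j < m) f y 0 j *: delta_mx 0 j).
  by apply/funext => y; rewrite [LHS]matrix_sum_delta big_ord1.
have -> : (fun y => \sum_(j < m) f y 0 j *: delta_mx 0 j) =
   \sum_(j < m) (fun y => f y 0 j *: (delta_mx 0 j : 'rV[R]_m)).
  by apply/funext => y; rewrite fct_sumE.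
by apply: differentiable_sum => j; exact: differentiableZl.
Qed.

Lemma derive_rV n m (f : 'rV[R]_n -> 'rV[R]_m) x v j : differentiable f x ->
  ('D_v f x) 0 j = 'D_v (fun y => f y 0 j) x.
Proof. by move=> df; rewrite derive_mx ?mxE//; exact: diff_derivable. Qed.

Lemma ck_rVP n m k (U : set 'rV[R]_n) (f : 'rV[R]_n -> 'rV[R]_m) : open U ->
  is_Ck k U f <-> forall j, is_Ck k U (fun y => f y 0 j).
Proof.
move=> oU; elim: k f => [|k IH] f.
  split=> [cf j x Ux|H x Ux].
    exact: (@continuous_comp _ _ _ f (fun M : 'rV[R]_m => M 0 j) x (cf x Ux)
      (@coord_continuous _ _ _ 0 j (f x))).
  apply/continuous_eps => e e0.
  apply: (near_rV_norm (nbhs_filter x) (ltW e0)) => j.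
  have /continuous_eps /(_ e e0) := H j x Ux.
  by apply: filterS => y; rewrite !mxE.
split=> [[f1 f2] j|H].
  split=> [x Ux|v]; first exact: (differentiable_rVP _ _).1 (f1 x Ux) j.
  have [/(_ (f2 v) j) + _] := IH ('D_v f).
  by apply: ck_eq => // x Ux; rewrite derive_rV//; exact: f1.
have df x : U x -> differentiable f x.
  by move=> Ux; apply/differentiable_rVP => j; exact: (H j).1 x Ux.
split=> // v; apply/IH => j; have [_ /(_ v)] := H j.
by apply: ck_eq => // x Ux; rewrite derive_rV//; exact: df.
Qed.

Lemma derive_sum_delta n (W : normedModType R) (f : 'rV[R]_n -> W) x v :
  differentiable f x -> 'D_v f x = \sum_i v 0 i *: 'D_(delta_mx 0 i) f x.
Proof.
move=> df; rewrite deriveE//.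
have {1}-> : v = \sum_(i < n) v 0 i *: delta_mx 0 i.
  by rewrite [LHS]matrix_sum_delta big_ord1.
by rewrite linear_sum; apply: eq_bigr => i _; rewrite linearZ deriveE.
Qed.

Lemma derive_comp n m (W : normedModType R) (f : 'rV[R]_m -> W)
    (g : 'rV[R]_n -> 'rV[R]_m) x v :
  differentiable g x -> differentiable f (g x) ->
  'D_v (fun y => f (g y)) x = 'D_('D_v g x) f (g x).
Proof.
move=> dg df; rewrite -[fun y => _]/(f \o g) deriveE; last exact: differentiable_comp.
by rewrite diff_comp//= -deriveE// -deriveE.
Qed.

(** The chain rule, expanded along the coordinates of ['D_v g x], writes the derivative as a sum of
    products of a derivative of g with a partial derivative of f composed with g. The induction
    therefore keeps f general. *)
Lemma ck_comp n m k (U : set 'rV[R]_n) (V : set 'rV[R]_m) (f : 'rV[R]_m -> R)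
    (g : 'rV[R]_n -> 'rV[R]_m) : open U -> open V ->
  (forall x, U x -> V (g x)) -> is_Ck k U g -> is_Ck k V f ->
  is_Ck k U (fun x => f (g x)).
Proof.
move=> oU oV gUV; elim: k f => [|k IH] f.
  move=> cg cf x Ux.
  exact: (@continuous_comp _ _ _ g f x (cg x Ux) (cf _ (gUV _ Ux))).
move=> cg cf; have := (cf, cg) => -[[f1 f2] [g1 g2]]; split=> [x Ux|v].
  by apply: differentiable_comp; [exact: g1|exact/f1/gUV].
have H i : is_Ck k U (fun x => ('D_v g x) 0 i * 'D_(delta_mx 0 i) f (g x)).
  apply: ck_mul => //; last exact: IH (ckS cg) (f2 _).
  by move: i; apply/(ck_rVP _ _ oU)/g2.
have := ck_sum (index_enum 'I_m) xpredT oU H.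
apply: ck_eq => // x Ux; rewrite (derive_comp (f := f) (g := g)) ?(derive_sum_delta (f := f))//.
all: first [exact: (f1 _ (gUV _ Ux)) | exact: (g1 _ Ux)].
Qed.

Lemma ck_comp_rV n m l k (U : set 'rV[R]_n) (V : set 'rV[R]_m)
    (f : 'rV[R]_m -> 'rV[R]_l) (g : 'rV[R]_n -> 'rV[R]_m) : open U -> open V ->
  (forall x, U x -> V (g x)) -> is_Ck k U g -> is_Ck k V f ->
  is_Ck k U (fun x => f (g x)).
Proof.
move=> oU oV gUV cg /(ck_rVP _ _ oV) cf; apply/(ck_rVP _ _ oU) => j.
exact: ck_comp (cf j).
Qed.

Lemma ck_inv n k (U : set 'rV[R]_n) (f : 'rV[R]_n -> R) : open U ->
  (forall x, U x -> f x != 0) -> is_Ck k U f -> is_Ck k U (fun x => (f x)^-1).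
Proof.
move=> oU fn0; elim: k => [|k IH].
  by move=> cf x Ux; exact: continuousV (fn0 x Ux) (cf x Ux).
move=> cf; have [f1 f2] := cf; split=> [x Ux|v].
  by apply: differentiableV; [exact: f1|exact: fn0].
have cV := IH (ckS cf).
have := ck_opp oU (ck_mul oU (ck_mul oU cV cV) (f2 v)).
apply: ck_eq => // x Ux; rewrite deriveV ?fn0//; last by apply: diff_derivable; exact: f1.
by rewrite -[RHS]/(_ * _) expr2 mulNr invfM.
Qed.

Lemma is_derive1_comp_rV n (s ds : R -> R) (f : 'rV[R]_n -> R) x :
  (forall t : R, is_derive t 1 s (ds t : R)) -> differentiable f x ->
  differentiable (fun y => s (f y)) x /\
  forall v, 'D_v (fun y => s (f y)) x = ds (f x) * 'D_v f x.
Proof.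
move=> ds_s df.
have dsf : differentiable s (f x).
  by apply/derivable1_diffP; have [] := ds_s (f x).
have dc : differentiable (s \o f) x by exact: differentiable_comp.
split=> // v; rewrite -[fun y => _]/(s \o f) deriveE// diff_comp//=.
rewrite -[X in 'd s _ X]mulr1 -[_ * 1]/(_ *: 1) linearZ/= -deriveE//.
by rewrite -deriveE// mulrC; congr (_ * _); have [_ <-] := ds_s (f x).
Qed.

(* The class [S] stands for smoothness of [s], as [is_Ck] does not apply to
   functions on [R]. *)
Lemma ck_comp1 n k (U : set 'rV[R]_n) (S : set (R -> R)) (s : R -> R)
    (f : 'rV[R]_n -> R) : open U ->
  (forall s, S s -> exists2 ds, S ds & forall t : R, is_derive t 1 s (ds t : R)) ->
  S s -> is_Ck k U f -> is_Ck k U (fun x => s (f x)).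
Proof.
move=> oU HS; elim: k s => [|k IH] s Ss.
  move=> cf x Ux; have [ds _ H] := HS _ Ss.
  apply: (@continuous_comp _ _ _ f s x (cf x Ux)).
  by apply/differentiable_continuous/derivable1_diffP; have [] := H (f x).
move=> cf; have [f1 f2] := cf; have [ds Sds H] := HS _ Ss; split=> [x Ux|v].
  by have [] := is_derive1_comp_rV H (f1 _ Ux).
have := ck_mul oU (IH _ Sds (ckS cf)) (f2 v).
by apply: ck_eq => // x Ux; have [_ ->] := is_derive1_comp_rV H (f1 _ Ux).
Qed.

End CkCalculus.

(** * Mean value theorem on segments and strict differentiability *)

Section MeanValue.
Context {R : realType} {n : nat}.
Implicit Types (f : 'rV[R]_n -> R) (x y v : 'rV[R]_n).

Lemma is_derive_line f x v (t : R) : derivable f (x + t *: v) v ->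
  is_derive t 1 (fun s : R => f (x + s *: v)) ('D_v f (x + t *: v)).
Proof.
have E : (fun h : R => h^-1 *: (((fun s : R => f (x + s *: v)) \o shift t) (h *: (1 : R)) -
                        f (x + t *: v))) =
         (fun h : R => h^-1 *: ((f \o shift (x + t *: v)) (h *: v) - f (x + t *: v))).
  apply/funext => h /=; congr (_ *: (f _ - _)).
  by rewrite [h *: 1](_ : _ = h) ?scalerDl 1?addrCA//; exact: mulr1.
by move=> df; split; [rewrite /derivable E|rewrite /derive E].
Qed.

Lemma mean_value f x v : (forall t : R, 0 <= t <= 1 -> differentiable f (x + t *: v)) ->
  exists2 t : R, 0 <= t <= 1 & f (x + v) - f x = 'D_v f (x + t *: v).
Proof.
move=> df; pose g (s : R) := f (x + s *: v).
have dg (t : R) : 0 <= t <= 1 -> is_derive t (1 : R) g ('D_v f (x + t *: v)).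
  by move=> t01; apply/is_derive_line/diff_derivable/df.
have [||t t01] := @MVT_segment R g (fun t => 'D_v f (x + t *: v)) 0 1 ler01.
- by move=> t; rewrite in_itv/= => /andP[t0 t1]; apply: dg; rewrite !ltW.
- apply: derivable_within_continuous => t; rewrite in_itv/= => t01.
  by have [] := dg t t01.
rewrite subr0 mulr1 /g scale1r scale0r addr0 => E.
by exists t => //; move: t01; rewrite in_itv.
Qed.

Lemma norm_derive_sum f x v : differentiable f x ->
  `|'D_v f x| <= (\sum_i `|'D_(delta_mx 0 i) f x|) * `|v|.
Proof.
move=> df; rewrite derive_sum_delta// mulr_suml.
apply: (le_trans (ler_norm_sum _ _ _)); apply: ler_sum => i _.
by rewrite normrZ mulrC ler_wpM2l// ler_coord_norm.
Qed.

Lemma norm_derive_diff f x y v : differentiable f x -> differentiable f y ->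
  `|'D_v f y - 'D_v f x| <=
  (\sum_i `|'D_(delta_mx 0 i) f y - 'D_(delta_mx 0 i) f x|) * `|v|.
Proof.
move=> dx dy; rewrite !(derive_sum_delta (f := f))// -sumrB mulr_suml.
apply: (le_trans (ler_norm_sum _ _ _)); apply: ler_sum => i _.
by rewrite -scalerBr normrZ mulrC ler_wpM2l// ler_coord_norm.
Qed.

Lemma near_sum_le (F : set_system 'rV[R]_n) m (g : 'I_m -> 'rV[R]_n -> R) (e : R) :
  Filter F -> 0 < e ->
  (forall i (d : R), 0 < d -> \forall y \near F, `|g i y| <= d) ->
  \forall y \near F, \sum_i `|g i y| <= e.
Proof.
move=> FF e0 H.
have : \forall y \near F, forall i, `|g i y| <= e / m.+1%:R.
  by apply: filter_forall => i; apply: H; rewrite divr_gt0.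
apply: filterS => y Hy; apply: (@le_trans _ _ (\sum_(i < m) e / m.+1%:R)).
  by apply: ler_sum => i _; exact: Hy.
rewrite sumr_const card_ord -[_ *+ m]mulr_natr -mulrA ger_pMr//.
by rewrite mulrC ler_pdivrMr// mul1r ler_nat.
Qed.

(** Mean value theorem on the segment from x to y, which stays in the ball around a, and continuity
    of the partial derivatives at a. Both points being free is what the inverse function theorem and
    the Lipschitz bound for projections rely on. *)
Lemma strict_differentiable f (U : set 'rV[R]_n) (a : 'rV[R]_n) (e : R) : open_nbhs a U ->
  is_Ck 1 U f -> 0 < e -> exists2 d, 0 < d &
  forall x y, `|x - a| < d -> `|y - a| < d ->
    U x /\ `|f y - f x - 'D_(y - x) f a| <= e * `|y - x|.
Proof.
move=> [oU Ua] [df cf] e0.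
have H : \forall y \near a, U y /\
    \sum_i `|'D_(delta_mx 0 i) f y - 'D_(delta_mx 0 i) f a| <= e.
  apply: filterI; first exact: open_nbhs_nbhs.
  apply: (near_sum_le (nbhs_filter a) e0) => i d d0.
  exact: (continuous_eps _ _).1 (cf (delta_mx 0 i) a Ua) d d0.
have /(nbhs_normP a)[d /= d0 Hd] := H.
exists d => // x y xa ya; split; first by apply: (Hd x _).1; rewrite /= distrC.
have Hs t : 0 <= t <= 1 -> `|a - (x + t *: (y - x))| < d.
  move=> /andP[t0 t1].
  have -> : a - (x + t *: (y - x)) = (1 - t) *: (a - x) + t *: (a - y).
    by apply/rowP => i; rewrite !mxE; ring.
  apply: (le_lt_trans (ler_normD _ _)); rewrite !normrZ.
  rewrite !ger0_norm ?subr_ge0// ![`|a - _|]distrC.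
  have [->|tn0] := eqVneq t 0; first by rewrite mul0r addr0 subr0 mul1r.
  have t_gt0 : 0 < t by rewrite lt_def tn0.
  by move: (`|x - a|) (`|y - a|) xa ya => u w; nra.
have [t t01] := @mean_value f x (y - x) (fun t t01 => df _ (Hd _ (Hs t t01)).1).
rewrite [x + _]addrC subrK => ->.
apply: le_trans (norm_derive_diff _ _ _) _.
- exact: df.
- by apply: df; apply: (Hd _ (Hs t t01)).1.
by apply: ler_wpM2r => //; exact: (Hd _ (Hs t t01)).2.
Qed.

End MeanValue.

(** * Local and global Lipschitz constants *)

Section PointwiseLipschitz.
Context {R : realType} {n : nat}.
Implicit Types (f g : 'rV[R]_n -> R) (x y v : 'rV[R]_n) (K : R).

Definition lipschitz_cst K f := forall x y, `|f x - f y| <= K * enorm (x - y).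

(** The upper limit of the quotients |f y - f x| / |y - x| at x is at most K; the slack e absorbs
    all terms of higher order. *)
Definition plip K f x := forall e : R, 0 < e ->
  \forall y \near x, `|f y - f x| <= (K + e) * enorm (y - x).

Lemma lipschitz_plip K f x : lipschitz_cst K f -> plip K f x.
Proof.
move=> Kf e e0; near=> y; apply: le_trans (Kf _ _) _.
by rewrite ler_wpM2r ?enorm_ge0// lerDl ltW.
Unshelve. all: by end_near. Qed.

Lemma plip_le K K' f x : K <= K' -> plip K f x -> plip K' f x.
Proof.
move=> KK' Kf e e0; apply: filterS (Kf e e0) => y H; apply: le_trans H _.
by rewrite ler_wpM2r ?enorm_ge0// lerD2r.
Qed.

Lemma near_eq_plip K f g x : (\near x, f x = g x) -> plip K f x -> plip K g x.
Proof.
move=> fg Kf e e0; have fgx := nbhs_singleton fg.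
by apply: filterS2 fg (Kf e e0) => y <-; rewrite fgx.
Qed.

Lemma plip_continuous K f x : plip K f x -> {for x, continuous f}.
Proof.
move=> Kf; apply/continuous_eps => e e0.
have L0 : 0 < `|K| + 1 by rewrite ltr_wpDl.
have d0 : 0 < e / (`|K| + 1) by rewrite divr_gt0.
apply: filterS2 (Kf 1 ltr01) (near_enorm x d0) => y H1 H2.
apply: le_trans H1 _; apply: (@le_trans _ _ ((`|K| + 1) * enorm (y - x))).
  by rewrite ler_wpM2r ?enorm_ge0// lerD2r ler_norm.
by rewrite mulrC -ler_pdivlMr// ltW.
Qed.

(** A maximum point c of h on [0, 1] must be 0: if c > 0, points slightly to the left of c have
    larger values. *)
Lemma decreasing_germs_le (h : R -> R) : {within `[0, 1], continuous h} ->
  (forall t, 0 < t <= 1 -> \forall s \near t^'-, h t < h s) -> h 1 <= h 0.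
Proof.
move=> ch H; have [c] := EVT_max ler01 ch.
rewrite in_itv/= => /andP[c0 c1] Hc.
have [c_gt0|] := ltP 0 c; last first.
  move=> c_le0; have E : c = 0 by apply/le_anti/andP.
  by rewrite E in Hc; apply: Hc; rewrite in_itv/= ler01 lexx.
have Hs := H c; rewrite c_gt0 c1 in Hs.
have {}Hs := Hs isT.
near c^'- => s.
have : h c < h s by near: s.
rewrite ltNge Hc// in_itv/=; apply/andP; split; first by near: s; exact: nbhs_left_ge.
by apply: le_trans c1; near: s; exact: nbhs_left_le.
Unshelve. all: by end_near. Qed.

(** Along the segment from x to y, f minus the affine function of slope K |y - x| + e decreases
    strictly to the right of its start, and e is arbitrary. Global Lipschitz constants can thus be
    verified pointwise, with a different formula for the function around each point. *)
Lemma plip_lipschitz K f : (forall x, plip K f x) -> lipschitz_cst K f.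
Proof.
move=> Kf.
suff H x y : f y - f x <= K * enorm (y - x).
  by move=> x y; rewrite ler_norml lerNl opprB H enormB H.
have [->|xy] := eqVneq x y; first by rewrite !subrr enorm0 mulr0.
have d0 : 0 < enorm (y - x).
  rewrite lt_def enorm_ge0 andbT; apply: contra xy => /eqP/enorm0_eq0/eqP.
  by rewrite subr_eq0 eq_sym.
apply/ler_addgt0Pr => e e0.
pose L := K * enorm (y - x) + e.
pose g (t : R) := f (x + t *: (y - x)).
pose h (t : R) := g t - g 0 - L * t.
have E1 : h 1 = f y - f x - L by rewrite /h /g scale0r addr0 scale1r [x + _]addrC subrK mulr1.
have E0 : h 0 = 0 by rewrite /h subrr mulr0 subr0.
rewrite -subr_le0 -[K * _ + e]/L -E1 -E0.
have cl (t : R) : {for t, continuous (fun s : R => x + s *: (y - x))}.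
  apply: continuousD; first exact: cst_continuous.
  exact: scalel_continuous.
have cg : continuous g.
  by move=> t; apply: (continuous_comp (cl t)); exact/plip_continuous/Kf.
have ch (t : R) : {for t, continuous h}.
  apply: (@continuousB _ _ _ (fun t : R => g t - g 0) (fun t : R => L * t)).
    apply: (@continuousB _ _ _ g (fun=> g 0)); first exact: cg.
    exact: cst_continuous.
  exact: mulrl_continuous.
apply: decreasing_germs_le.
  by apply: continuous_subspaceT => t; exact: ch.
move=> t _.
(* Half of the slack e is spent here; the other half makes the decrease of h strict. *)
have e' : 0 < e / enorm (y - x) / 2 by rewrite !divr_gt0.
have := cl t _ (Kf (x + t *: (y - x)) _ e') => {}Kt.
have {}Kt : \forall s \near t, `|g s - g t| <= (K + e / enorm (y - x) / 2) * enorm ((s - t) *: (y - x)).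
  have Kt' : \forall s \near t, `|g s - g t| <= (K + e / enorm (y - x) / 2) *
    enorm (x + s *: (y - x) - (x + t *: (y - x))) by exact: Kt.
  by apply: filterS Kt' => s; rewrite opprD addrACA subrr add0r -scalerBl.
near=> s.
have st : s < t by near: s; exact: nbhs_left_lt.
have : `|g s - g t| <= (K + e / enorm (y - x) / 2) * enorm ((s - t) *: (y - x)).
  by near: s; apply: cvg_at_left_filter Kt; exact: cvg_id.
rewrite enormZ [`|s - t|]ltr0_norm ?subr_lt0// opprB.
rewrite [X in _ <= X](_ : _ = (t - s) * (K * enorm (y - x) + e / 2)); last first.
  by field; rewrite gt_eqF.
rewrite ler_norml => /andP[H _].
rewrite /h /L; have : 0 < (t - s) * (e / 2) by rewrite mulr_gt0 ?divr_gt0 ?subr_gt0.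
move: H; set k := K * _ => H1 H2; nra.
Unshelve. all: by end_near. Qed.

(** The increment splits into (1 - phi x) times that of f, phi x times that of g, and the increment
    of phi times g - f. The last term is weighted by |g x - f x|: a steep phi is harmless where f
    and g are close. All gluings below are estimated in this way. *)
Lemma plip_mix Kf Kg c f g (phi : 'rV[R]_n -> R) x : 0 <= Kf -> 0 <= Kg -> 0 <= c ->
  0 <= phi x <= 1 -> plip Kf f x -> plip Kg g x -> plip c phi x ->
  plip ((1 - phi x) * Kf + phi x * Kg + c * `|g x - f x|)
    (fun y => f y + phi y * (g y - f y)) x.
Proof.
move=> Kf0 Kg0 c0 /andP[p0 p1] Hf Hg Hp e e0.
(* The excess will be d (1 + c + |g x - f x| + d), at most e because d <= 1. *)
pose d := Num.min 1 (e / (2 + c + `|g x - f x|)).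
have B0 : 0 < 2 + c + `|g x - f x| by rewrite -addrA ltr_wpDr ?addr_ge0.
have d0 : 0 < d by rewrite /d lt_min ltr01 divr_gt0.
have d1 : d <= 1 by rewrite /d ge_min lexx.
have de : d * (2 + c + `|g x - f x|) <= e.
  by rewrite -ler_pdivlMr// /d ge_min lexx orbT.
have cgf : {for x, continuous (fun y => g y - f y)}.
  exact: continuousB (plip_continuous Hg) (plip_continuous Hf).
have Hc := (continuous_eps _ _).1 cgf d d0.
near=> y.
have h1 : `|f y - f x| <= (Kf + d) * enorm (y - x) by near: y; exact: Hf.
have h2 : `|g y - g x| <= (Kg + d) * enorm (y - x) by near: y; exact: Hg.
have h3 : `|phi y - phi x| <= (c + d) * enorm (y - x) by near: y; exact: Hp.
have h4 : `|g y - f y - (g x - f x)| <= d by near: y; exact: Hc.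
have E : f y + phi y * (g y - f y) - (f x + phi x * (g x - f x)) =
  (1 - phi x) * (f y - f x) + phi x * (g y - g x) + (phi y - phi x) * (g y - f y).
  by ring.
rewrite E; apply: (le_trans (ler_normD _ _)).
apply: (le_trans (lerD (ler_normD _ _) (lexx _))).
rewrite !normrM (ger0_norm p0) (ger0_norm (_ : 0 <= 1 - phi x)) ?subr_ge0//.
have h5 : `|g y - f y| <= `|g x - f x| + d.
  by rewrite -lerBlDl; apply: le_trans (lerB_dist _ _) h4.
have h6 : `|phi y - phi x| * `|g y - f y| <= (c + d) * enorm (y - x) * (`|g x - f x| + d).
  by apply: ler_pM.
have h7 : (1 - phi x) * `|f y - f x| <= (1 - phi x) * ((Kf + d) * enorm (y - x)).
  by rewrite ler_wpM2l ?subr_ge0.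
have h8 : phi x * `|g y - g x| <= phi x * ((Kg + d) * enorm (y - x)).
  by rewrite ler_wpM2l.
apply: (le_trans (lerD (lerD h7 h8) h6)).
have -> : (1 - phi x) * ((Kf + d) * enorm (y - x)) + phi x * ((Kg + d) * enorm (y - x)) +
  (c + d) * enorm (y - x) * (`|g x - f x| + d) =
  ((1 - phi x) * Kf + phi x * Kg + c * `|g x - f x| + d * (1 + c + `|g x - f x| + d)) * enorm (y - x).
  by ring.
rewrite ler_wpM2r ?enorm_ge0// lerD2l; apply: le_trans de.
by apply: ler_wpM2l; [exact: ltW|lra].
Unshelve. all: by end_near. Qed.

(** The crude bound by the sum of the partial derivatives suffices: wherever it enters below, it
    multiplies a difference that is chosen small afterwards. *)
Lemma differentiable_plip f x : differentiable f x ->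
  plip (\sum_i `|'D_(delta_mx 0 i) f x|) f x.
Proof.
move=> df e e0; apply: filterS (diff_eps df e0) => y H.
have -> : f y - f x = (f y - f x - 'd f x (y - x)) + 'd f x (y - x) by rewrite subrK.
apply: (le_trans (ler_normD _ _)); rewrite mulrDl addrC lerD//.
  rewrite -deriveE//; apply: le_trans (norm_derive_sum _ _) _ => //.
  by rewrite ler_wpM2l ?ler_norm_enorm ?sumr_ge0.
by apply: le_trans H _; rewrite ler_wpM2l ?ler_norm_enorm ?ltW.
Qed.

End PointwiseLipschitz.

(** * Mollification *)

Section FlatExponential.
Context {R : realType}.
Implicit Types (p : {poly R}) (t u : R).

(* The polynomial factor makes this family closed under differentiation. *)
Definition flat_exp p t : R := if 0 < t then p.[t^-1] * expR (- t^-1) else 0.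

(** Raise u / m <= exp (u / m) to the power m. *)
Lemma exprn_expRN_bound m u : 0 <= u -> u ^+ m * expR (- u) <= m%:R ^+ m.
Proof.
move=> u0; case: m => [|m].
  by rewrite !expr0 mul1r -expR0 ler_expR oppr_le0.
have m0 : 0 < m.+1%:R :> R by [].
rewrite expRN -ler_pdivlMr ?invr_gt0 ?expR_gt0// invrK mulrC.
rewrite -ler_pdivrMr ?exprn_gt0// -expr_div_n.
have -> : expR u = expR (u / m.+1%:R) ^+ m.+1.
  by rewrite -expRM_natl mulrC divfK// gt_eqF.
rewrite ler_pXn2r ?nnegrE ?divr_ge0 ?expR_ge0//.
by apply: le_trans (expR_ge1Dx _); rewrite lerDr.
Qed.

Lemma horner_bound p u : 1 <= u ->
  `|p.[u]| <= (\sum_(i < size p) `|p`_i|) * u ^+ size p.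
Proof.
move=> u1; rewrite horner_coef mulr_suml.
apply: (le_trans (ler_norm_sum _ _ _)); apply: ler_sum => i _.
rewrite normrM ler_wpM2l// normrX ger0_norm ?(le_trans ler01)//.
by rewrite ler_weXn2l// ltnW.
Qed.

(** With u = 1 / t, the polynomial grows at most like u^(size p), while u^(size p + 2) exp (-u) is
    bounded. The two spare powers give t^2, which forces the derivative 0 at the origin. *)
Lemma flat_exp_bound p : exists2 C, 0 <= C &
  forall t, `|t| <= 1 -> `|flat_exp p t| <= C * t ^+ 2.
Proof.
pose N := (size p).+2.
have [K K0 HK] : exists2 K : R, 0 <= K & forall u, 0 <= u -> u ^+ N * expR (- u) <= K.
  by exists (N%:R ^+ N) => [|u]; [exact: exprn_ge0|exact: exprn_expRN_bound].
exists ((\sum_(i < size p) `|p`_i|) * K) => [|t t1].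
  by rewrite mulr_ge0 ?sumr_ge0.
rewrite /flat_exp; case: ifPn => t0; last first.
  rewrite normr0; apply: mulr_ge0; last exact: sqr_ge0.
  by rewrite mulr_ge0 ?sumr_ge0.
have u1 : 1 <= t^-1 by rewrite invf_ge1//; apply: le_trans t1; exact: ler_norm.
rewrite normrM (ger0_norm (expR_ge0 _)).
apply: (@le_trans _ _ ((\sum_(i < size p) `|p`_i|) * t^-1 ^+ size p * expR (- t^-1))).
  by rewrite ler_wpM2r ?expR_ge0// horner_bound.
rewrite -!mulrA ler_wpM2l ?sumr_ge0//.
rewrite [leLHS](_ : _ = (t^-1 ^+ N * expR (- t^-1)) * t ^+ 2).
  by rewrite ler_wpM2r ?sqr_ge0// HK// (le_trans ler01).
rewrite /N -addn2 exprD -!mulrA; congr (_ * _).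
by set E := expR _; field; rewrite gt_eqF.
Qed.

Lemma is_derive_flat0 (f : R -> R) C t0 : f t0 = 0 ->
  (forall t, `|t - t0| <= 1 -> `|f t| <= C * (t - t0) ^+ 2) -> is_derive t0 1 f 0.
Proof.
move=> f0 HC; have C0 : 0 <= C.
  have := HC (t0 + 1); rewrite addrAC subrr add0r normr1 expr1n mulr1 => /(_ (lexx _)).
  exact: le_trans.
have [] := @eps_diff R R R f t0 ('d (cst (0 : R)) t0).
- exact/diff_continuous/differentiable_cst.
- move=> e e0; have d0 : 0 < Num.min 1 (e / (C + 1)).
    by rewrite lt_min ltr01 divr_gt0// ltr_wpDl.
  near=> t; rewrite f0 diff_cst !subr0.
  have : `|t - t0| <= Num.min 1 (e / (C + 1)).
    by rewrite distrC; near: t; apply: cvgr_dist_le => //; exact: cvg_id.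
  rewrite le_min => /andP[t1 te]; apply: (le_trans (HC t t1)).
  rewrite -real_normK ?num_real// expr2 mulrA ler_wpM2r//.
  rewrite ler_pdivlMr ?ltr_wpDl// in te; apply: le_trans te.
  by rewrite mulrC ler_wpM2l// lerDl.
- move=> df dE; apply: DeriveDef; first exact/derivable1_diffP.
  by rewrite deriveE// dE diff_cst.
Unshelve. all: by end_near. Qed.

(** For t > 0 the chain rule brings out 1 / t^2 from both factors, with opposite signs, whence the
    polynomial X^2 (p - p') in 1 / t; at t = 0 the quadratic bound applies. *)
Lemma derivative_flat_exp p t :
  is_derive t 1 (flat_exp p) (flat_exp ('X^2 * (p - p^`())) t).
Proof.
have [t0|t0|E] := ltgtP t 0.
- have -> : flat_exp ('X^2 * (p - p^`())) t = 0 by rewrite /flat_exp ltNge ltW.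
  apply: (@near_eq_is_derive _ R R (cst (0 : R))).
  near=> s; rewrite /flat_exp ltNge ltW//.
  by near: s; exact: lt_nbhsl.
- have tn0 : t != 0 by rewrite gt_eqF.
  have dV : is_derive t 1 (fun s : R => s^-1) (- t ^- 2).
    have := @is_deriveV R id t 1 1 tn0 (is_derive_id t (1 : R)).
    by rewrite (_ : _ *: 1 = - t ^- 2)//; exact: mulr1.
  have dN : is_derive t 1 (fun s : R => - s^-1) (t ^- 2).
    by rewrite -[t ^- 2]opprK; exact: is_deriveN.
  have dE : is_derive t 1 (fun s : R => expR (- s^-1)) (expR (- t^-1) * t ^- 2).
    exact: (@is_derive1_comp _ expR (fun s => - s^-1)).
  have dp : is_derive t 1 (fun s : R => p.[s^-1]) (p^`().[t^-1] * - t ^- 2).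
    exact: (@is_derive1_comp _ (horner p) (fun s => s^-1) _ _ _ (is_derive_poly p _)).
  apply: (@near_eq_is_derive _ R R (fun s => p.[s^-1] * expR (- s^-1))).
    near=> s; rewrite /flat_exp ifT//.
    by near: s; exact: lt_nbhsr.
  apply: is_derive_eq; rewrite /flat_exp t0 hornerM hornerXn hornerD hornerN.
  rewrite -!/(_ * _) exprVn; set x := p.[_]; set y := _.[_].
  by rewrite -[_ *: _]/(_ * _) -[X in _ + X]/(_ * _); ring.
- rewrite E; have -> : flat_exp ('X^2 * (p - p^`())) 0 = 0 by rewrite /flat_exp ltxx.
  have [C C0 HC] := flat_exp_bound p.
  apply: (@is_derive_flat0 _ C); first by rewrite /flat_exp ltxx.
  by move=> s; rewrite subr0; exact: HC.
Unshelve. all: by end_near. Qed.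

Lemma flat_exp_ge0 p t : (forall u, 0 < u -> 0 <= p.[u]) -> 0 <= flat_exp p t.
Proof.
move=> p0; rewrite /flat_exp; case: ifP => // t0.
by rewrite mulr_ge0 ?expR_ge0 ?p0 ?invr_gt0.
Qed.

Lemma flat_exp1_gt0 t : 0 < t -> 0 < flat_exp 1 t.
Proof. by move=> t0; rewrite /flat_exp t0 hornerC mul1r expR_gt0. Qed.

Lemma flat_exp_le0 p t : t <= 0 -> flat_exp p t = 0.
Proof. by move=> t0; rewrite /flat_exp ltNge t0. Qed.

Lemma ck_flat_exp n k (U : set 'rV[R]_n) (f : 'rV[R]_n -> R) p : open U ->
  is_Ck k U f -> is_Ck k U (fun x => flat_exp p (f x)).
Proof.
move=> oU; apply: (@ck_comp1 _ _ _ _ (range flat_exp) (flat_exp p)) => //.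
move=> _ [q _ <-]; exists (flat_exp ('X^2 * (q - q^`()))); first by eexists.
by move=> t; exact: derivative_flat_exp.
Qed.

(** The transition takes place inside [1/4, 3/4], so that the step remains locally constant when its
    argument is known to be 0 or 1 only up to an error less than 1/4. *)
Definition smooth_step t : R :=
  flat_exp 1 (t - 4^-1) / (flat_exp 1 (t - 4^-1) + flat_exp 1 (3 / 4 - t)).

Lemma smooth_step_den t : 0 < flat_exp 1 (t - 4^-1) + flat_exp 1 (3 / 4 - t).
Proof.
have f0 s : 0 <= flat_exp 1 s by apply: flat_exp_ge0 => u _; rewrite hornerC.
have [t2|t2] := ltP 4^-1 t.
  by rewrite ltr_pwDl// flat_exp1_gt0// subr_gt0.
rewrite ltr_wpDl// flat_exp1_gt0// subr_gt0; lra.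
Qed.

Lemma smooth_step_itv t : 0 <= smooth_step t <= 1.
Proof.
have f0 s : 0 <= flat_exp 1 s by apply: flat_exp_ge0 => u _; rewrite hornerC.
apply/andP; split; first exact: divr_ge0 (ltW (smooth_step_den t)).
by rewrite /smooth_step ler_pdivrMr ?smooth_step_den// mul1r lerDl.
Qed.

Lemma smooth_step0 t : t <= 4^-1 -> smooth_step t = 0.
Proof. by move=> t0; rewrite /smooth_step flat_exp_le0 ?mul0r// subr_le0. Qed.

Lemma smooth_step1 t : 3 / 4 <= t -> smooth_step t = 1.
Proof.
move=> t1; have := smooth_step_den t; rewrite /smooth_step.
rewrite (@flat_exp_le0 _ (3 / 4 - t)) ?subr_le0// addr0 => H.
by rewrite divff// gt_eqF.
Qed.

Lemma ck_smooth_step n k (U : set 'rV[R]_n) (f : 'rV[R]_n -> R) : open U ->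
  is_Ck k U f -> is_Ck k U (fun x => smooth_step (f x)).
Proof.
move=> oU cf.
have c1 : is_Ck k U (fun x => flat_exp 1 (f x - 4^-1)).
  by apply: ck_flat_exp => //; apply: ck_sub2 => //; exact: ck_cst.
have c2 : is_Ck k U (fun x => flat_exp 1 (3 / 4 - f x)).
  by apply: ck_flat_exp => //; apply: ck_sub2 => //; exact: ck_cst.
apply: ck_mul => //; apply: ck_inv => //; last exact: ck_add.
by move=> x _; rewrite gt_eqF ?smooth_step_den.
Qed.

End FlatExponential.

(** * One-dimensional integration over [-3, 3] *)

Section IntervalIntegral.
Context {R : realType}.
Implicit Types (phi psi : R -> R) (t s : R).

(* Integrals are taken over [-3, 3], for functions vanishing outside [-2, 2]; the
   margin allows translations by at most 1. *)
Lemma exists_primitive phi : continuous phi ->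
  exists F : R -> R, forall t, -5 < t < 5 -> is_derive t 1 F (phi t).
Proof.
move=> cphi; pose mu := @lebesgue_measure R.
have iphi : mu.-integrable [set` Interval (BLeft (-6)) (BRight 6)] (EFin \o phi).
  apply: continuous_compact_integrable; first exact: segment_compact.
  exact: continuous_subspaceT.
exists (fun x => \int[mu]_(t in [set` Interval (BLeft (-6)) (BRight x)]) phi t)%R.
move=> t /andP[t1 t2].
have [||dF dE] := @continuous_FTC1 R phi (BLeft (-6)) t 6 _ iphi _ (cphi t).
- lra.
- by rewrite /Order.lt/=; lra.
by apply: DeriveDef; rewrite -?derive1E.
Qed.

Lemma derive_const_itv (F : R -> R) a b :
  (forall t, a <= t <= b -> is_derive t 1 F 0) -> a <= b -> F a = F b.
Proof.
move=> dF ab; have [||t _] := @MVT_segment R F (fun=> 0) a b ab.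
- by move=> t; rewrite in_itv/= => /andP[t0 t1]; apply: dF; rewrite !ltW.
- apply: derivable_within_continuous => t; rewrite in_itv/= => t01.
  by have [] := dF t t01.
by rewrite mul0r => /eqP; rewrite subr_eq0 => /eqP.
Qed.

(** The value 0 is a default for functions without a primitive on ]-5, 5[; continuous functions have
    one. *)
Definition primitive phi : R -> R :=
  if pselect (exists F : R -> R, forall t, -5 < t < 5 -> is_derive t 1 F (phi t))
  is left H then projT1 (cid H) else fun=> 0.

Definition integ phi : R := primitive phi 3 - primitive phi (-3).

Lemma integP phi : continuous phi -> exists2 F : R -> R,
  integ phi = F 3 - F (-3) & forall t, -5 < t < 5 -> is_derive t 1 F (phi t).
Proof.
move=> cphi; exists (primitive phi) => //; rewrite /primitive.
by case: pselect => [H|/(_ (exists_primitive cphi))//]; exact: projT2 (cid H).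
Qed.

(** Two primitives differ by a constant. The interval ]-4, 4[ is what remains valid of ]-5, 5[ after
    a translation by at most 1. *)
Lemma integE phi (G : R -> R) : continuous phi ->
  (forall t, -4 < t < 4 -> is_derive t 1 G (phi t)) -> integ phi = G 3 - G (-3).
Proof.
move=> cphi dG; have [F -> dF] := integP cphi.
suff : (F - G) (-3) = (F - G) 3.
  rewrite -[X in X = _]/(F (-3) - G (-3)) -[X in _ = X]/(F 3 - G 3); lra.
apply: derive_const_itv; last lra.
move=> t /andP[t1 t2]; rewrite -[0](subrr (phi t)).
by apply: is_deriveB; [apply: dF|apply: dG]; lra.
Qed.

Lemma integ_lin a phi psi : continuous phi -> continuous psi ->
  integ (fun t => a * phi t + psi t) = a * integ phi + integ psi.
Proof.
move=> cphi cpsi; have [F -> dF] := integP cphi; have [G -> dG] := integP cpsi.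
have c1 : continuous (fun t => a * phi t + psi t).
  move=> t; apply: (@continuousD _ _ _ (fun t => a * phi t) psi); last exact: cpsi.
  by apply: (@continuousM _ _ (fun=> a) phi); [exact: cst_continuous|exact: cphi].
have d1 t : -4 < t < 4 -> is_derive t 1 (fun t => a * F t + G t) (a * phi t + psi t).
  move=> t4; apply: (@is_deriveD _ _ _ (fun t => a * F t) G).
    by apply: (@is_deriveZ _ _ _ F a); apply: dF; lra.
  by apply: dG; lra.
by rewrite (integE c1 d1); ring.
Qed.

Lemma integ_cst c : integ (fun=> c) = 6 * c.
Proof.
have c1 : continuous (fun _ : R => c) by move=> t; exact: cst_continuous.
have d1 t : -4 < t < 4 -> is_derive t 1 (fun t => c * t) c.
  move=> _; have := @is_deriveZ _ _ _ id c t 1 1 (is_derive_id _ _).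
  by rewrite [c *: _](_ : _ = c)//; exact: mulr1.
by rewrite (integE c1 d1); ring.
Qed.

Lemma primitive_le (F : R -> R) phi a b : -5 < a -> a <= b -> b < 5 ->
  (forall t, -5 < t < 5 -> is_derive t 1 F (phi t)) ->
  (forall t, a <= t <= b -> 0 <= phi t) -> F a <= F b.
Proof.
move=> a5 ab b5 dF p0; have [||c] := @MVT_segment R F phi a b ab.
- by move=> t; rewrite in_itv/= => t01; apply: dF; lra.
- apply: derivable_within_continuous => t; rewrite in_itv/= => t01.
  by have [] : is_derive t 1 F (phi t) by apply: dF; lra.
rewrite in_itv/= => cab E; rewrite -subr_ge0 E mulr_ge0 ?subr_ge0//.
exact: p0.
Qed.

Lemma integ_ge0 phi : continuous phi -> (forall t, 0 <= phi t) -> 0 <= integ phi.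
Proof.
move=> cphi p0; have [F -> dF] := integP cphi; rewrite subr_ge0.
by apply: (primitive_le _ _ _ dF) => //; lra.
Qed.

Lemma integ_gt0 phi : continuous phi -> (forall t, 0 <= phi t) -> 0 < phi 0 ->
  0 < integ phi.
Proof.
move=> cphi p0 pp; have [F -> dF] := integP cphi.
have : \forall t \near (0 : R), `|phi t - phi 0| <= phi 0 / 2.
  by apply: (continuous_eps _ _).1; [exact: cphi|rewrite divr_gt0].
move=> /(nbhs_normP (0 : R))[d /= d0 Hd].
pose e := Num.min 1 (d / 2).
have e0 : 0 < e by rewrite lt_min ltr01 divr_gt0.
have e1 : e <= 1 by rewrite ge_min lexx.
have ed : e < d by rewrite gt_min; apply/orP; right; lra.
have H1 : F (-3) <= F 0 by apply: (primitive_le _ _ _ dF) => //; lra.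
have H2 : F e <= F 3 by apply: (primitive_le _ _ _ dF) => //; lra.
have [||c] := @MVT_segment R F phi 0 e (ltW e0).
- by move=> t; rewrite in_itv/= => t01; apply: dF; lra.
- apply: derivable_within_continuous => t; rewrite in_itv/= => t01.
  by have [] : is_derive t 1 F (phi t) by apply: dF; lra.
rewrite in_itv/= => /andP[c0 ce] E.
have : `|phi c - phi 0| <= phi 0 / 2.
  by apply: Hd => /=; rewrite sub0r normrN ger0_norm//; lra.
rewrite ler_norml => /andP[H3 _].
have H4 : 0 < F e - F 0 by rewrite E subr0 mulr_gt0//; lra.
lra.
Qed.

(** The translate of a primitive F is a primitive of the translate. As phi vanishes on [2, 4] and
    [-4, -2], F is constant on both, and moving the endpoints 3 and -3 by s changes nothing. *)
Lemma integ_shift phi s : continuous phi -> `|s| <= 1 ->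
  (forall t, 2 <= `|t| -> phi t = 0) -> integ (fun t => phi (t + s)) = integ phi.
Proof.
move=> cphi; rewrite ler_norml => s1 p0; have [F FE dF] := integP cphi.
have c1 : continuous (fun t => phi (t + s)).
  move=> t; apply: (@continuous_comp _ _ _ (fun t => t + s) phi); last exact: cphi.
  by apply: (@continuousD _ _ _ id (fun=> s)); [exact: cvg_id|exact: cst_continuous].
have d1 t : -4 < t < 4 -> is_derive t 1 (fun t => F (t + s)) (phi (t + s)).
  move=> t4; rewrite -[phi _]mulr1.
  apply: (@is_derive1_comp _ F (fun t => t + s)); first by apply: dF; lra.
  by rewrite -[X in is_derive _ _ _ X]addr0; exact: is_deriveD.
rewrite (integE c1 d1).
have F1 a b : 2 <= a -> a <= b -> b <= 4 -> F a = F b.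
  move=> a2 ab b4; apply: derive_const_itv => // t tab.
  by rewrite -(p0 t); [apply: dF|rewrite ger0_norm]; lra.
have F2 a b : -4 <= a -> a <= b -> b <= -2 -> F a = F b.
  move=> a2 ab b4; apply: derive_const_itv => // t tab.
  by rewrite -(p0 t); [apply: dF|rewrite ler0_norm]; lra.
have E1 : F 2 = F (3 + s) by apply: F1; lra.
have E2 : F 2 = F 3 by apply: F1; lra.
have E3 : F (-3 + s) = F (-2) by apply: F2; lra.
have E4 : F (-3) = F (-2) by apply: F2; lra.
by rewrite FE -E1 -E2 E3 E4.
Qed.

Lemma integ_le phi psi : continuous phi -> continuous psi ->
  (forall t, phi t <= psi t) -> integ phi <= integ psi.
Proof.
move=> cphi cpsi H; have := integ_lin (-1) cphi cpsi.
have : 0 <= integ (fun t => -1 * phi t + psi t); last lra.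
apply: integ_ge0 => [t|t]; last by have := H t; lra.
apply: (@continuousD _ _ _ (fun t => -1 * phi t) psi); last exact: cpsi.
by apply: (@continuousM _ _ (fun=> -1) phi); [exact: cst_continuous|exact: cphi].
Qed.

Lemma integ_norm_le phi c : continuous phi -> (forall t, `|phi t| <= c) ->
  `|integ phi| <= 6 * c.
Proof.
move=> cphi H; have cc (a : R) : continuous (fun _ : R => a) by move=> t; exact: cst_continuous.
rewrite ler_norml -mulrN -!integ_cst !integ_le//.
- by move=> t; have := H t; rewrite ler_norml => /andP[].
- by move=> t; have := H t; rewrite ler_norml => /andP[].
Qed.

End IntervalIntegral.

(** * Integration over a cube, one coordinate at a time *)

Section IteratedIntegral.
Context {R : realType} {n : nat}.
Implicit Types (phi psi : 'rV[R]_n -> R) (x y v : 'rV[R]_n) (s : seq 'I_n).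

Local Notation e_ i := (delta_mx 0 i : 'rV[R]_n).

(** Uniform continuity passes directly to integrals in one coordinate and so carries the induction
    over the coordinates. *)
Definition ucont phi := forall e : R, 0 < e -> exists2 d : R, 0 < d &
  forall x y, `|x - y| < d -> `|phi x - phi y| <= e.

Lemma ucont_continuous phi : ucont phi -> continuous phi.
Proof.
move=> uphi x; apply/continuous_eps => e e0.
have [d d0 H] := uphi e e0; near=> y; apply: H.
rewrite distrC; near: y; apply: cvgr_dist_lt => //; exact: cvg_id.
Unshelve. all: by end_near. Qed.

Lemma continuous_line phi x v : continuous phi ->
  continuous (fun t : R => phi (x + t *: v)).
Proof.
move=> cphi t; apply: (@continuous_comp _ _ _ (fun t : R => x + t *: v) phi).
  by apply: continuousD; [exact: cst_continuous|exact: scalel_continuous].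
exact: cphi.
Qed.

(** The i-th variable is not removed: the integral runs over [x_i - 3, x_i + 3], so that all stages
    of the iteration are functions on the same space. *)
Definition integ_coord (i : 'I_n) phi x : R := integ (fun t => phi (x + t *: e_ i)).

Lemma ucont_lin a phi psi : ucont phi -> ucont psi ->
  ucont (fun x => a * phi x + psi x).
Proof.
move=> u1 u2 e e0; have a0 : 0 < `|a| + 1 by rewrite ltr_wpDl.
have [d1 d10 H1] := u1 (e / 2 / (`|a| + 1)) (divr_gt0 (divr_gt0 e0 (ltr0Sn R 1)) a0).
have [d2 d20 H2] := u2 (e / 2) (divr_gt0 e0 (ltr0Sn R 1)).
exists (Num.min d1 d2); first by rewrite lt_min d10.
move=> x y; rewrite lt_min => /andP[/H1 h1 /H2 h2].
rewrite opprD addrACA -mulrBr; apply: (le_trans (ler_normD _ _)).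
rewrite (splitr e) lerD// normrM.
apply: (@le_trans _ _ ((`|a| + 1) * (e / 2 / (`|a| + 1)))).
  by apply: ler_pM => //; rewrite lerDl.
by rewrite mulrC divfK// gt_eqF.
Qed.

Lemma ucont_integ_coord i phi : ucont phi -> ucont (integ_coord i phi).
Proof.
move=> uphi e e0; have [d d0 H] := uphi (e / 6) (divr_gt0 e0 (ltr0Sn R 5)).
exists d => // x y xy; have cphi := ucont_continuous uphi.
have cl z : continuous (fun t : R => phi (z + t *: e_ i)) by exact: continuous_line.
have := integ_lin (-1) (cl y) (cl x).
rewrite /integ_coord mulN1r addrC => <-.
rewrite [e](_ : _ = 6 * (e / 6)); last by field.
apply: integ_norm_le => [t|t].
  apply: (@continuousD _ _ _ (fun t : R => -1 * phi (y + t *: e_ i))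
    (fun t : R => phi (x + t *: e_ i))); last exact: cl.
  apply: (@continuousM _ _ (fun=> -1) (fun t : R => phi (y + t *: e_ i))).
    exact: cst_continuous.
  exact: cl.
by rewrite mulN1r addrC; apply: H; rewrite opprD addrACA subrr addr0.
Qed.

Definition integ_seq s phi := foldr integ_coord phi s.

Lemma ucont_integ_seq s phi : ucont phi -> ucont (integ_seq s phi).
Proof. by move=> u; elim: s => //= i s IH; exact: ucont_integ_coord. Qed.

Lemma integ_seq_lin s a phi psi : ucont phi -> ucont psi ->
  integ_seq s (fun x => a * phi x + psi x) =
  (fun x => a * integ_seq s phi x + integ_seq s psi x).
Proof.
move=> u1 u2; elim: s => //= i s ->; apply/funext => x.
rewrite /integ_coord; apply: integ_lin; apply: continuous_line;
  exact/ucont_continuous/ucont_integ_seq.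
Qed.

Lemma integ_seq_ge0 s phi : ucont phi -> (forall x, 0 <= phi x) ->
  forall x, 0 <= integ_seq s phi x.
Proof.
move=> u p0; elim: s => //= i s IH x; apply: integ_ge0 => //.
exact/continuous_line/ucont_continuous/ucont_integ_seq.
Qed.

Lemma integ_seq_gt0 s phi x : ucont phi -> (forall x, 0 <= phi x) -> 0 < phi x ->
  0 < integ_seq s phi x.
Proof.
move=> u p0 px; elim: s => //= i s IH; apply: integ_gt0.
- exact/continuous_line/ucont_continuous/ucont_integ_seq.
- by move=> t; exact: integ_seq_ge0.
- by rewrite scale0r addr0.
Qed.

Lemma integ_seq_norm_le s phi c : ucont phi -> (forall x, `|phi x| <= c) ->
  forall x, `|integ_seq s phi x| <= 6 ^+ size s * c.
Proof.
move=> u pc; elim: s => [|i s IH] x /=; first by rewrite expr0 mul1r.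
rewrite exprS -mulrA; apply: integ_norm_le => //.
exact/continuous_line/ucont_continuous/ucont_integ_seq.
Qed.

Lemma integ_seq_translate s phi v x :
  integ_seq s (fun y => phi (y + v)) x = integ_seq s phi (x + v).
Proof.
elim: s x => //= i s IH x; rewrite /integ_coord; congr integ.
by apply/funext => t; rewrite IH addrAC.
Qed.

Lemma integ_seq_supp i s phi : i \notin s ->
  (forall x, 2 <= `|x 0 i| -> phi x = 0) ->
  forall x, 2 <= `|x 0 i| -> integ_seq s phi x = 0.
Proof.
move=> + p0; elim: s => //= j s IH; rewrite inE negb_or => /andP[ij /IH H] x xi.
rewrite /integ_coord (_ : (fun t => _) = (fun=> 0)) ?integ_cst ?mulr0//.
apply/funext => t; apply: H; rewrite !mxE eqxx/= (negbTE ij) mulr0 addr0//.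
Qed.

(** Moving x by at most 1 in a coordinate that has been integrated keeps the support inside the
    window of integration. At the step that integrates the i-th coordinate this is [integ_shift];
    the other steps commute with the move. *)
Lemma integ_seq_invariant i s phi x : uniq s -> i \in s -> ucont phi ->
  (forall x, 2 <= `|x 0 i| -> phi x = 0) -> `|x 0 i| <= 1 ->
  integ_seq s phi (x - x 0 i *: e_ i) = integ_seq s phi x.
Proof.
move=> us + u p0; elim: s us x => //= j s IH /andP[js us] x.
rewrite inE; case: (eqVneq i j) => [E|ij] /= => [_ xi|si xi].
  rewrite -E in js *; rewrite /integ_coord; set x0 := x - x 0 i *: e_ i.
  rewrite -(integ_shift (s := x 0 i))//.
  - congr integ; apply/funext => t; congr (integ_seq _ _ _).
    by rewrite /x0 scalerDl [t *: _ + _]addrC addrA subrK.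
  - exact/continuous_line/ucont_continuous/ucont_integ_seq.
  move=> t t2; apply: (integ_seq_supp js p0).
  by rewrite !mxE !eqxx/= !mulr1 subrr add0r.
rewrite /integ_coord; congr integ; apply/funext => t.
have E : (x + t *: e_ j) 0 i = x 0 i.
  by rewrite !mxE eqxx (negbTE ij) mulr0 addr0.
have := IH us (x + t *: e_ j) si; rewrite E => /(_ xi) <-.
by rewrite addrAC.
Qed.

Definition rVint phi : R := integ_seq (enum 'I_n) phi 0.

Lemma rVint_translate phi v : ucont phi -> `|v| <= 1 ->
  (forall i x, 2 <= `|x 0 i| -> phi x = 0) ->
  rVint (fun y => phi (y + v)) = rVint phi.
Proof.
move=> u v1 p0; rewrite /rVint integ_seq_translate add0r.
set E := enum _.
(* [z s] is v with the coordinates in s set to 0: the translation vector is erased one coordinate at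
   a time, each time by invariance. *)
pose z s := foldr (fun i (x : 'rV[R]_n) => x - x 0 i *: e_ i) v s.
have zE s j : z s 0 j = if j \in s then 0 else v 0 j.
  elim: s => //= i s IH; rewrite !mxE inE eqxx/=.
  case: (eqVneq j i) => [->|ji]; first by rewrite mulr1 subrr.
  by rewrite mulr0 subr0 IH.
have -> : 0 = z E by apply/rowP => j; rewrite zE mem_enum mxE.
elim: (E in z E) => //= i s ->; rewrite -/(z s).
apply/esym/integ_seq_invariant => //.
- exact: enum_uniq.
- exact: mem_enum.
- exact: p0.
- rewrite zE; case: ifP => _; first by rewrite normr0.
  exact: le_trans (ler_coord_norm _ _) v1.
Qed.

End IteratedIntegral.

(** * Uniform bounds on balls *)

Section Compactness.
Context {R : realType} {n : nat}.
Implicit Types (phi : 'rV[R]_n -> R) (x y v : 'rV[R]_n).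

Lemma near0_norm_lt (d : R) : 0 < d -> \forall v \near (0 : 'rV[R]_n), `|v| < d.
Proof.
move=> d0; apply: filterS (near_enorm 0 d0) => v; rewrite subr0.
exact/le_lt_trans/ler_norm_enorm.
Qed.

Lemma compact_norm_le (r : R) : compact [set x : 'rV[R]_n | `|x| <= r].
Proof.
apply: bounded_closed_compact.
  by exists r; split; [exact: num_real|move=> M rM x /= xr; exact: le_trans xr (ltW rM)].
apply: (@closed_comp _ _ (fun x : 'rV[R]_n => `|x|) [set t | t <= r]).
  by move=> x _; exact: norm_continuous.
exact: closed_le.
Qed.

(** Only x is confined to K: the average of f around a point of a closed ball also involves values
    outside that ball. *)
Lemma compact_uniform phi (K : set 'rV[R]_n) (e : R) : continuous phi -> compact K ->
  0 < e -> exists2 d : R, 0 < d &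
  forall x y, K x -> `|x - y| < d -> `|phi x - phi y| <= e.
Proof.
move=> cphi /compact_near_coveringP cK e0.
have e2 : 0 < e / 2 by rewrite divr_gt0.
have : \forall d \near (0 : R)^'+, K `<=`
    (fun x => forall y, `|x - y| < d -> `|phi x - phi y| <= e).
  apply: cK => x _.
  have /(nbhs_normP x)[d /= d0 Hd] := (continuous_eps phi x).1 (cphi x) _ e2.
  exists ([set x' : 'rV[R]_n | `|x' - x| < d / 2], [set d' : R | d' < d / 2]).
    split => /=; last by apply: nbhs_right_lt; rewrite divr_gt0.
    apply/(nbhs_normP x); exists (d / 2); first by rewrite /= divr_gt0.
    by move=> z /=; rewrite distrC.
  move=> [x' d'] /= [x'x d'd] y x'y.
  have H1 : `|phi x' - phi x| <= e / 2.
    apply: Hd => /=; rewrite distrC; apply: (lt_le_trans x'x); lra.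
  have H2 : `|phi y - phi x| <= e / 2.
    apply: Hd => /=; rewrite -[x - y](subrKA x') (splitr d).
    by apply: (le_lt_trans (ler_normD _ _)); rewrite ltrD// ?(lt_trans x'y)// distrC.
  rewrite -[phi x' - _](subrKA (phi x)) (splitr e).
  by apply: (le_trans (ler_normD _ _)); rewrite lerD// distrC.
move=> H; have [d [d0 Hd]] : exists d : R, 0 < d /\ K `<=`
    (fun x => forall y, `|x - y| < d -> `|phi x - phi y| <= e).
  near (0 : R)^'+ => d; exists d; split; first by near: d; exact: nbhs_right_gt.
  by near: d.
by exists d => // x y Kx; exact: Hd.
Unshelve. all: by end_near. Qed.

Lemma continuous_bounded phi (r : R) : continuous phi ->
  exists2 B : R, 0 <= B & forall x, `|x| <= r -> `|phi x| <= B.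
Proof.
move=> cphi; have [r0|r0] := leP 0 r; last first.
  by exists 0 => // x xr; have := le_lt_trans xr r0; rewrite ltNge normr_ge0.
have [||c _ Hc] := @EVT_max_rV R n (fun x => `|phi x|) _ _ (@compact_norm_le r).
- by exists 0; rewrite /= normr0.
- apply: continuous_subspaceT => x.
  apply: (@continuous_comp _ _ _ phi (fun t : R => `|t|)); first exact: cphi.
  exact: norm_continuous.
by exists `|phi c| => // x xr; apply: Hc; rewrite inE.
Qed.

Lemma continuous_pos_bounded phi (r : R) : continuous phi -> (forall x, 0 < phi x) ->
  exists2 c : R, 0 < c & forall x, `|x| <= r -> c <= phi x.
Proof.
move=> cphi p0; have [r0|r0] := leP 0 r; last first.
  by exists 1 => // x xr; have := le_lt_trans xr r0; rewrite ltNge normr_ge0.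
have [||c _ Hc] := @EVT_min_rV R n phi _ _ (@compact_norm_le r).
- by exists 0; rewrite /= normr0.
- by apply: continuous_subspaceT => x; exact: cphi.
by exists (phi c) => // x xr; apply: Hc; rewrite inE.
Qed.

Lemma ucont_compact_support phi (r : R) : continuous phi ->
  (forall x, r < `|x| -> phi x = 0) -> ucont phi.
Proof.
move=> cphi p0 e e0; have [d d0 Hd] := compact_uniform cphi (@compact_norm_le r) e0.
exists d => // x y xy; have [xr|xr] := leP `|x| r; first exact: Hd.
have [yr|yr] := leP `|y| r; first by rewrite distrC; apply: Hd => //; rewrite distrC.
by rewrite !p0// subrr normr0 ltW.
Qed.

End Compactness.

Section LinearForm.
Context {R : realType} {n : nat}.

Definition coord_form (a : 'I_n -> R) (v : 'rV[R]_n) : R := \sum_i v 0 i * a i.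

Lemma coord_form_is_linear a : linear_for *:%R (coord_form a).
Proof.
move=> k u v; rewrite /coord_form scaler_sumr -big_split/=.
apply: eq_bigr => i _; rewrite !mxE mulrDl; congr (_ + _).
by rewrite -[RHS]/(_ * _) mulrA.
Qed.

HB.instance Definition _ a :=
  GRing.isLinear.Build R 'rV[R]_n R _ (coord_form a) (coord_form_is_linear a).

Lemma continuous_coord_form a : continuous (coord_form a).
Proof.
have : is_Ck 0 setT (coord_form a).
  apply: ck_sum; first exact: openT.
  move=> i; apply: ck_mul; first exact: openT.
    exact: ck_coord.
  exact: ck_cst.
by move=> H x; exact: H.
Qed.

Lemma eps_diff_coord (f : 'rV[R]_n -> R) x a : (forall e : R, 0 < e ->
  \forall v \near (0 : 'rV[R]_n), `|f (x + v) - f x - \sum_i v 0 i * a i| <= e * `|v|) ->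
  differentiable f x /\ forall v, 'D_v f x = \sum_i v 0 i * a i.
Proof.
move=> H; have [] := @eps_diff R _ R f x (coord_form a).
- exact: continuous_coord_form.
- move=> e e0; have := H e e0; rewrite (near_shift x (0 : 'rV[R]_n)).
  by apply: filterS => y /=; rewrite sub0r addrCA subrr addr0.
- by move=> df dE; split=> // v; rewrite deriveE// dE.
Qed.

End LinearForm.

(** * Averages against a smooth compactly supported kernel *)

Section Mollifier.
Context {R : realType} {n : nat}.
Implicit Types (f kappa : 'rV[R]_n -> R) (x y v : 'rV[R]_n).

Lemma rVint_lin a (phi psi : 'rV[R]_n -> R) : ucont phi -> ucont psi ->
  rVint (fun x => a * phi x + psi x) = a * rVint phi + rVint psi.
Proof. by move=> u1 u2; rewrite /rVint integ_seq_lin. Qed.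

Lemma ucont_cst (c : R) : ucont (fun _ : 'rV[R]_n => c).
Proof. by move=> e e0; exists 1 => // x y _; rewrite subrr normr0 ltW. Qed.

Lemma rVint0 : rVint (fun _ : 'rV[R]_n => 0) = 0 :> R.
Proof.
have := rVint_lin (-1) (ucont_cst 0) (ucont_cst 0).
by rewrite mulr0 addr0 mulN1r addNr.
Qed.

Lemma rVint_sum I (r : seq I) (a : I -> R) (phi : I -> 'rV[R]_n -> R) :
  (forall i, ucont (phi i)) ->
  ucont (fun y => \sum_(i <- r) a i * phi i y) /\
  rVint (fun y => \sum_(i <- r) a i * phi i y) = \sum_(i <- r) a i * rVint (phi i).
Proof.
move=> u; elim: r => [|i r [IH1 IH2]].
  rewrite big_nil (_ : (fun y => _) = fun=> 0); last first.
    by apply/funext => y; rewrite big_nil.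
  by split; [exact: ucont_cst|exact: rVint0].
rewrite big_cons (_ : (fun y => _) = fun y => a i * phi i y + \sum_(j <- r) a j * phi j y).
  by split; [exact: ucont_lin|rewrite rVint_lin// IH2].
by apply/funext => y; rewrite big_cons.
Qed.

Lemma rVint_norm_le (phi : 'rV[R]_n -> R) c : ucont phi -> (forall x, `|phi x| <= c) ->
  `|rVint phi| <= 6 ^+ n * c.
Proof.
by move=> u H; have := integ_seq_norm_le (enum 'I_n) u H 0; rewrite size_enum_ord.
Qed.

Lemma rVint_le (phi psi : 'rV[R]_n -> R) : ucont phi -> ucont psi ->
  (forall x, phi x <= psi x) -> rVint phi <= rVint psi.
Proof.
move=> u1 u2 H; have := rVint_lin (-1) u1 u2.
have : 0 <= rVint (fun x => -1 * phi x + psi x); last lra.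
apply: integ_seq_ge0; first exact: ucont_lin.
by move=> x; have := H x; lra.
Qed.

Definition bump_kernel kappa := (forall k, is_Ck k setT kappa) /\
  forall y, 1 < `|y| -> kappa y = 0.

Lemma open_norm_gt (r : R) : open [set y : 'rV[R]_n | r < `|y|].
Proof.
apply: (@open_comp _ _ (fun x : 'rV[R]_n => `|x|) [set t | r < t]).
  by move=> x _; exact: norm_continuous.
exact: open_gt.
Qed.

Lemma bump_kernel_derive kappa v : bump_kernel kappa -> bump_kernel ('D_v kappa).
Proof.
move=> [sk k0]; split=> [k|y y1]; first exact: (sk k.+1).2.
have -> : 'D_v kappa y = 'D_v (cst (0 : R)) y; last exact: derive_cst.
apply: near_eq_derive; apply: (open_near_eq (@open_norm_gt 1)) => // z /=; exact: k0.
Qed.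

Lemma bump_kernel_continuous kappa : bump_kernel kappa -> continuous kappa.
Proof. by move=> [sk _] x; exact: (sk 0%N). Qed.

Lemma bump_kernel_differentiable kappa x : bump_kernel kappa -> differentiable kappa x.
Proof. by move=> [sk _]; exact: (sk 1%N).1. Qed.

Lemma bump_kernel_ucont kappa : bump_kernel kappa -> ucont kappa.
Proof. by move=> ka; apply: (ucont_compact_support (bump_kernel_continuous ka) ka.2). Qed.

Lemma ucont_kernel_mul f kappa v x : continuous f -> bump_kernel kappa ->
  ucont (fun y => f (x + y) * kappa (y + v)).
Proof.
move=> cf ka; apply: (@ucont_compact_support _ _ _ (1 + `|v|)).
  have cs (w : 'rV[R]_n) z : {for z, continuous (fun y => y + w)}.
    by apply: (@continuousD _ _ _ id (fun=> w)); [exact: cvg_id|exact: cst_continuous].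
  move=> z; apply: (@continuousM _ _ (fun y => f (x + y)) (fun y => kappa (y + v))).
    rewrite (_ : (fun y => _) = f \o (fun y => y + x)); last first.
      by apply/funext => y /=; rewrite addrC.
    by apply: continuous_comp; [exact: cs|exact: cf].
  by apply: (@continuous_comp _ _ _ (fun y => y + v) kappa); [exact: cs|exact: bump_kernel_continuous].
move=> y yv; rewrite (ka.2 (y + v)) ?mulr0//.
have : `|y| <= `|y + v| + `|v| by rewrite -{1}(addrK v y) (le_trans (ler_normB _ _)).
lra.
Qed.

(** With f taken at x + y, a shift of x by v turns into kappa (y - v) after a translation of y;
    hence the minus sign in the derivative. *)
Definition mollify kappa f x : R := rVint (fun y => f (x + y) * kappa y).

Lemma ucont_mollify f kappa x : continuous f -> bump_kernel kappa ->
  ucont (fun y => f (x + y) * kappa y).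
Proof.
move=> cf ka; rewrite (_ : (fun y => _) = fun y => f (x + y) * kappa (y + 0)).
  exact: ucont_kernel_mul.
by apply/funext => y; rewrite addr0.
Qed.

Lemma mollify_shift f kappa x v : continuous f -> bump_kernel kappa -> `|v| < 1 ->
  mollify kappa f (x + v) = rVint (fun y => f (x + y) * kappa (y - v)).
Proof.
move=> cf ka v1; rewrite -(rVint_translate (v := v))//.
- congr rVint; apply/funext => y.
  by rewrite addrK -addrA [v + y]addrC.
- exact: ucont_kernel_mul.
- exact: ltW.
move=> i y yi; rewrite ka.2 ?mulr0//.
have := ler_coord_norm y i.
have : `|y| <= `|y - v| + `|v| by rewrite -{1}(subrK v y) ler_normD.
lra.
Qed.

(** Mean value theorem and uniform continuity of the partial derivatives of the kernel. The bound is
    uniform in y, so that it can be integrated. *)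
Lemma bump_kernel_taylor kappa e : bump_kernel kappa -> 0 < e -> exists2 d : R, 0 < d &
  forall y v, `|v| < d -> `|kappa (y - v) - kappa y + 'D_v kappa y| <= e * `|v|.
Proof.
move=> ka e0; pose g v := 'D_v kappa.
have H : \forall d \near (0 : R)^'+, forall i x y, `|x - y| < d ->
    `|'D_(delta_mx 0 i) kappa x - 'D_(delta_mx 0 i) kappa y| <= e / n.+1%:R.
  apply: filter_forall => i.
  have [d d0 Hd] := bump_kernel_ucont (bump_kernel_derive (delta_mx 0 i) ka)
    (divr_gt0 e0 (ltr0Sn R n)).
  near=> d' => x y xy; apply: Hd; apply: (lt_trans xy).
  by near: d'; exact: nbhs_right_lt.
have [d [d0 Hd]] : exists d : R, 0 < d /\ forall i x y, `|x - y| < d ->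
    `|'D_(delta_mx 0 i) kappa x - 'D_(delta_mx 0 i) kappa y| <= e / n.+1%:R.
  near (0 : R)^'+ => d; exists d; split; first by near: d; exact: nbhs_right_gt.
  by near: d.
exists d => // y v vd.
have dk z : differentiable kappa z by exact: bump_kernel_differentiable.
have [t /andP[t0 t1] ->] := @mean_value R n kappa y (- v) (fun t _ => dk _).
have -> : 'D_v kappa y = - 'D_(- v) kappa y.
  by rewrite !deriveE// linearN opprK.
apply: le_trans (norm_derive_diff _ _ _) _ => //.
rewrite normrN ler_wpM2r//; apply: (@le_trans _ _ (\sum_(i < n) e / n.+1%:R)).
  apply: ler_sum => i _; apply: Hd.
  rewrite addrAC subrr add0r scalerN normrN normrZ ger0_norm//.
  by apply: le_lt_trans vd; rewrite ler_piMl.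
rewrite sumr_const card_ord -[_ *+ n]mulr_natr -mulrA ger_pMr//.
by rewrite mulrC ler_pdivrMr// mul1r ler_nat.
Unshelve. all: by end_near. Qed.

(** Once the increment is moved onto the kernel, the error is the integral of f (x + y) times the
    Taylor remainder of the kernel. Derivatives fall on the kernel alone, and they are kernels
    again. *)
Lemma mollify_derive f kappa x : continuous f -> bump_kernel kappa ->
  differentiable (mollify kappa f) x /\ forall v, 'D_v (mollify kappa f) x =
    \sum_i v 0 i * - mollify ('D_(delta_mx 0 i) kappa) f x.
Proof.
move=> cf ka; apply: eps_diff_coord => e e0.
have cfx : continuous (fun y => f (x + y)).
  move=> z; apply: (@continuous_comp _ _ _ (fun y => x + y) f); last exact: cf.
  by apply: (@continuousD _ _ _ (fun=> x) id); [exact: cst_continuous|exact: cvg_id].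
(* The ball of radius 2 contains the supports of the kernel and of its translates by v, as |v| <
   1. *)
have [B B0 HB] := continuous_bounded 2 cfx.
have M0 : 0 < 6 ^+ n * (B + 1) by rewrite mulr_gt0 ?exprn_gt0// ltr_wpDl.
have [d d0 Hd] := bump_kernel_taylor ka (divr_gt0 e0 M0).
near=> v.
have v1 : `|v| < 1.
  by near: v; exact: near0_norm_lt.
have vd : `|v| < d.
  by near: v; exact: near0_norm_lt.
rewrite mollify_shift//.
pose D i := 'D_(delta_mx 0 i) kappa.
have uD i : ucont (fun y => f (x + y) * D i y) by exact/ucont_mollify/bump_kernel_derive.
have [us Es] := rVint_sum (index_enum 'I_n) (fun i => v 0 i) uD.
have -> : \sum_i v 0 i * - mollify (D i) f x =
          - rVint (fun y => \sum_i v 0 i * (f (x + y) * D i y)).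
  by rewrite Es -sumrN; apply: eq_bigr => i _; rewrite mulrN.
have u1 := ucont_kernel_mul (- v) x cf ka.
have u2 := ucont_mollify x cf ka.
have u3 := ucont_lin (-1) u2 u1.
have E : rVint (fun y => f (x + y) * kappa (y - v)) - mollify kappa f x -
   - rVint (fun y => \sum_i v 0 i * (f (x + y) * D i y)) =
   rVint (fun y => 1 * (-1 * (f (x + y) * kappa y) + f (x + y) * kappa (y - v)) +
     \sum_i v 0 i * (f (x + y) * D i y)).
  by rewrite rVint_lin// rVint_lin// /mollify; ring.
rewrite E.
have -> : e * `|v| = 6 ^+ n * ((B + 1) * (e / (6 ^+ n * (B + 1)) * `|v|)).
  by field; rewrite !gt_eqF// ?exprn_gt0// ltr_wpDl.
apply: rVint_norm_le; first exact: ucont_lin.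
move=> y; have -> : 1 * (-1 * (f (x + y) * kappa y) + f (x + y) * kappa (y - v)) +
     \sum_i v 0 i * (f (x + y) * D i y) =
     f (x + y) * (kappa (y - v) - kappa y + 'D_v kappa y).
  have -> : 'D_v kappa y = \sum_i v 0 i * D i y :> R.
    by rewrite derive_sum_delta//; exact: bump_kernel_differentiable.
  rewrite [RHS]mulrDr mulr_sumr; congr (_ + _); first by ring.
  by apply: eq_bigr => i _; ring.
have [y2|y2] := leP `|y| 2.
  rewrite normrM; apply: ler_pM => //; last exact: Hd.
  by apply: (le_trans (HB _ y2)); rewrite lerDl.
rewrite (ka.2 (y - v)); last first.
  have : `|y| <= `|y - v| + `|v| by rewrite -{1}(subrK v y) ler_normD.
  lra.
rewrite (ka.2 y) ?((bump_kernel_derive v ka).2 y); [|lra|lra].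
rewrite subrr addr0 mulr0 normr0; apply: mulr_ge0; first by rewrite addr_ge0.
by apply: mulr_ge0 => //; apply/ltW/divr_gt0.
Unshelve. all: by end_near. Qed.

Lemma ck_mollify k f kappa : continuous f -> bump_kernel kappa ->
  is_Ck k setT (mollify kappa f).
Proof.
move=> cf; elim: k kappa => [|k IH] kappa ka.
  by move=> x _; apply: differentiable_continuous; have [] := mollify_derive x cf ka.
split=> [x _|v]; first by have [] := mollify_derive x cf ka.
have H : is_Ck k setT (fun x => \sum_i v 0 i * - mollify ('D_(delta_mx 0 i) kappa) f x).
  apply: ck_sum; first exact: openT.
  move=> i; apply: ck_scale; first exact: openT.
  by apply: ck_opp; [exact: openT|exact/IH/bump_kernel_derive].
apply: ck_eq H; first exact: openT.
by move=> x _; have [_ ->] := mollify_derive x cf ka.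
Qed.

Lemma exists_kernel : exists kappa, [/\ bump_kernel kappa, forall y, 0 <= kappa y &
  rVint kappa = 1].
Proof.
pose q (y : 'rV[R]_n) : R := 1 - \sum_i y 0 i * y 0 i.
pose k0 y := flat_exp 1 (q y).
have f0 s : 0 <= flat_exp 1 s :> R by apply: flat_exp_ge0 => u _; rewrite hornerC.
have ck k : is_Ck k setT k0.
  apply: ck_flat_exp; first exact: openT.
  apply: ck_sub2; [exact: openT|exact: ck_cst|].
  apply: ck_sum; first exact: openT.
  by move=> i; apply: ck_mul; [exact: openT|exact: ck_coord|exact: ck_coord].
have kk : bump_kernel k0.
  split=> // y y1; apply: flat_exp_le0; rewrite /q subr_le0.
  have := ler_norm_enorm y; rewrite -/(dotp y y) -enorm_sqr => H.
  have : 1 < enorm y by exact: lt_le_trans H.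
  nra.
have I0 : 0 < rVint k0.
  apply: integ_seq_gt0; first exact: bump_kernel_ucont.
    by move=> y; exact: f0.
  apply: flat_exp1_gt0; rewrite /q big1 ?subr0// => i _.
  by rewrite mxE mul0r.
exists (fun y => (rVint k0)^-1 * k0 y); split.
- split=> [k|y y1]; last by rewrite kk.2// mulr0.
  by apply: ck_scale; [exact: openT|exact: ck].
- by move=> y; apply: mulr_ge0; [rewrite invr_ge0 ltW|exact: f0].
have := rVint_lin (rVint k0)^-1 (bump_kernel_ucont kk) (ucont_cst 0).
rewrite rVint0 addr0 mulVf ?gt_eqF// => <-.
by congr rVint; apply/funext => y; rewrite addr0.
Qed.

(** g x is the average of f (x + c y) with weight kappa y of total mass 1. It therefore inherits
    every Lipschitz constant of f and is off by at most the oscillation of f at scale c. Scaling f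
    instead of the kernel keeps the support of the kernel fixed. *)
Lemma smooth_approx_compact f (r e : R) : continuous f -> 0 < e ->
  exists g : 'rV[R]_n -> R, [/\ forall k, is_Ck k setT g,
    forall x, `|x| <= r -> `|g x - f x| <= e &
    forall K, 0 <= K -> lipschitz_cst K f -> lipschitz_cst K g].
Proof.
move=> cf e0; have [kappa [ka kappa_ge0 kappa1]] := exists_kernel.
have [d d0 Hd] := compact_uniform cf (@compact_norm_le R n r) e0.
pose c := d / 2; have c0 : 0 < c by rewrite divr_gt0.
pose fc x := f (c *: x).
have cfc : continuous fc.
  move=> z; apply: (@continuous_comp _ _ _ (fun x => c *: x) f); last exact: cf.
  exact: scaler_continuous.
pose g x := mollify kappa fc (c^-1 *: x).
have gE x : g x = rVint (fun y => f (x + c *: y) * kappa y).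
  rewrite /g /mollify; congr rVint; apply/funext => y.
  by rewrite /fc scalerDr scalerA mulfV ?gt_eqF// scale1r.
have uf x : ucont (fun y => f (x + c *: y) * kappa y).
  have := ucont_mollify (c^-1 *: x) cfc ka; congr ucont.
  by apply/funext => y; rewrite /fc scalerDr scalerA mulfV ?gt_eqF// scale1r.
have cE a : a = rVint (fun y => a * kappa y).
  have := rVint_lin a (bump_kernel_ucont ka) (ucont_cst 0).
  rewrite rVint0 addr0 kappa1 mulr1 => E; rewrite -[LHS]E.
  by congr rVint; apply/funext => y; rewrite addr0.
have uc a : ucont (fun y => a * kappa y).
  have := ucont_lin a (bump_kernel_ucont ka) (ucont_cst 0); congr ucont.
  by apply/funext => y; rewrite addr0.
have bound (a : R) (phi psi : 'rV[R]_n -> R) : ucont phi -> ucont psi ->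
    (forall y, `|phi y - psi y| <= a * kappa y) ->
    `|rVint phi - rVint psi| <= a.
  move=> u1 u2 H.
  have H1 : rVint phi <= a + rVint psi.
    rewrite {1}(cE a) -[rVint (fun y => a * kappa y)]mul1r -rVint_lin//.
    apply: rVint_le => //; first exact: ucont_lin.
    by move=> y; have := H y; rewrite ler_norml mul1r => /andP[_]; lra.
  have H2 : rVint psi <= a + rVint phi.
    rewrite {1}(cE a) -[rVint (fun y => a * kappa y)]mul1r -rVint_lin//.
    apply: rVint_le => //; first exact: ucont_lin.
    by move=> y; have := H y; rewrite ler_norml mul1r => /andP[+ _]; lra.
  by rewrite ler_norml; lra.
exists g; split=> [k|x xr|K K0 HK x y].
- apply: (@ck_comp R n n k setT setT (mollify kappa fc) (fun x => c^-1 *: x)) => //.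
  + exact: openT.
  + exact: openT.
  + apply/ck_rVP; first exact: openT.
    move=> j; apply: (@ck_eq _ _ _ _ _ (fun x => c^-1 * x 0 j)); first exact: openT.
      by move=> x _; rewrite mxE.
    by apply: ck_scale; [exact: openT|exact: ck_coord].
  + exact: ck_mollify.
- rewrite gE (cE (f x)); apply: bound => // y.
  rewrite -mulrBl normrM (ger0_norm (kappa_ge0 y)).
  have [y1|y1] := leP `|y| 1; last by rewrite ka.2// !mulr0.
  apply: ler_wpM2r => //; rewrite distrC; apply: Hd => //.
  rewrite opprD addrA subrr sub0r normrN normrZ ger0_norm ?ltW//.
  by apply: (@le_lt_trans _ _ c); [apply: ler_piMr => //; exact: ltW|rewrite /c; lra].
- rewrite !gE; apply: bound => // z.
  rewrite -mulrBl normrM (ger0_norm (kappa_ge0 z)) ler_wpM2r//.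
  by apply: le_trans (HK _ _) _; rewrite opprD addrACA subrr addr0.
Qed.

End Mollifier.

(** * Smooth approximation relative to a closed set *)

Section SmoothApproximation.
Context {R : realType} {n : nat}.
Implicit Types (f g h : 'rV[R]_n -> R) (x y v : 'rV[R]_n).

Lemma ck_near (W : normedModType R) k (U : set 'rV[R]_n) (h : 'rV[R]_n -> W) :
  (forall x, U x -> exists (V : set 'rV[R]_n) (g : 'rV[R]_n -> W), [/\ open_nbhs x V, is_Ck k V g &
    \near x, h x = g x]) -> is_Ck k U h.
Proof.
move=> H; apply: ck_local => x /H[V [g [[oV Vx] cg hg]]].
have : nbhs x [set y | h y = g y] by [].
rewrite nbhsE => -[V' [oV' V'x] {}hg].
exists (V `&` V'); split; first by split.
apply: (@ck_eq _ _ _ _ _ g); first exact: openI.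
  by move=> y [_ /hg].
by apply: ck_sub cg => y [].
Qed.

Lemma near_refl (T : Type) (g : 'rV[R]_n -> T) x : \near x, g x = g x.
Proof. by near=> y. Unshelve. all: by end_near. Qed.

Definition grad_bound f x : R := \sum_i `|'D_(delta_mx 0 i) f x|.

Lemma grad_bound_ge0 f x : 0 <= grad_bound f x.
Proof. exact: sumr_ge0. Qed.

Lemma continuous_grad_bound f : is_Ck 1 setT f -> continuous (grad_bound f).
Proof.
move=> [_ cf]; rewrite /grad_bound.
elim: (index_enum _) => [|i r IH] x.
  by under eq_fun do rewrite big_nil; exact: cst_continuous.
under eq_fun do rewrite big_cons.
apply: (@continuousD _ _ _ (fun x => `|'D_(delta_mx 0 i) f x|)); last exact: IH.
apply: (@continuous_comp _ _ _ ('D_(delta_mx 0 i) f) (fun t : R => `|t|)).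
  exact: cf.
exact: norm_continuous.
Qed.

Lemma ck_dotp k : is_Ck k setT (fun x : 'rV[R]_n => dotp x x).
Proof.
apply: ck_sum; first exact: openT.
by move=> i; apply: ck_mul; [exact: openT|exact: ck_coord|exact: ck_coord].
Qed.

Lemma dotp_norm_le x (j : nat) : dotp x x < j.+1%:R -> `|x| <= j.+1%:R.
Proof.
move=> H; apply: (le_trans (ler_norm_enorm x)).
have j1 : 1 <= j.+1%:R :> R by rewrite ler1n.
have := enorm_ge0 x; rewrite -enorm_sqr in H; nra.
Qed.

(** On the shell j <= |x|^2 < j + 1, the weight [a j] leads from an approximation T j to T j.+1. The
    weights are fixed beforehand, so the errors of the T j can be chosen small against their
    gradients, and the gluing costs no more than delta. *)
Lemma smooth_approx f (eps : 'rV[R]_n -> R) (delta : R) : continuous f -> continuous eps ->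
  (forall x, 0 < eps x) -> 0 < delta ->
  exists h : 'rV[R]_n -> R, [/\ forall k, is_Ck k setT h,
    forall x, `|h x - f x| < eps x &
    forall K, 0 <= K -> lipschitz_cst K f -> lipschitz_cst (K + delta) h].
Proof.
move=> cf ce e0 d0; pose s x := dotp x x.
pose a (j : nat) x := smooth_step (s x - j%:R).
have a01 j x : 0 <= a j x <= 1 by exact: smooth_step_itv.
have ca j k : is_Ck k setT (a j).
  apply: ck_smooth_step; first exact: openT.
  by apply: ck_sub2; [exact: openT|exact: ck_dotp|exact: ck_cst].
(* T i is mixed with T i.+1 by [a i] and with T i.-1 by [a i.-1], and its error has to compensate
   both gradients. For i = 0 the second term repeats the first, as 0.-1 = 0. *)
pose G i x := grad_bound (a i) x + grad_bound (a i.-1) x.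
have cG i : continuous (G i).
  move=> x; apply: (@continuousD _ _ _ (grad_bound (a i)) (grad_bound (a i.-1))).
    exact: continuous_grad_bound.
  exact: continuous_grad_bound.
have /choice[T HT] (i : nat) : exists g, [/\ forall k, is_Ck k setT g,
    forall x, `|x| <= i.+1%:R -> 2 * `|g x - f x| <= eps x,
    forall x, `|x| <= i.+1%:R -> 2 * (G i x * `|g x - f x|) <= delta &
    forall K, 0 <= K -> lipschitz_cst K f -> lipschitz_cst K g].
  have [c c0 Hc] := continuous_pos_bounded i.+1%:R ce e0.
  have [B B0 HB] := continuous_bounded i.+1%:R (@cG i).
  have B1 : 0 < B + 1 by rewrite ltr_wpDl.
  pose e := Num.min (c / 2) (delta / 2 / (B + 1)).
  have ep0 : 0 < e by rewrite /e lt_min !divr_gt0.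
  have [g [sg Hg lg]] := smooth_approx_compact i.+1%:R cf ep0.
  exists g; split=> // x xi.
    have := Hc x xi; have := Hg x xi; rewrite {1}/e le_min => /andP[H _]; lra.
  have := Hg x xi; rewrite /e le_min => /andP[_]; rewrite ler_pdivlMr// => H.
  have : G i x * `|g x - f x| <= (B + 1) * `|g x - f x|.
    by rewrite ler_wpM2r// (le_trans (ler_norm _))// (le_trans (HB x xi))// lerDl.
  lra.
pose hj j x := T j x + a j x * (T j.+1 x - T j x).
pose tr x := Num.trunc (s x).
pose h x := hj (tr x) x.
have s_ge0 x : 0 <= s x by exact: dotp_ge0.
have cs : continuous s by move=> x; exact: (@ck_dotp 0%N x I).
have trP x : (tr x)%:R <= s x < (tr x).+1%:R by exact: truncn_itv.
(* Just inside the sphere |y|^2 = j the formulas of the shells j - 1 and j agree, both reducing to T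
   j: there the weight of the former is 1 and that of the latter is 0. *)
have h_near x : \forall y \near x, h y = hj (tr x) y.
  have /andP[s1 s2] := trP x; set j := tr x in s1 s2 *.
  have n1 : \forall y \near x, s y < j.+1%:R.
    exact: (cvgr_lt _ (cs x) _ s2).
  have n2 : \forall y \near x, j%:R - 4^-1 < s y.
    apply: (cvgr_gt _ (cs x)); lra.
  apply: filterS2 n1 n2 => y y1 y2; rewrite /h.
  have [jy|yj] := leP j%:R (s y).
    by rewrite (_ : tr y = j)//; apply: truncn_def; rewrite jy.
  case: (j) y1 y2 yj => [|i] y1 y2 yj; first by have := s_ge0 y; lra.
  have -> : tr y = i.
    apply: truncn_def; rewrite yj andbT; move: y2; rewrite -natr1; lra.
  rewrite /hj /a smooth_step1; last by move: y2; rewrite -natr1; lra.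
  rewrite (@smooth_step0 _ (s y - i.+1%:R)); last by lra.
  by rewrite mul0r mul1r addr0 addrC subrK.
have x_norm x : `|x| <= (tr x).+1%:R.
  by apply: dotp_norm_le; have /andP[] := trP x.
have x_norm' x : `|x| <= (tr x).+2%:R.
  by apply: le_trans (x_norm x) _; rewrite ler_nat.
exists h; split.
- move=> k; apply: ck_near => x _; exists setT, (hj (tr x)); split.
  + by split=> //; exact: openT.
  + apply: ck_add; [exact: openT|by have [] := HT (tr x)|].
    apply: ck_mul; [exact: openT|exact: ca|].
    by apply: ck_sub2; [exact: openT|have [] := HT (tr x).+1|have [] := HT (tr x)].
  + exact: h_near.
- move=> x; rewrite /h /hj; set j := tr x.
  have [_ /(_ x (x_norm x)) H1 _ _] := HT j.
  have [_ /(_ x (x_norm' x)) H2 _ _] := HT j.+1.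
  have -> : T j x + a j x * (T j.+1 x - T j x) - f x =
    (1 - a j x) * (T j x - f x) + a j x * (T j.+1 x - f x) by ring.
  have /andP[] := a01 j x; move: (a j x) => A a0 a1.
  apply: (le_lt_trans (ler_normD _ _)); rewrite !normrM.
  rewrite (ger0_norm a0) (ger0_norm (_ : 0 <= 1 - A)) ?subr_ge0//.
  move: (e0 x) H1 H2; set u := `|T j x - f x|; set w := `|_|; nra.
- move=> K K0 HK; apply: plip_lipschitz => x.
  apply: (@near_eq_plip _ _ _ (hj (tr x))).
    by apply: filterS (h_near x) => y ->.
  set j := tr x.
  have [_ _ /(_ x (x_norm x)) H1 /(_ K K0 HK) L1] := HT j.
  have [_ _ /(_ x (x_norm' x)) H2 /(_ K K0 HK) L2] := HT j.+1.
  have da : differentiable (a j) x by exact: (ca j 1%N).1.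
  have := plip_mix K0 K0 (grad_bound_ge0 (a j) x) (a01 j x) (lipschitz_plip x L1)
    (lipschitz_plip x L2) (differentiable_plip da).
  apply: plip_le.
  have -> : (1 - a j x) * K + a j x * K = K by ring.
  rewrite lerD2l.
  have g0 := grad_bound_ge0 (a j) x.
  have g1 := grad_bound_ge0 (a j.-1) x; have g2 := grad_bound_ge0 (a j.+1) x.
  have : `|T j.+1 x - T j x| <= `|T j x - f x| + `|T j.+1 x - f x|.
    rewrite -[T j.+1 x - _](subrKA (f x)) addrC.
    by apply: (le_trans (ler_normD _ _)); rewrite lerD// distrC.
  move: H1 H2; rewrite {1 2}/G /=; set u := `|T j x - f x|; set w := `|T j.+1 x - f x|.
  have u0 : 0 <= u by exact: normr_ge0.
  have w0 : 0 <= w by exact: normr_ge0.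
  move: (grad_bound (a j) x) (grad_bound (a j.-1) x) (grad_bound (a j.+1) x) g0 g1 g2.
  move=> A B C A0 B0 C0; set z := `|_| => H1 H2 zuw.
  have := ler_wpM2l A0 zuw; have := mulr_ge0 B0 u0; have := mulr_ge0 C0 w0.
  lra.
Qed.

(** A continuous Urysohn function, smoothed with an error below 1/4, followed by the smooth step:
    the margins of the step make the result constant around the points concerned. *)
Lemma smooth_urysohn (C0 W : set 'rV[R]_n) : closed C0 -> open W -> C0 `<=` W ->
  exists chi : 'rV[R]_n -> R, [/\ forall k, is_Ck k setT chi,
    forall x, 0 <= chi x <= 1,
    forall x, C0 x -> \near x, chi x = 0 & forall x, ~ W x -> \near x, chi x = 1].
Proof.
move=> cC oW CW.
have sep : uniform_separator C0 (~` W).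
  apply: ((@normal_separatorP R 'rV[R]_n).1 (@pseudometric_normal R 'rV[R]_n)) => //.
    exact: open_closedC.
  by apply/disjoints_subset; rewrite setCK.
have [u [cu u01 u0 u1]] := (@uniform_separatorP _ R _ _).1 sep.
have ce : continuous (fun _ : 'rV[R]_n => 4^-1 : R) by move=> x; exact: cst_continuous.
have e0 (x : 'rV[R]_n) : 0 < 4^-1 :> R by [].
have [v [sv vu _]] := smooth_approx cu ce e0 (@ltr01 R).
have cv : continuous v by move=> x; exact: (sv 0%N x I).
exists (fun x => smooth_step (v x)); split.
- by move=> k; apply: ck_smooth_step; [exact: openT|exact: sv].
- by move=> x; exact: smooth_step_itv.
- move=> x Cx; have ux : u x = 0 by apply: u0; exists x.
  have : v x < 4^-1 by have := vu x; rewrite ux subr0; exact/le_lt_trans/ler_norm.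
  move=> /(cvgr_lt _ (cv x)); apply: filterS => y /ltW; exact: smooth_step0.
- move=> x Wx; have ux : u x = 1 by apply: u1; exists x.
  have : 3 / 4 < v x by have := vu x; rewrite ux ltr_norml => /andP[H _]; clear -H; lra.
  move=> /(cvgr_gt _ (cv x)); apply: filterS => y /ltW; exact: smooth_step1.
Qed.

(** Pass from f near C0 to a smooth approximation h0 outside W by means of chi. Half of delta is
    left to h0; the other half pays for the gradient of chi, against which |h0 - f| is chosen
    small. *)
Lemma smooth_approx_rel f (C0 W : set 'rV[R]_n) (eps : 'rV[R]_n -> R) (delta : R) : continuous f ->
  closed C0 -> open W -> C0 `<=` W ->
  continuous eps -> (forall x, 0 < eps x) -> 0 < delta ->
  exists h : 'rV[R]_n -> R, [/\ forall k, is_Ck k W f -> is_Ck k setT h,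
    forall x, `|h x - f x| < eps x,
    forall x, C0 x -> \near x, f x = h x &
    forall K, 0 <= K -> lipschitz_cst K f -> lipschitz_cst (K + delta) h].
Proof.
move=> cf cC oW CW ce e0 d0.
have [chi [schi chi01 chi0 chi1]] := smooth_urysohn cC oW CW.
pose G := grad_bound chi.
have cG : continuous G by exact: continuous_grad_bound.
have G1 x : 0 < G x + 1 by rewrite ltr_wpDl ?grad_bound_ge0.
pose e x := Num.min (eps x) (delta / 2 / (G x + 1)).
have ce' : continuous e.
  move=> x; apply: (@continuous_min _ _ eps (fun x => delta / 2 / (G x + 1))).
    exact: ce.
  apply: (@continuousM _ _ (fun=> delta / 2) (fun x => (G x + 1)^-1)).
    exact: cst_continuous.
  apply: (@continuousV _ _ (fun x => G x + 1)); first by rewrite gt_eqF.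
  apply: (@continuousD _ _ _ G (fun=> 1)); [exact: cG|exact: cst_continuous].
have e0' x : 0 < e x by rewrite /e lt_min e0 !divr_gt0.
have d2 : 0 < delta / 2 by rewrite divr_gt0.
have [h0 [sh0 hf lh0]] := smooth_approx cf ce' e0' d2.
exists (fun x => f x + chi x * (h0 x - f x)); split.
- move=> k ck; apply: ck_near => x _.
  have [Wx|Wx] := pselect (W x).
    exists W, (fun x => f x + chi x * (h0 x - f x)).
    split; [by split| |exact: near_refl].
    have sub g : is_Ck k setT g -> is_Ck k W g by apply: ck_sub.
    apply: ck_add => //; apply: ck_mul => //; first exact/sub/schi.
    by apply: ck_sub2 => //; exact/sub/sh0.
  exists setT, h0; split=> //; first by split=> //; exact: openT.
  by apply: filterS (chi1 x Wx) => y ->; rewrite mul1r addrC subrK.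
- move=> x; rewrite addrAC subrr add0r normrM.
  have /andP[c0 c1] := chi01 x; rewrite ger0_norm//.
  have := hf x; rewrite lt_min => /andP[H _]; apply: le_lt_trans H.
  by rewrite ler_piMl.
- by move=> x Cx; apply: filterS (chi0 x Cx) => y ->; rewrite mul0r addr0.
- move=> K K0 HK; apply: plip_lipschitz => x.
  have dchi : differentiable chi x by exact: (schi 1%N).1.
  have K2 : 0 <= K + delta / 2 by rewrite addr_ge0// ltW.
  have := plip_mix K0 K2 (grad_bound_ge0 chi x) (chi01 x) (lipschitz_plip x HK)
    (lipschitz_plip x (lh0 K K0 HK)) (differentiable_plip dchi).
  apply: plip_le; have /andP[c0 c1] := chi01 x.
  have := hf x; rewrite lt_min ltr_pdivlMr// => /andP[_].
  have := grad_bound_ge0 chi x; rewrite -/(G x).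
  have : 0 <= `|h0 x - f x| by [].
  by set z := `|_|; move: (G x) (chi x) c0 c1 => A B; nra.
Qed.

End SmoothApproximation.

(** * The inverse function theorem and metric projections *)

Section InverseFunction.
Context {R : realType}.

Lemma ck_det n m k (U : set 'rV[R]_n) (M : 'rV[R]_n -> 'M[R]_m) : open U ->
  (forall i j, is_Ck k U (fun x => M x i j)) -> is_Ck k U (fun x => \det (M x)).
Proof.
move=> oU cM; apply: ck_sum => // s; apply: ck_mul => //; first exact: ck_cst.
by apply: ck_prod => // i; exact: cM.
Qed.

Lemma ck_invmx n m k (U : set 'rV[R]_n) (M : 'rV[R]_n -> 'M[R]_m) : open U ->
  (forall x, U x -> M x \in unitmx) ->
  (forall i j, is_Ck k U (fun x => M x i j)) ->
  forall i j, is_Ck k U (fun x => invmx (M x) i j).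
Proof.
move=> oU uM cM i j.
apply: (@ck_eq _ _ _ _ _ (fun x => (\det (M x))^-1 * \adj (M x) i j)) => //.
  by move=> x Ux; rewrite /invmx (uM x Ux) [RHS]mxE.
apply: ck_mul => //.
  apply: ck_inv => //; last exact: ck_det.
  by move=> x /uM; rewrite unitmxE unitfE.
apply: (@ck_eq _ _ _ _ _ (fun x => (-1) ^+ (j + i) * \det (row' j (col' i (M x))))) => //.
  by move=> x _; rewrite mxE.
apply: ck_mul => //; first exact: ck_cst.
apply: ck_det => // i' j'; apply: ck_eq (cM (lift j i') (lift i j')) => // x _.
by rewrite !mxE.
Qed.

Lemma jacobianE n m (f : 'rV[R]_n -> 'rV[R]_m) x i j : differentiable f x ->
  jacobian f x i j = 'D_(delta_mx 0 i) (fun y => f y 0 j) x.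
Proof.
by move=> df; rewrite /jacobian mxE -deriveE// derive_rV.
Qed.

Lemma strict_differentiable_rV n m (f : 'rV[R]_n -> 'rV[R]_m) (U : set 'rV[R]_n)
    (a : 'rV[R]_n) (e : R) : open_nbhs a U -> is_Ck 1 U f -> 0 < e ->
  exists2 d : R, 0 < d & forall x y, `|x - a| < d -> `|y - a| < d ->
    U x /\ `|f y - f x - 'D_(y - x) f a| <= e * `|y - x|.
Proof.
move=> aU cf e0; have [oU Ua] := aU.
have dfa : differentiable f a by exact: cf.1.
have Hj j : is_Ck 1 U (fun y => f y 0 j) by move: j; apply/ck_rVP.
have H : \forall d \near (0 : R)^'+, forall j x y, `|x - a| < d -> `|y - a| < d ->
    U x /\ `|f y 0 j - f x 0 j - 'D_(y - x) (fun z => f z 0 j) a| <= e * `|y - x|.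
  apply: filter_forall => j.
  have [d d0 Hd] := strict_differentiable aU (Hj j) e0.
  near=> d' => x y xa ya.
  have d'd : d' < d by near: d'; exact: nbhs_right_lt.
  by apply: Hd; [exact: lt_trans xa d'd|exact: lt_trans ya d'd].
have /(nbhs_normP a)[d1 /= d10 Hd1] := open_nbhs_nbhs aU.
have [d [d0 [dd1 Hd]]] : exists d : R, 0 < d /\ d < d1 /\
  forall j x y, `|x - a| < d -> `|y - a| < d ->
    U x /\ `|f y 0 j - f x 0 j - 'D_(y - x) (fun z => f z 0 j) a| <= e * `|y - x|.
  near (0 : R)^'+ => d; exists d; split; first by near: d; exact: nbhs_right_gt.
  by split; near: d; [exact: nbhs_right_lt|].
exists d => // x y xa ya; split.
  by apply: Hd1; rewrite /= distrC (lt_trans xa).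
rewrite [leLHS]/Num.Def.normr/= mx_normrE; apply: bigmax_le.
  by apply: mulr_ge0; [exact: ltW|exact: normr_ge0].
move=> [i j] _; rewrite ord1 /=; have [_] := Hd j x y xa ya.
by rewrite !mxE derive_rV.
Unshelve. all: by end_near. Qed.

Section LocalInverse.
Context {n : nat} (Phi : 'rV[R]_n -> 'rV[R]_n) (U : set 'rV[R]_n) (a : 'rV[R]_n).
Hypotheses (aU : open_nbhs a U) (cPhi : is_Ck 1 U Phi)
  (dPhi : forall v, 'D_v Phi a = v).

(** Phi - id has derivative 0 at a and thus contracts by 1/2 near a; the whole inversion rests on
    this. Both maps to be inverted later have the identity as derivative at the base point. *)
Lemma near_identity : exists2 d : R, 0 < d &
  forall x y, `|x - a| < d -> `|y - a| < d ->
    U x /\ `|Phi y - Phi x - (y - x)| <= 2^-1 * `|y - x|.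
Proof.
have h0 : 0 < 2^-1 :> R by [].
have [d d0 Hd] := strict_differentiable_rV aU cPhi h0.
by exists d => // x y xa ya; have := Hd x y xa ya; rewrite dPhi.
Qed.

Variable d : R.
Hypotheses (d0 : 0 < d) (Hd : forall x y, `|x - a| < d -> `|y - a| < d ->
    U x /\ `|Phi y - Phi x - (y - x)| <= 2^-1 * `|y - x|).

Lemma local_expansion x y : `|x - a| < d -> `|y - a| < d ->
  `|y - x| <= 2 * `|Phi y - Phi x|.
Proof.
move=> xa ya; have [_ H] := Hd xa ya.
have : `|y - x| <= `|Phi y - Phi x - (y - x)| + `|Phi y - Phi x|.
  rewrite -[X in X <= _]normrN -{1}(addKr (Phi y - Phi x) (- (y - x))).
  by rewrite addrC (le_trans (ler_normB _ _))// addrC [- _ + _]addrC.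
lra.
Qed.

(** The map h (z) = z - (Phi z - y) sends the closed ball K of radius d / 2 into itself, by d / 4 +
    d / 4, and at least halves the residual |Phi z - y| = |z - h z|. At a point of K where the
    residual is minimal it is therefore 0. *)
Lemma local_surjective y : `|y - Phi a| < d / 4 ->
  exists2 x, `|x - a| < d & Phi x = y.
Proof.
move=> ya; have [oU Ua] := aU; have d_gt0 := d0.
have aa : `|a - a| < d by rewrite subrr normr0.
pose K := [set x : 'rV[R]_n | `|x - a| <= d / 2].
have Kd x : K x -> `|x - a| < d by move=> /= H; apply: le_lt_trans H _; lra.
have cK : compact K.
  have -> : K = [set a + x | x in [set x | `|x| <= d / 2]].
    apply/seteqP; split=> [x Kx|_ [x xd <-]].
      by exists (x - a) => //; rewrite addrC subrK.
    by rewrite /K /= addrAC subrr add0r.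
  apply: continuous_compact; last exact: compact_norm_le.
  apply: continuous_subspaceT => x.
  by apply: (@continuousD _ _ _ (fun=> a) id); [exact: cst_continuous|exact: cvg_id].
have [||x] := @EVT_min_rV R n (fun x => `|Phi x - y|) K _ cK.
- by exists a; rewrite /K /= subrr normr0 divr_ge0// ltW.
- apply: continuous_in_subspaceT => x; rewrite inE => Kx.
  apply: (@continuous_comp _ _ _ (fun x => Phi x - y) (fun z : 'rV[R]_n => `|z|)).
    apply: (@continuousB _ _ _ Phi (fun=> y)); last exact: cst_continuous.
    by apply: (ck_continuous cPhi); have [] := Hd (Kd x Kx) (Kd x Kx).
  exact: norm_continuous.
rewrite inE => Kx Hx; exists x; first exact: Kd.
pose h z := z - (Phi z - y).
have hh z w : K z -> `|w - a| < d -> `|h w - h z| <= 2^-1 * `|w - z|.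
  move=> Kz wa; have [_] := Hd (Kd z Kz) wa.
  rewrite -normrN; congr (`|_| <= _).
  by apply/rowP => i; rewrite !mxE; ring.
have Kh z : K z -> K (h z).
  move=> Kz; rewrite /K /=; have := hh a z _ (Kd z Kz).
  have Ka : K a by rewrite /K /= subrr normr0 divr_ge0// ltW.
  move=> /(_ Ka) H1.
  have H2 : `|h a - a| < d / 4.
    by rewrite /h addrAC subrr add0r opprB.
  have : `|h z - a| <= `|h z - h a| + `|h a - a|.
    by rewrite -[h z - a](subrKA (h a)) ler_normD.
  have H3 : `|z - a| <= d / 2 by [].
  lra.
have H1 := Hx (h x); rewrite inE in H1; have {}H1 := H1 (Kh x Kx).
have H2 := hh x (h x) Kx (Kd _ (Kh x Kx)).
have E w : Phi w - y = w - h w by rewrite /h subKr.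
rewrite !E in H1; rewrite distrC [`|h x - x|]distrC in H2.
have : `|x - h x| <= 0 by lra.
by rewrite normr_le0 -E subr_eq0 => /eqP.
Qed.

(** A nonzero v annihilated by the Jacobian would give |Phi (x + t v) - Phi x| <= |t v| / 4 for
    small t, against the lower bound |t v| / 2. *)
Lemma jacobian_unit x : `|x - a| < d -> jacobian Phi x \in unitmx.
Proof.
move=> xa; have [Ux _] := Hd xa xa.
have dx : differentiable Phi x by exact: cPhi.1.
rewrite -row_free_unit; apply: inj_row_free => v vJ.
apply/eqP/negPn/negP => v0.
have v_gt0 : 0 < `|v| by rewrite normr_gt0.
have e4 : 0 < 4^-1 :> R by [].
have /(nbhs_normP x)[r /= r0 Hr] := diff_eps dx e4.
pose q := Num.min r (d - `|x - a|).
have q0 : 0 < q by rewrite lt_min r0 subr_gt0.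
pose t := q / 2 / `|v|.
have tv : `|t *: v| = q / 2.
  by rewrite normrZ ger0_norm ?divr_ge0 ?ltW// /t divfK// gt_eqF.
have yr : `|x - (x + t *: v)| < r.
  rewrite opprD addrA subrr sub0r normrN tv.
  have : q <= r by rewrite ge_min lexx.
  by move: r0 q0; lra.
have ya : `|x + t *: v - a| < d.
  rewrite addrAC; apply: (le_lt_trans (ler_normD _ _)); rewrite tv.
  have : q <= d - `|x - a| by rewrite ge_min lexx orbT.
  by move: q0; lra.
have E : x + t *: v - x = t *: v by rewrite addrAC subrr add0r.
have := Hr _ yr; rewrite /= E -deriveE//.
rewrite deriveEjacobian// -scalemxAl vJ scaler0 subr0.
have := local_expansion xa ya; rewrite E tv.
by move: q0; lra.
Qed.

(** The increment z of theta satisfies |z| <= 2 |v| and v = z J + o(|z|); multiply by the inverse of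
    J. *)
Lemma local_inverse_differentiable (V : set 'rV[R]_n) (theta : 'rV[R]_n -> 'rV[R]_n) y :
  open V -> V y -> (forall z, V z -> `|theta z - a| < d /\ Phi (theta z) = z) ->
  differentiable theta y /\
  forall v j, 'D_v (fun z => theta z 0 j) y =
    \sum_i v 0 i * invmx (jacobian Phi (theta y)) i j.
Proof.
move=> oV Vy thetaP.
suff H j : differentiable (fun z => theta z 0 j) y /\
    forall v, 'D_v (fun z => theta z 0 j) y =
      \sum_i v 0 i * invmx (jacobian Phi (theta y)) i j.
  by split=> [|v j]; [apply/differentiable_rVP => j|]; have [] := H j.
set J := jacobian Phi (theta y); have [xa Ex] := thetaP _ Vy.
have [Ux _] := Hd xa xa.
have dx : differentiable Phi (theta y) by exact: cPhi.1.
have uJ : J \in unitmx by exact: jacobian_unit.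
apply: eps_diff_coord => e e0.
pose C := \sum_i `|invmx J i j| + 1.
have C0 : 0 < C by rewrite ltr_wpDl// sumr_ge0.
have e' : 0 < e / (2 * C) by rewrite divr_gt0// mulr_gt0.
have /(nbhs_normP (theta y))[r /= r0 Hr] := diff_eps dx e'.
have VyN : nbhs y V by exact: open_nbhs_nbhs.
have {}VyN : \forall v \near (0 : 'rV[R]_n), V (y + v).
  move: VyN => /(nbhs_normP y)[s /= s0 Hs].
  apply: filterS (near0_norm_lt s0) => v vs; apply: Hs => /=.
  by rewrite opprD addrA subrr sub0r normrN.
have r2 : 0 < r / 2 by rewrite divr_gt0.
apply: filterS2 VyN (near0_norm_lt r2) => v Vv vr.
have [xa' Ex'] := thetaP _ Vv.
have L : `|theta (y + v) - theta y| <= 2 * `|v|.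
  by have := local_expansion xa xa'; rewrite Ex Ex' addrAC subrr add0r.
have xr : `|theta y - theta (y + v)| < r.
  rewrite distrC; apply: le_lt_trans L _.
  by move: vr; lra.
have Ev : y + v - y = v by rewrite addrAC subrr add0r.
have := Hr _ xr; rewrite /= Ex Ex' Ev -deriveE// deriveEjacobian//.
rewrite -/J; set z := theta (y + v) - theta y => H.
have -> : theta (y + v) 0 j - theta y 0 j - \sum_i v 0 i * invmx J i j =
    - ((v - z *m J) *m invmx J) 0 j.
  by rewrite mulmxBl mulmxK// !mxE opprB.
rewrite normrN mxE; apply: (le_trans (ler_norm_sum _ _ _)).
apply: (@le_trans _ _ (C * `|v - z *m J|)).
  apply: (@le_trans _ _ ((\sum_i `|invmx J i j|) * `|v - z *m J|)).
    rewrite mulr_suml; apply: ler_sum => i _; rewrite normrM mulrC.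
    by rewrite ler_wpM2l// ler_coord_norm.
  by rewrite ler_wpM2r// lerDl.
apply: (@le_trans _ _ (C * (e / (2 * C) * (2 * `|v|)))).
  rewrite ler_wpM2l ?(ltW C0)//; apply: le_trans H _.
  by rewrite ler_wpM2l// ltW.
rewrite le_eqVlt; apply/orP; left; apply/eqP; field.
by rewrite gt_eqF.
Qed.

(** Bootstrap: the derivative of theta is the inverse of the Jacobian of Phi at theta, which is C^k
    once theta is C^k and Phi is C^(k+1). *)
Lemma local_inverse_ck k (V : set 'rV[R]_n) (theta : 'rV[R]_n -> 'rV[R]_n) :
  open V -> (forall z, V z -> `|theta z - a| < d /\ Phi (theta z) = z) ->
  is_Ck k U Phi -> is_Ck k V theta.
Proof.
move=> oV thetaP; have [oU _] := aU.
have dth y : V y -> differentiable theta y.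
  by move=> Vy; have [] := local_inverse_differentiable oV Vy thetaP.
elim: k => [|k IH] cP.
  by move=> y Vy; apply: differentiable_continuous; exact: dth.
split=> // v; apply/(ck_rVP _ _ oV) => j.
apply: (@ck_eq _ _ _ _ _ (fun y => \sum_i v 0 i * invmx (jacobian Phi (theta y)) i j)) => //.
  move=> y Vy; rewrite derive_rV; last exact: dth.
  by have [_ ->] := local_inverse_differentiable oV Vy thetaP.
have thU y : V y -> U (theta y) by move=> /thetaP[xa _]; have [] := Hd xa xa.
apply: ck_sum => // i; apply: ck_mul => //; first exact: ck_cst.
apply: ck_invmx => //; first by move=> y /thetaP[xa _]; exact: jacobian_unit.
move=> i' j'.
apply: (@ck_eq _ _ _ _ _ (fun y => 'D_(delta_mx 0 i') (fun x => Phi x 0 j') (theta y))) => //.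
  by move=> y Vy; rewrite jacobianE//; apply: cPhi.1; exact: thU.
apply: (@ck_comp R n n k V U ('D_(delta_mx 0 i') (fun x => Phi x 0 j')) theta oV oU thU (IH (ckS cP))).
by have /(ck_rVP _ _ oU)/(_ j') [_] := cP; exact.
Qed.

End LocalInverse.

Theorem inverse_function n (Phi : 'rV[R]_n -> 'rV[R]_n) (U : set 'rV[R]_n) a :
  open_nbhs a U -> is_Ck 1 U Phi -> (forall v, 'D_v Phi a = v) ->
  exists (B V : set 'rV[R]_n) (theta : 'rV[R]_n -> 'rV[R]_n),
  [/\ open_nbhs a B /\ B `<=` U, open_nbhs (Phi a) V,
      forall y, V y -> [/\ B (theta y), Phi (theta y) = y,
        jacobian Phi (theta y) \in unitmx &
        jacobian theta y = invmx (jacobian Phi (theta y))],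
      forall x, B x -> V (Phi x) -> theta (Phi x) = x &
      forall k, is_Ck k U Phi -> is_Ck k V theta].
Proof.
move=> aU cPhi dPhi; have [d d0 Hd] := near_identity aU cPhi dPhi.
pose B := [set x : 'rV[R]_n | `|x - a| < d].
pose V := [set y : 'rV[R]_n | `|y - Phi a| < d / 4].
have oball (c : 'rV[R]_n) r : 0 < r -> open [set x : 'rV[R]_n | `|x - c| < r].
  move=> r0; rewrite (_ : [set x | _] = ball c r); first exact: ball_open.
  by rewrite -ball_normE; apply/seteqP; split=> x /=; rewrite distrC.
have /choice[theta Htheta] (y : 'rV[R]_n) : exists x, V y -> B x /\ Phi x = y.
  have [Vy|] := pselect (V y); last by exists a.
  by have [x xa Ex] := local_surjective aU cPhi d0 Hd Vy; exists x.
have oV : open V by apply: oball; rewrite divr_gt0.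
exists B, V, theta; split.
- split; last by move=> x Bx; have [] := Hd x x Bx Bx.
  by split; [exact: oball|rewrite /B /= subrr normr0].
- by split=> //; rewrite /V /= subrr normr0 divr_gt0.
- move=> y Vy; have [Bx Ex] := Htheta y Vy; split=> //.
    exact: (jacobian_unit cPhi Hd Bx).
  have [dth thE] := local_inverse_differentiable cPhi Hd oV Vy Htheta.
  apply/matrixP => i j; rewrite jacobianE// thE (bigD1 i)//= mxE !eqxx mul1r.
  by rewrite big1 ?addr0// => i' /negbTE i'i; rewrite mxE eqxx/= i'i mul0r.
- move=> x Bx Vx; have [Bx' Ex] := Htheta _ Vx.
  have := local_expansion Hd Bx' Bx; rewrite Ex subrr normr0 mulr0 normr_le0.
  by rewrite subr_eq0 => /eqP.
- by move=> k; exact: (local_inverse_ck aU cPhi Hd oV Htheta).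
Qed.

End InverseFunction.

(** * Nearest points, and charts in which a submanifold is linear *)

Section MetricProjection.
Context {R : realType} {n : nat}.
Implicit Types (x y v : 'rV[R]_n) (M : set 'rV[R]_n).

Definition le_order (k : nat) (p : option nat) : bool :=
  if p is Some m then (k <= m)%N else true.

Lemma is_CpP (W : normedModType R) p (U : set 'rV[R]_n) (f : 'rV[R]_n -> W) :
  is_Cp p U f <-> forall k, le_order k p -> is_Ck k U f.
Proof.
case: p => [m|] /=; last by split=> [H k _|H k]; exact: H.
by split=> [H k km|]; [exact: ck_le km H|apply].
Qed.

Lemma metric_projP M x p : metric_proj M x p <->
  M p /\ forall q, M q -> enorm (x - p) <= enorm (x - q).
Proof.
have lb0 : has_lbound [set enorm (x - y) | y in M].
  by exists 0 => _ [y _ <-]; exact: enorm_ge0.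
split=> [[Mp E]|[Mp H]]; split=> //.
  by move=> q Mq; rewrite E; apply: ge_inf => //; exists q.
apply/le_anti/andP; split; last by apply: ge_inf => //; exists p.
by apply: lb_le_inf => [|_ [q Mq <-]]; [exists (enorm (x - p)), p|exact: H].
Qed.

Lemma metric_proj_id M x : M x -> metric_proj M x = [set x].
Proof.
move=> Mx; apply/seteqP; split=> [p /metric_projP[Mp H]|_ ->].
  have := H x Mx; rewrite subrr enorm0 => H0.
  have /enorm0_eq0/eqP : enorm (x - p) = 0 by apply/le_anti; rewrite H0 enorm_ge0.
  by rewrite subr_eq0 => /eqP <-.
by apply/metric_projP; split=> // q _; rewrite subrr enorm0 enorm_ge0.
Qed.

Lemma metric_proj_close M x p a : metric_proj M x p -> M a ->
  enorm (p - a) <= 2 * enorm (x - a).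
Proof.
move=> /metric_projP[_ H] Ma; have := ler_enormB p x a.
by rewrite (enormB p x); have := H a Ma; lra.
Qed.

Lemma continuous_enorm : continuous (@enorm R n).
Proof.
move=> x; apply/continuous_eps => e e0.
apply: filterS (near_enorm x e0) => y /ltW; apply: le_trans.
rewrite ler_norml; have := ler_enormD (y - x) x; have := ler_enormD (x - y) y.
by rewrite !subrK (enormB x y); move=> H1 H2; apply/andP; split; lra.
Qed.

Lemma derive_dotp m (f g : 'rV[R]_n -> 'rV[R]_m) x v :
  differentiable f x -> differentiable g x ->
  'D_v (fun y => dotp (f y) (g y)) x = dotp ('D_v f x) (g x) + dotp (f x) ('D_v g x).
Proof.
move=> df dg; have dfi i : derivable (fun y => f y 0 i) x v.
  by apply: diff_derivable; move: i; apply/differentiable_rVP.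
have dgi i : derivable (fun y => g y 0 i) x v.
  by apply: diff_derivable; move: i; apply/differentiable_rVP.
have -> : (fun y => dotp (f y) (g y)) =
    \sum_(i < m) ((fun y => f y 0 i) * (fun y => g y 0 i)).
  by rewrite fct_sumE.
rewrite derive_sum => [|i]; last exact: derivableM.
rewrite /dotp -big_split; apply: eq_bigr => i _ /=.
rewrite deriveM// !derive_rV// [RHS]addrC; congr (_ + _).
exact: mulrC.
Qed.

Lemma ck_mulmx m l k (U : set 'rV[R]_n) (f : 'rV[R]_n -> 'rV[R]_m)
    (A : 'rV[R]_n -> 'M[R]_(m, l)) : open U -> is_Ck k U f ->
  (forall i j, is_Ck k U (fun x => A x i j)) -> is_Ck k U (fun x => f x *m A x).
Proof.
move=> oU /(ck_rVP _ _ oU) cf cA; apply/(ck_rVP _ _ oU) => j.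
apply: (@ck_eq _ _ _ _ _ (fun x => \sum_i f x 0 i * A x i j)) => //.
  by move=> x _; rewrite mxE.
by apply: ck_sum => // i; exact: ck_mul.
Qed.

Lemma ck_id k (U : set 'rV[R]_n) : open U -> is_Ck k U (fun x => x).
Proof. by move=> oU; apply/ck_rVP => // j; exact: ck_coord. Qed.

Lemma ck_mulmx_cst m l k (U : set 'rV[R]_n) (f : 'rV[R]_n -> 'rV[R]_m)
    (A : 'M[R]_(m, l)) : open U -> is_Ck k U f -> is_Ck k U (fun x => f x *m A).
Proof. by move=> oU cf; apply: ck_mulmx => // i j; exact: ck_cst. Qed.

Lemma mulmxr_differentiable m l (f : 'rV[R]_n -> 'rV[R]_m) (A : 'M[R]_(m, l)) x :
  differentiable f x -> differentiable (fun y => f y *m A) x /\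
  forall v, 'D_v (fun y => f y *m A) x = 'D_v f x *m A.
Proof.
move=> df; have cA : continuous (mulmxr A : 'rV[R]_m -> 'rV[R]_l).
  have H : is_Ck 0 setT (fun y : 'rV[R]_m => y *m A).
    apply/ck_rVP; first exact: openT.
    move=> j; apply: (@ck_eq _ _ _ _ _ (fun y : 'rV[R]_m => \sum_i y 0 i * A i j)).
    - exact: openT.
    - by move=> y _; rewrite mxE.
    - apply: ck_sum; first exact: openT.
      by move=> i; apply: ck_mul; [exact: openT|exact: ck_coord|exact: ck_cst].
  by move=> y; exact: (H y I).
have dA (y : 'rV[R]_m) : differentiable (mulmxr A : 'rV[R]_m -> 'rV[R]_l) y.
  exact: linear_differentiable.
have dc : differentiable ((mulmxr A : 'rV[R]_m -> 'rV[R]_l) \o f) x.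
  exact: differentiable_comp.
split=> // v; rewrite -[fun y => _]/((mulmxr A : 'rV[R]_m -> 'rV[R]_l) \o f).
by rewrite deriveE// diff_comp//= diff_lin//= deriveE.
Qed.

Lemma dotp_mulmx_sym (E : 'M[R]_n) x y : E^T = E -> dotp (x *m E) y = dotp x (y *m E).
Proof. by move=> ET; rewrite !dotpE trmx_mul ET mulmxA. Qed.

Lemma enorm_proj_le (E : 'M[R]_n) x : E^T = E -> E *m E = E ->
  enorm (x *m E) <= enorm x.
Proof.
move=> ET EE; have : enorm (x *m E) ^+ 2 <= enorm (x *m E) * enorm x.
  by rewrite enorm_sqr -dotp_mulmx_sym// -mulmxA EE dotp_enorm.
have := enorm_ge0 (x *m E); rewrite le0r => /orP[/eqP->|e0].
  by rewrite enorm_ge0.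
by rewrite expr2 ler_pM2l.
Qed.

(** The condition of [manifold] at one point, with a codimension that may vary with the point:
    strata of different dimensions will be treated together. *)
Definition chart (p : option nat) M a := exists (d : nat) (U : set 'rV[R]_n)
  (F : 'rV[R]_n -> 'rV[R]_d), [/\ open_nbhs a U, is_Cp p U F,
    M `&` U = [set x | U x /\ F x = 0] & \rank (jacobian F a) = d].

Lemma gram_unit d (J : 'M[R]_(n, d)) : \rank J = d -> J^T *m J \in unitmx.
Proof.
move=> rJ; rewrite -row_free_unit; apply: inj_row_free => v vG.
have fJ : row_free J^T by rewrite /row_free mxrank_tr rJ.
have : enorm (v *m J^T) ^+ 2 = 0.
  by rewrite enorm_sqr dotpE trmx_mul trmxK -mulmxA [J^T *m _]mulmxA mulmxA vG mul0mx mxE.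
move=> /eqP; rewrite sqrf_eq0 => /eqP/enorm0_eq0 H.
by apply: (row_free_inj fJ); rewrite H mul0mx.
Qed.

(** N = J (J^T J)^-1 J^T is the orthogonal projection onto the normal space at a, and E = 1 - N that
    onto the tangent space. Phi keeps the tangential part of x - a and takes F, carried into the
    normal space by B, as normal part. Its derivative at a is E + J B = id, and F = 0 says that the
    normal part of Phi vanishes. *)
Lemma straightening p M a : le_order 1 p -> M a -> chart p M a ->
  exists (E : 'M[R]_n) (U : set 'rV[R]_n) (Phi : 'rV[R]_n -> 'rV[R]_n),
  [/\ E^T = E /\ E *m E = E, open_nbhs a U,
    forall k, le_order k p -> is_Ck k U Phi,
    Phi a = 0 /\ forall v, 'D_v Phi a = v &
    forall x, U x -> M x <-> Phi x *m E = Phi x].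
Proof.
move=> p1 Ma [d [U [F [aU /is_CpP cF MU rJ]]]]; have [oU Ua] := aU.
set J := jacobian F a in rJ.
have Gu := gram_unit rJ; set G := J^T *m J in Gu.
pose B := invmx G *m J^T.
have BJ : B *m J = 1%:M by rewrite /B -mulmxA mulVmx.
pose N := J *m B.
have GT : G^T = G by rewrite /G trmx_mul trmxK.
have NT : N^T = N by rewrite /N /B !trmx_mul trmxK trmx_inv GT mulmxA.
have NN : N *m N = N by rewrite /N -mulmxA [B *m _]mulmxA BJ mul1mx.
have NE : N *m (1%:M - N) = 0 by rewrite mulmxBr mulmx1 NN subrr.
have BN : B *m N = B by rewrite /N mulmxA BJ mul1mx.
have Fa : F a = 0.
  have : (M `&` U) a by []. 
  by rewrite MU => -[].
exists (1%:M - N), U, (fun x => (x - a) *m (1%:M - N) + F x *m B); split=> //.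
- split; first by rewrite linearB/= trmx1 NT.
  by rewrite mulmxBl mul1mx NE subr0.
- move=> k kp; apply: ck_add => //; last by apply: ck_mulmx_cst => //; exact: cF.
  by apply: ck_mulmx_cst => //; apply: ck_add => //; [exact: ck_id|exact: ck_cst].
- split=> [|v]; first by rewrite subrr mul0mx Fa mul0mx addr0.
  have dF : differentiable F a by exact: (cF 1%N p1).1.
  have dya : differentiable (fun y : 'rV[R]_n => y - a) a.
    by apply: differentiableB; [exact: ex_diff|exact: differentiable_cst].
  have [d1 D1] := mulmxr_differentiable (1%:M - N) dya.
  have [d2 D2] := mulmxr_differentiable B dF.
  rewrite deriveD; [|exact: diff_derivable|exact: diff_derivable].
  rewrite D1 D2 deriveB; [|exact: derivable_id|exact: derivable_cst].
  rewrite derive_id derive_cst subr0 deriveEjacobian// -/J -mulmxA -/N.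
  by rewrite -mulmxDr subrK mulmx1.
- move=> x Ux; have FB : F x *m B = 0 <-> F x = 0.
    split=> [H|->]; last by rewrite mul0mx.
    by rewrite -[F x]mulmx1 -BJ mulmxA H mul0mx.
  have MF : M x <-> F x = 0.
    have : (M `&` U) x <-> [set x | U x /\ F x = 0] x by rewrite MU.
    by move=> [H1 H2]; split=> [Mx|Fx]; [have [] := H1 (conj Mx Ux)|have [] := H2 (conj Ux Fx)].
  rewrite MF -FB; set z := (x - a) *m _; set w := F x *m B.
  have zE : z *m (1%:M - N) = z.
    by rewrite /z -mulmxA [(1%:M - N) *m _]mulmxBl mul1mx NE subr0.
  have wE : w *m (1%:M - N) = 0.
    by rewrite /w mulmxBr mulmx1 -mulmxA BN subrr.
  rewrite mulmxDl zE wE addr0; split=> [->|H]; first by rewrite addr0.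
  by apply: (addrI z); rewrite addr0 -H.
Qed.

End MetricProjection.

(** * The metric projection near a point of a submanifold *)

Section LocalProjection.
Context {R : realType} {n : nat}.
Implicit Types (x y v : 'rV[R]_n) (M : set 'rV[R]_n).

Lemma near_forall (I : finType) (P : I -> 'rV[R]_n -> Prop) x :
  (forall i, \forall y \near x, P i y) -> \forall y \near x, forall i, P i y.
Proof. exact: (@filter_forall _ I P (nbhs x) (nbhs_filter x)). Qed.

(** The squared distance from x to theta (u + t q) has a minimum at t = 0, where its derivative is
    -2 times the scalar product in question. *)
Lemma critical_point (theta : 'rV[R]_n -> 'rV[R]_n) (V : set 'rV[R]_n) x u q :
  open V -> V u -> is_Ck 1 V theta ->
  (\forall t \near (0 : R), enorm (x - theta u) <= enorm (x - theta (u + t *: q))) ->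
  dotp (x - theta u) ('D_q theta u) = 0.
Proof.
move=> oV Vu [dth _] Hmin.
pose gg w := dotp (x - theta w) (x - theta w).
have dxt w : V w -> differentiable (fun z => x - theta z) w.
  by move=> Vw; apply: differentiableB; [exact: differentiable_cst|exact: dth].
have dgg w : V w -> differentiable gg w.
  move=> Vw; have -> : gg = \sum_(i < n)
      ((fun z => (x - theta z) 0 i) * (fun z => (x - theta z) 0 i)).
    by rewrite fct_sumE.
  have H i := (differentiable_rVP _ _).1 (dxt w Vw) i.
  by apply: differentiable_sum => i; exact: differentiableM.
have nV : \forall t \near (0 : R), V (u + t *: q).
  have cl : {for (0 : R), continuous (fun t : R => u + t *: q)}.
    by apply: continuousD; [exact: cst_continuous|exact: scalel_continuous].
  by apply: cl; rewrite scale0r addr0; exact: open_nbhs_nbhs.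
have /(nbhs_normP (0 : R))[r /= r0 Hr] : \forall t \near (0 : R), V (u + t *: q) /\
   enorm (x - theta u) <= enorm (x - theta (u + t *: q)) by exact: filterI.
have Hr' (t : R) : t \in `](- r), r[ -> V (u + t *: q) /\
   enorm (x - theta u) <= enorm (x - theta (u + t *: q)).
  by rewrite in_itv/= => tr; apply: Hr; rewrite /= sub0r normrN ltr_norml.
have E0 : u + (0 : R) *: q = u by rewrite scale0r addr0.
have D0 : is_derive (0 : R) 1 (fun t : R => gg (u + t *: q)) 0.
  apply: (@derive1_at_min R _ (- r) r 0).
  - by rewrite ltW// gtrN.
  - move=> t /Hr'[Vt _].
    have dl : derivable gg (u + t *: q) q by apply: diff_derivable; exact: dgg.
    by have [] := is_derive_line dl.
  - by rewrite in_itv/= oppr_lt0 r0.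
  - move=> t /Hr'[_ H]; rewrite E0 /gg -!enorm_sqr.
    by rewrite ler_pXn2r ?nnegrE ?enorm_ge0.
have D1 : is_derive (0 : R) 1 (fun t : R => gg (u + t *: q)) ('D_q gg u).
  have := @is_derive_line _ _ gg u q 0; rewrite E0; apply.
  by apply: diff_derivable; exact: dgg.
have : 'D_q gg u = 0.
  have [_ <-] := D1; by have [_ ->] := D0.
rewrite /gg derive_dotp; [|exact: dxt|exact: dxt].
have -> : 'D_q (fun y => x - theta y) u = - 'D_q theta u.
  rewrite deriveB; [|exact: derivable_cst|exact/diff_derivable/dth].
  by rewrite derive_cst sub0r.
rewrite dotpNl dotpNr dotpC; lra.
Qed.

(** The term in which A is differentiated keeps the factor z N, which is 0 at z = 0. *)
Lemma derive_bilinear_at0 m (A : 'rV[R]_n -> 'M[R]_(n, m)) (N : 'M[R]_n)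
    (V : set 'rV[R]_n) v : open_nbhs (0 : 'rV[R]_n) V ->
  (forall i j, is_Ck 1 V (fun z => A z i j)) ->
  'D_v (fun z => z *m N *m A z) 0 = v *m N *m A 0.
Proof.
move=> [oV V0] cA; apply/rowP => j.
have cid' : is_Ck 1 V (fun z : 'rV[R]_n => z *m N).
  by apply: ck_mulmx_cst => //; exact: ck_id.
have c1 : is_Ck 1 V (fun z => z *m N *m A z) by exact: ck_mulmx.
rewrite derive_rV; last exact: c1.1.
have -> : (fun z : 'rV[R]_n => (z *m N *m A z) 0 j) =
          (fun z => dotp (z *m N) ((col j (A z))^T)).
  by apply/funext => z; rewrite mxE; apply: eq_bigr => i _; rewrite !mxE.
have c2 : is_Ck 1 V (fun z => (col j (A z))^T).
  apply/ck_rVP => // i; apply: ck_eq (cA i j) => // z _.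
  by rewrite !mxE.
rewrite derive_dotp; [|exact: cid'.1|exact: c2.1].
rewrite mul0mx [dotp 0 _](_ : _ = 0) ?addr0; last by rewrite dotpE mul0mx mxE.
have dI : differentiable (fun z : 'rV[R]_n => z) 0 by exact: ex_diff.
have [_ ->] := mulmxr_differentiable N dI.
rewrite (_ : 'D_v (fun z => z) 0 = v); last exact: derive_id.
by rewrite [RHS]mxE; apply: eq_bigr => i _; rewrite !mxE.
Qed.

(** The points theta (u) + w J_Phi^T with w E = 0 form the normal space at theta (u). A nearest
    point q = theta (u) of x is critical, so w = (x - q) J_theta^T satisfies w E = 0 and x = G (u +
    w). Inverting G recovers u from x, which gives uniqueness and smoothness at once; one derivative
    is lost because G contains J_Phi. Existence comes from a compact piece of M around a. *)
Lemma local_projection p M a : le_order 1 p -> M a -> chart (omap succn p) M a ->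
  exists (O : set 'rV[R]_n) (pi : 'rV[R]_n -> 'rV[R]_n), [/\ open_nbhs a O,
    forall x, O x -> metric_proj M x = [set pi x],
    forall k, le_order k p -> is_Ck k O pi &
    forall x y, O x -> O y -> enorm (pi y - pi x) <= 2 * enorm (y - x)].
Proof.
move=> p1 Ma ch.
have p1' : le_order 1 (omap succn p) by case: (p) p1.
have pS k : le_order k p -> le_order k.+1 (omap succn p) by case: (p).
have [E [U [Phi [[ET EE] aU cPhi [Phia dPhi] MPhi]]]] := straightening p1' Ma ch.
have [oU Ua] := aU.
have [B [V [theta [[aB BU] oV0 thetaP thetaK cth]]]] := inverse_function aU (cPhi _ p1') dPhi.
rewrite Phia in oV0; have [oV V0] := oV0; have [oB Ba] := aB.
have th0 : theta 0 = a by rewrite -{1}Phia; apply: thetaK => //; rewrite Phia.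
have c1th : is_Ck 1 V theta by exact/cth/cPhi.
have dJ0 : jacobian Phi a = 1%:M.
  apply/row_matrixP => i; rewrite rowE -deriveEjacobian; last exact: (cPhi _ p1').1.
  by rewrite dPhi rowE mulmx1.
have Jth0 : jacobian theta 0 = 1%:M.
  by have [_ _ _ ->] := thetaP 0 V0; rewrite th0 dJ0 invmx1.
pose N : 'M[R]_n := 1%:M - E.
have NE : N *m E = 0 by rewrite mulmxBl mul1mx EE subrr.
have EN : E *m N = 0 by rewrite mulmxBr mulmx1 EE subrr.
have NN : N *m N = N by rewrite /N mulmxBr mulmx1 -/N NE subr0.
have ENs : E + N = 1%:M by rewrite /N addrC subrK.
pose VE := [set z : 'rV[R]_n | V (z *m E)].
have cE : continuous (fun z : 'rV[R]_n => z *m E).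
  have H : is_Ck 0 setT (fun z : 'rV[R]_n => z *m E).
    by apply: ck_mulmx_cst; [exact: openT|apply: ck_id; exact: openT].
  by move=> z; exact: (H z I).
have oVE : open VE by apply: open_comp => // z _; exact: cE.
have VE0 : VE 0 by rewrite /VE /= mul0mx.
pose A z := (jacobian Phi (theta (z *m E)))^T.
pose G z := theta (z *m E) + z *m N *m A z.
have cthE k : le_order k p -> is_Ck k VE (fun z => theta (z *m E)).
  move=> kp; apply: (@ck_comp_rV _ _ _ _ _ VE V theta) => //.
    by apply: ck_mulmx_cst => //; exact: ck_id.
  by apply: cth; apply: cPhi; case: (p) kp => //= m; exact: leqW.
have cA k : le_order k p -> forall i j, is_Ck k VE (fun z => A z i j).
  move=> kp i j.
  have BV z : VE z -> U (theta (z *m E)) by move=> Vz; have [/BU] := thetaP _ Vz.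
  apply: (@ck_eq _ _ _ _ _ (fun z => 'D_(delta_mx 0 j) (fun x => Phi x 0 i) (theta (z *m E)))) => //.
    by move=> z /BV Uz; rewrite mxE jacobianE//; exact: (cPhi _ p1').1.
  apply: (@ck_comp R n n k VE U ('D_(delta_mx 0 j) (fun x => Phi x 0 i)) (fun z => theta (z *m E))) => //.
    exact: cthE.
  by have /(ck_rVP _ _ oU)/(_ i) [_] := cPhi _ (pS k kp); exact.
have cG k : le_order k p -> is_Ck k VE G.
  move=> kp; apply: ck_add => //; first exact: cthE.
  apply: ck_mulmx => //; last exact: cA.
  by apply: ck_mulmx_cst => //; exact: ck_id.
have G0 : G 0 = a by rewrite /G !mul0mx addr0 th0.
have dth0 : differentiable theta 0 by exact: c1th.1.
have dthE v : 'D_v (fun z => theta (z *m E)) 0 = v *m E.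
  have dI : differentiable (fun z : 'rV[R]_n => z) 0 by exact: ex_diff.
  have [d1 D1] := mulmxr_differentiable E dI.
  rewrite (@derive_comp R n n _ theta (fun z => z *m E)) ?mul0mx// D1.
  rewrite (_ : 'D_v (fun z => z) 0 = v); last exact: derive_id.
  by rewrite deriveEjacobian// Jth0 mulmx1.
have dG v : 'D_v G 0 = v.
  have db := @derive_bilinear_at0 n A N VE v (conj oVE VE0) (cA _ p1).
  have cb : is_Ck 1 VE (fun z => z *m N *m A z).
    apply: ck_mulmx => //; last exact: cA.
    by apply: ck_mulmx_cst => //; exact: ck_id.
  rewrite deriveD.
  - rewrite dthE db /A mul0mx th0 dJ0 trmx1 mulmx1 -mulmxDr ENs.
    exact: mulmx1.
  - by apply: diff_derivable; exact: (cthE _ p1).1.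
  - by apply: diff_derivable; exact: cb.1.
have [B2 [V2 [theta2 [[aB2 B2VE] oV20 theta2P theta2K cth2]]]] :=
  inverse_function (conj oVE VE0) (cG _ p1) dG.
rewrite G0 in oV20; have [oV2 V2a] := oV20; have [oB2 B20] := aB2.
pose pi x := theta (theta2 x *m E).
have cpi k : le_order k p -> is_Ck k V2 pi.
  move=> kp; apply: (@ck_comp_rV _ _ _ _ _ V2 VE (fun z => theta (z *m E))) => //.
  - by move=> x V2x; apply: B2VE; have [] := theta2P _ V2x.
  - exact/cth2/cG.
  - exact: cthE.
have theta20 : theta2 a = 0 by rewrite -{1}G0; apply: theta2K => //; rewrite G0.
have dpi v : 'D_v pi a = v *m E.
  have dJG : jacobian G 0 = 1%:M.
    apply/row_matrixP => i; rewrite rowE -deriveEjacobian; last exact: (cG _ p1).1.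
    by rewrite dG rowE mulmx1.
  have d2 : differentiable theta2 a by exact: (cth2 _ (cG _ p1)).1.
  rewrite (@derive_comp R n n _ (fun z => theta (z *m E)) theta2)//; last first.
    by rewrite theta20; exact: (cthE _ p1).1.
  rewrite theta20 dthE deriveEjacobian//.
  by have [_ _ _ ->] := theta2P _ V2a; rewrite theta20 dJG invmx1 mulmx1.
have Mth u : V u -> u *m E = u -> M (theta u).
  by move=> Vu uE; have [Bu Pu _ _] := thetaP _ Vu; apply/(MPhi _ (BU _ Bu)); rewrite Pu.
have ME y : B y -> M y -> Phi y *m E = Phi y by move=> By My; exact/(MPhi _ (BU _ By)).
have /(nbhs_normP (0 : 'rV[R]_n))[r /= r0 Hr] := open_nbhs_nbhs oV0.
have {}Hr u : `|u| < r -> V u by move=> ur; apply: Hr; rewrite /= sub0r normrN.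
pose rho := r / 2; have rho0 : 0 < rho by rewrite divr_gt0.
have rhoV u : `|u| <= rho -> V u by move=> ur; apply: Hr; apply: le_lt_trans ur _; rewrite /rho; lra.
have /(nbhs_normP (0 : 'rV[R]_n))[sg /= sg0 Hsg] := open_nbhs_nbhs aB2.
have {}Hsg z : `|z| < sg -> B2 z by move=> zs; apply: Hsg; rewrite /= sub0r normrN.
have sg2 : 0 < sg / 2 by rewrite divr_gt0.
have Jnear : \forall u \near (0 : 'rV[R]_n), forall ij : 'I_n * 'I_n,
    `|'D_(delta_mx 0 ij.1) (fun y => theta y 0 ij.2) u| <= 2.
  apply: near_forall => -[i j] /=.
  have /(ck_rVP _ _ oV)/(_ j) [_ /(_ (delta_mx 0 i) 0 V0)] := c1th.
  move=> /continuous_eps /(_ 1 ltr01); apply: filterS => u H.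
  have H0 : `|'D_(delta_mx 0 i) (fun y => theta y 0 j) 0| <= 1.
    rewrite -jacobianE// Jth0 mxE; case: eqP => _; first by rewrite normr1.
    by rewrite normr0.
  rewrite -[X in `|X|](subrK ('D_(delta_mx 0 i) (fun y => theta y 0 j) 0)).
  by apply: (le_trans (ler_normD _ _)); rewrite -[2]/(1 + 1) lerD.
have Qnear : \forall y \near a, B y /\ (`|Phi y| <= rho /\ (`|Phi y| < sg / 2 /\
    forall ij : 'I_n * 'I_n,
    `|'D_(delta_mx 0 ij.1) (fun z => theta z 0 ij.2) (Phi y)| <= 2)).
  apply: filterI; first exact: open_nbhs_nbhs.
  have cPa : {for a, continuous Phi} by exact: (ck_continuous (cPhi _ p1')).
  pose Q := [set u : 'rV[R]_n | `|u| <= rho /\ (`|u| < sg / 2 /\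
    forall ij : 'I_n * 'I_n, `|'D_(delta_mx 0 ij.1) (fun z => theta z 0 ij.2) u| <= 2)].
  have H : nbhs (0 : 'rV[R]_n) Q.
    apply: filterI; first by apply: filterS (near0_norm_lt rho0) => u /ltW.
    by apply: filterI => //; exact: near0_norm_lt.
  have H' : nbhs (Phi a) Q by rewrite Phia.
  exact: (cPa Q H').
have /nbhs_enormP[s s0 Hs] := Qnear.
pose T := [set u : 'rV[R]_n | `|u| <= rho] `&` [set u | u *m E - u = 0].
have cT : compact T.
  apply: compact_closedI; first exact: compact_norm_le.
  apply: (@closed_comp _ _ (fun u : 'rV[R]_n => u *m E - u) [set 0]).
    move=> u _; apply: (@continuousB _ _ _ (fun u : 'rV[R]_n => u *m E) id); first exact: cE.
    exact: cvg_id.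
  by apply: accessible_closed_set1; apply: hausdorff_accessible; exact: norm_hausdorff.
have TP u : T u -> V u /\ u *m E = u.
  by move=> [ur /eqP]; rewrite subr_eq0 => /eqP uE; split=> //; exact: rhoV.
have T0 : T 0 by split; rewrite /= ?normr0 ?ltW// mul0mx subrr.
(* It is enough to minimise over theta (T): a point of M at distance at least s from a is farther
   from x than a is. *)
have exists_proj x : enorm (x - a) < s / 2 -> exists q, metric_proj M x q.
  move=> xa; have [||u] := @EVT_min_rV R n (fun u => enorm (x - theta u)) T _ cT.
  - by exists 0.
  - apply: continuous_in_subspaceT => u; rewrite inE => /TP[Vu _].
    apply: (@continuous_comp _ _ _ (fun u => x - theta u) (@enorm R n)); last exact: continuous_enorm.
    apply: (@continuousB _ _ _ (fun=> x) theta); first exact: cst_continuous.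
    exact: (ck_continuous c1th).
  rewrite inE => Tu Hu; exists (theta u); apply/metric_projP.
  have [Vu uE] := TP _ Tu; split; first exact: Mth.
  move=> q Mq; have [qa|qa] := ltP (enorm (q - a)) s.
    have [Bq [qr _]] := Hs q qa; have qE := ME _ Bq Mq.
    have Tq : T (Phi q) by split=> //=; rewrite qE subrr.
    have [Vq _] := TP _ Tq.
    by have := Hu (Phi q); rewrite inE thetaK//; exact.
  have := Hu 0; rewrite inE th0 => /(_ T0) H1.
  have := ler_enormB q x a; rewrite (enormB q x); lra.
have n4 : 0 < 4 * n.+1%:R :> R by rewrite mulr_gt0.
(* The entries of J_theta are at most 2 where they are used, so the second bound gives |w| <= 2 n |x
   - a| <= sg / 2 for the normal coordinate w, and u + w stays in B2. *)
pose dl := Num.min (s / 2) (sg / (4 * n.+1%:R)).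
have dl0 : 0 < dl by rewrite lt_min !divr_gt0.
have unique x q : enorm (x - a) < dl -> V2 x -> metric_proj M x q -> q = pi x.
  rewrite lt_min => /andP[xs xsg] V2x qx; have [Mq Hq] := (metric_projP _ _ _).1 qx.
  have qa : enorm (q - a) < s by apply: le_lt_trans (metric_proj_close qx Ma) _; lra.
  have [Bq [qrho [qsg Jq]]] := Hs q qa.
  set u := Phi q in qrho qsg Jq; have Vu : V u by exact: rhoV.
  have uE : u *m E = u by exact: ME.
  have thu : theta u = q by exact: thetaK.
  have [_ _ Ju JJ] := thetaP _ Vu; rewrite thu in Ju JJ.
  have du : differentiable theta u by exact: c1th.1.
  have crit v : dotp (x - q) (v *m E *m jacobian theta u) = 0.
    rewrite -deriveEjacobian// -{1}thu; apply: (critical_point oV Vu c1th).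
    have cl : {for (0 : R), continuous (fun t : R => u + t *: (v *m E))}.
      by apply: continuousD; [exact: cst_continuous|exact: scalel_continuous].
    have nV : \forall t \near (0 : R), V (u + t *: (v *m E)).
      by apply: cl; rewrite scale0r addr0; exact: open_nbhs_nbhs.
    apply: filterS nV => t Vt; rewrite thu; apply: Hq; apply: Mth => //.
    by rewrite mulmxDl uE -scalemxAl -mulmxA EE.
  pose w := (x - q) *m (jacobian theta u)^T.
  have wE : w *m E = 0.
    apply: enorm0_eq0; apply/eqP; rewrite -sqrf_eq0 enorm_sqr -(crit (w *m E)).
    rewrite dotp_mulmx_sym// !dotpE [(w *m E *m E *m _)^T]trmx_mul.
    by rewrite mulmxA.
  pose z := u + w.
  have zE : z *m E = u by rewrite mulmxDl uE wE addr0.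
  have zN : z *m N = w by rewrite /N mulmxBr mulmx1 zE addrC addKr.
  have Gz : G z = x.
    rewrite /G zE zN /A zE thu /w -mulmxA -trmx_mul JJ mulmxV// trmx1 mulmx1.
    by rewrite addrC subrK.
  have B2z : B2 z.
    apply: Hsg; apply: (le_lt_trans (ler_normD _ _)); rewrite (splitr sg) ltr_leD//.
    rewrite [leLHS]/Num.Def.normr/= mx_normrE; apply: bigmax_le; first exact: ltW.
    move=> [i j] _; rewrite ord1 /= mxE; apply: (le_trans (ler_norm_sum _ _ _)).
    apply: (@le_trans _ _ (\sum_(l < n) enorm (x - a) * 2)).
      apply: ler_sum => l _; rewrite normrM; apply: ler_pM => //.
        by apply: (le_trans (ler_coord_enorm _ _)); exact: Hq.
      by rewrite mxE jacobianE//; exact: (Jq (j, l)).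
    rewrite sumr_const card_ord -mulr_natl.
    have H1 : enorm (x - a) * (4 * n.+1%:R) <= sg by rewrite -ler_pdivlMr// ltW.
    have H2 : n%:R <= n.+1%:R :> R by rewrite ler_nat.
    have H3 := enorm_ge0 (x - a); have H4 : 0 <= n%:R :> R by [].
    move: H1 H2 H3 H4; set e := enorm _; set k1 : R := n.+1%:R; set k2 : R := n%:R.
    by move=> H1 H2 H3 H4; have := ler_wpM2l H3 H2; lra.
  have E2 : theta2 x = z by rewrite -Gz; apply: theta2K => //; rewrite Gz.
  by rewrite /pi E2 zE.
(* A remainder with factor 1 / (n + 1) in the sup norm has factor at most 1 in the Euclidean norm;
   together with the derivative E at a, of norm at most 1, it makes up the constant 2. *)
have n1 : 0 < n.+1%:R^-1 :> R by rewrite invr_gt0.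
have [d d0 Hd] := strict_differentiable_rV oV20 (cpi _ p1) n1.
have Onear : \forall x \near a, enorm (x - a) < dl /\ (V2 x /\ `|x - a| < d).
  apply: filterI; first exact: near_enorm.
  apply: filterI; first exact: open_nbhs_nbhs.
  by apply: filterS (near_enorm a d0) => x; exact/le_lt_trans/ler_norm_enorm.
have : nbhs a [set x | enorm (x - a) < dl /\ (V2 x /\ `|x - a| < d)] by [].
rewrite nbhsE; case=> O [oO Oa] HO.
exists O, pi; split=> //.
- move=> x /HO[xdl [V2x _]].
  have [q Hq] : exists q, metric_proj M x q.
    by apply: exists_proj; move: xdl; rewrite lt_min => /andP[].
  apply/seteqP; split=> [q' Hq'|_ ->]; first exact: unique.
  by rewrite -(unique x q).
- by move=> k kp; apply: ck_sub (cpi k kp) => x /HO[_ []].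
- move=> x y /HO[_ [_ xa]] /HO[_ [_ ya]].
  have [_] := Hd x y xa ya; rewrite dpi => H.
  have -> : pi y - pi x = (pi y - pi x - (y - x) *m E) + (y - x) *m E by rewrite subrK.
  apply: (le_trans (ler_enormD _ _)).
  have H1 := enorm_proj_le (y - x) ET EE.
  have H2 := enorm_le_norm (pi y - pi x - (y - x) *m E).
  have H3 : n.+1%:R * `|pi y - pi x - (y - x) *m E| <= `|y - x|.
    by rewrite -ler_pdivlMl.
  have H4 := ler_norm_enorm (y - x).
  lra.
Qed.

End LocalProjection.

(** * Modification near a submanifold *)

Section SetDistance.
Context {R : realType} {n : nat}.
Implicit Types (x y : 'rV[R]_n) (S V : set 'rV[R]_n) (d rho : 'rV[R]_n -> R).

Lemma set_dist_le S x y : S y -> set_dist x S <= enorm (x - y).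
Proof.
by move=> Sy; apply: ge_inf; [exists 0 => _ [z _ <-]; exact: enorm_ge0|exists y].
Qed.

Lemma set_dist_ge S x c : S !=set0 -> (forall y, S y -> c <= enorm (x - y)) ->
  c <= set_dist x S.
Proof.
by move=> [y Sy] H; apply: lb_le_inf; [exists (enorm (x - y)), y|move=> _ [z Sz <-]; exact: H].
Qed.

Lemma set_dist_ge0 S x : 0 <= set_dist x S.
Proof.
have [[y Sy]|S0] := pselect (S !=set0).
  by apply: set_dist_ge => [|z _]; [exists y|exact: enorm_ge0].
by rewrite /set_dist inf_out// => -[[_ [z Sz _]] _]; apply: S0; exists z.
Qed.

Lemma set_dist_lipschitz S : S !=set0 -> lipschitz_cst 1 (fun x => set_dist x S).
Proof.
move=> S0 x y; have H u v : set_dist u S - set_dist v S <= enorm (v - u).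
  rewrite lerBlDr -lerBlDl; apply: set_dist_ge => // z Sz.
  have := set_dist_le u Sz; have := ler_enormB u v z; rewrite (enormB u v); lra.
by rewrite mul1r ler_norml lerNl opprB H enormB H.
Qed.

Lemma set_dist_gt0 S x : S !=set0 -> ~ closure S x -> 0 < set_dist x S.
Proof.
move=> S0 cSx; have : nbhs x (~` closure S).
  by apply: open_nbhs_nbhs; split=> //; exact/closed_openC/closed_closure.
move=> /nbhs_enormP[e e0 H]; apply: (lt_le_trans e0); apply: set_dist_ge => // y Sy.
rewrite leNgt; apply/negP => xy; apply: (H y); last exact: subset_closure.
by rewrite enormB.
Qed.

Lemma dist_to_complement V : open V -> exists rho : 'rV[R]_n -> R,
  [/\ lipschitz_cst 1 rho, forall x, V x -> 0 < rho x & forall x, ~ V x -> rho x = 0].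
Proof.
move=> oV; have [V0|V0] := pselect ((~` V) !=set0).
  exists (fun x => set_dist x (~` V)); split; first exact: set_dist_lipschitz.
    by move=> x Vx; apply: set_dist_gt0 => //; rewrite -(closure_id _).1; [move/(_ Vx)|exact: open_closedC].
  move=> x Vx; apply/le_anti; rewrite set_dist_ge0 andbT.
  by have := @set_dist_le (~` V) x x Vx; rewrite subrr enorm0.
(* For V the whole space, the distance to the empty complement would be 0 by convention; a positive
   constant replaces it. *)
exists (fun=> 1); split=> //; first by move=> x y; rewrite subrr normr0 mul1r enorm_ge0.
by move=> x Vx; exfalso; apply: V0; exists x.
Qed.

(** Affine in d / rho between 1 at d = rho / 4 and 0 at d = rho / 2. At rho x = 0 the convention on
    division makes it 1, so it is used only where rho is positive. *)
Definition cutoff d rho x : R := Num.max 0 (Num.min 1 (2 - 4 * (d x / rho x))).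

Lemma cutoff_itv d rho x : 0 <= cutoff d rho x <= 1.
Proof. by rewrite le_max lexx /= ge_max ler01 ge_min lexx. Qed.

Lemma cutoff0 d rho x : 0 < rho x -> rho x / 2 <= d x -> cutoff d rho x = 0.
Proof.
move=> r0 H; have H1 : 2^-1 <= d x / rho x by rewrite ler_pdivlMr// mulrC.
by rewrite /cutoff; apply/max_idPl; rewrite ge_min; apply/orP; right; lra.
Qed.

Lemma cutoff1 d rho x : 0 < rho x -> d x <= rho x / 4 -> cutoff d rho x = 1.
Proof.
move=> r0 H; have H1 : d x / rho x <= 4^-1 by rewrite ler_pdivrMr// mulrC.
rewrite /cutoff (min_idPl _); last by lra.
by apply/max_idPr.
Qed.

Lemma clamp_lip (a b : R) :
  `|Num.max 0 (Num.min 1 a) - Num.max 0 (Num.min 1 b)| <= `|a - b|.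
Proof.
wlog ab : a b / b <= a => [H|].
  by have [/H//|/ltW/H] := leP b a; rewrite distrC (distrC b).
rewrite (@ger0_norm _ (a - b)) ?subr_ge0// ger0_norm ?subr_ge0.
  rewrite /Num.max /Num.min; do !case: ifPn; rewrite -?leNgt; lra.
by apply: (@le_max2 _ R) => //; apply: (@le_min2 _ R).
Qed.

(** The slope of d / rho is at most (1 + d / rho) / rho <= (3 / 2) / rho, and the cutoff multiplies
    it by 4. *)
Lemma cutoff_plip d rho x : lipschitz_cst 1 d -> lipschitz_cst 1 rho ->
  0 < rho x -> 0 <= d x <= rho x / 2 -> plip (6 / rho x) (cutoff d rho) x.
Proof.
move=> ld lr r0 /andP[d0 dr] e e0.
have cr : {for x, continuous rho} := plip_continuous (lipschitz_plip x lr).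
have H1 : \forall y \near x, 0 < rho y by exact: (cvgr_gt _ cr).
have H2 : \forall y \near x, 6 / rho y < 6 / rho x + e.
  have c6 : {for x, continuous (fun y => 6 / rho y)}.
    apply: (@continuousM _ _ (fun=> 6) (fun y => (rho y)^-1)); first exact: cst_continuous.
    by apply: continuousV => //; rewrite gt_eqF.
  by apply: (cvgr_lt _ c6); rewrite ltrDl.
apply: filterS2 H1 H2 => y ry0 H; apply: (le_trans (clamp_lip _ _)).
have -> : 2 - 4 * (d y / rho y) - (2 - 4 * (d x / rho x)) =
  4 * ((d x * (rho y - rho x) - (d y - d x) * rho x) / (rho x * rho y)).
  by field; rewrite !gt_eqF.
rewrite normrM normrM normfV (gtr0_norm (mulr_gt0 r0 ry0)) (@ger0_norm _ 4)//.
apply: (@le_trans _ _ (6 / rho y * enorm (y - x))); last first.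
  by rewrite ler_wpM2r ?enorm_ge0// ltW.
rewrite mulrA ler_pdivrMr ?mulr_gt0//.
have -> : 6 / rho y * enorm (y - x) * (rho x * rho y) = 6 * (enorm (y - x) * rho x).
  by field; rewrite gt_eqF.
have A1 := ld y x; have A2 := lr y x; rewrite mul1r in A1; rewrite mul1r in A2.
apply: (@le_trans _ _ (4 * (rho x / 2 * enorm (y - x) + enorm (y - x) * rho x))); last by lra.
rewrite ler_wpM2l//; apply: (le_trans (ler_normB _ _)); rewrite lerD// normrM.
  by apply: ler_pM => //; rewrite ger0_norm.
by rewrite (gtr0_norm r0) ler_wpM2r// ltW.
Qed.

Lemma cutoff_continuous d rho x : lipschitz_cst 1 d -> lipschitz_cst 1 rho ->
  0 < rho x -> {for x, continuous (cutoff d rho)}.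
Proof.
move=> ld lr r0.
have cr : {for x, continuous rho} := plip_continuous (lipschitz_plip x lr).
have cd : {for x, continuous d} := plip_continuous (lipschitz_plip x ld).
have cq : {for x, continuous (fun y => 4 * (d y / rho y))}.
  apply: (@continuousM _ _ (fun=> 4) (fun y => d y / rho y)); first exact: cst_continuous.
  by apply: (@continuousM _ _ d (fun y => (rho y)^-1)) => //; apply: continuousV => //; rewrite gt_eqF.
apply/continuous_eps => e e0.
apply: filterS ((continuous_eps _ _).1 cq e e0) => y; apply: le_trans.
apply: (le_trans (clamp_lip _ _)).
set a := d y / rho y; set b := d x / rho x.
by have -> : 2 - 4 * a - (2 - 4 * b) = - (4 * a - 4 * b); [ring|rewrite normrN].
Qed.

End SetDistance.

(** * One correction stage along a submanifold *)

Section Stage.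
Context {R : realType} {n : nat}.
Implicit Types (x y z a : 'rV[R]_n) (Y Z G : set 'rV[R]_n).

Lemma near_metric_proj Y a (S : set 'rV[R]_n) : Y a -> nbhs a S ->
  \forall x \near a, forall y, metric_proj Y x y -> S y.
Proof.
move=> Ya /nbhs_enormP[s s0 H]; have s2 : 0 < s / 2 by rewrite divr_gt0.
apply: filterS (near_enorm a s2) => x xa y yx; apply: H.
by have := metric_proj_close yx Ya; lra.
Qed.

(** V consists of the points around which all the required properties hold, hence is open by
    construction. The parameter [cond] gathers whatever else is wanted near Y, so that V is shrunk
    only once. *)
Lemma tubular_neighborhood p Y (cond : 'rV[R]_n -> 'rV[R]_n -> Prop) : le_order 1 p ->
  (forall a, Y a -> chart (omap succn p) Y a) ->
  (forall a, Y a -> \forall x \near a, forall y, metric_proj Y x y -> cond x y) ->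
  exists (V : set 'rV[R]_n) (P : 'rV[R]_n -> 'rV[R]_n),
  [/\ open V, Y `<=` V, forall x, V x -> metric_proj Y x = [set P x] /\ cond x (P x),
    forall k, le_order k p -> is_Ck k V P &
    forall x, V x -> \forall y \near x, enorm (P y - P x) <= 2 * enorm (y - x)].
Proof.
(* P picks some nearest point, or 0 if there is none; its values matter only where the nearest point
   is unique. *)
move=> p1 chY condY; pose P x : 'rV[R]_n := xget 0 (metric_proj Y x).
have PE x q : metric_proj Y x = [set q] -> P x = q.
  by move=> E; rewrite /P E; case: xgetP => [y _ ->//|/(_ q)/(_ erefl)].
pose good x := exists B : set 'rV[R]_n, [/\ open_nbhs x B,
  forall y, B y -> metric_proj Y y = [set P y] /\ cond y (P y),
  forall k, le_order k p -> is_Ck k B P &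
  forall y z, B y -> B z -> enorm (P z - P y) <= 2 * enorm (z - y)].
have goodP x : good x -> exists B, open_nbhs x B /\ B `<=` good.
  move=> [B [[oO Ox] H1 H2 H3]]; exists B; split; first by split.
  by move=> y Oy; exists B.
exists good, P; split.
- rewrite openE => x /goodP[B [Ox HO]].
  by rewrite /interior/=; apply: filterS HO _; exact: open_nbhs_nbhs.
- move=> a Ya; have [B [pi [[oO Oa] piP cpi lpi]]] := local_projection p1 Ya (chY a Ya).
  have : nbhs a [set x | B x /\ forall y, metric_proj Y x y -> cond x y].
    by apply: filterI; [exact: open_nbhs_nbhs|exact: condY].
  rewrite nbhsE; case=> B' [oO' B'a] HO'; exists B'.
  have EP x : B' x -> P x = pi x by move=> /HO'[Ox _]; exact/PE/piP.
  split; first by split.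
  + move=> x B'x; have [Ox Cx] := HO' x B'x; rewrite EP// piP//; split=> //.
    by apply: Cx; rewrite piP.
  + move=> k kp; apply: (@ck_eq _ _ _ _ _ pi) => //; first by move=> x /EP.
    by apply: ck_sub (cpi k kp) => x /HO'[].
  + by move=> x y B'x B'y; rewrite !EP//; apply: lpi; [have [] := HO' x B'x|have [] := HO' y B'y].
- by move=> x [B [[_ Ox] H _ _]]; exact: H.
- move=> k kp; apply: ck_near => x [B [Ox _ cO _]].
  by exists B, P; split=> //; [exact: cO|exact: near_refl].
- move=> x [B [Ox _ _ lO]]; have [_ Ox'] := Ox; apply: filterS (open_nbhs_nbhs Ox) => y Oy.
  exact: lO.
Qed.

(** Y is the submanifold treated now, Z a closed set that contains its frontier and carries the
    earlier corrections, G a closed set near which the function has to remain 0. The hypothesis on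
    Z, named [flat] in the proof, is the form in which normal flatness enters: near Z the correction
    f o P - f vanishes wherever the nearest point in Y is no farther from x than Z is. Hence F = f
    near Z, although V pinches there. *)
Lemma tangential_modification p Y Z G (V2 U : set 'rV[R]_n) (f e : 'rV[R]_n -> R) (K : R) :
  le_order 1 p -> Y !=set0 -> (forall a, Y a -> chart (omap succn p) Y a) ->
  closed Z -> (forall a, Y a -> ~ Z a) -> closure Y `<=` Y `|` Z ->
  closed G -> (forall x, G x -> \forall y \near x, f y = 0) ->
  (forall a, Y a -> nbhs a V2) -> (forall a, Y a -> nbhs a U) ->
  (forall k, le_order k p -> is_Ck k setT f) ->
  continuous e -> (forall x, 0 < e x) ->
  (forall z, Z z -> \forall x \near z, U x -> forall y, metric_proj Y x = [set y] ->
    enorm (x - y) <= enorm (x - z) -> f y = f x) ->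
  0 < K ->
  exists h : 'rV[R]_n -> R, [/\ forall k, le_order k p -> is_Ck k setT h,
    forall x, `|h x - f x| < e x /\ (~ V2 x -> h x = f x),
    (forall x, Z x -> \near x, h x = f x) /\ (forall x, G x -> \forall y \near x, h y = 0),
    forall a, Y a -> \forall x \near a, exists y, metric_proj Y x = [set y] /\ h x = h y &
    lipschitz_cst K f -> lipschitz_cst (11 * K) h].
Proof.
move=> p1 Y0 chY cZ YZ clY cG fG YV2 YU cf ce e0 flat K0.
have p0 : le_order 0 p by case: (p).
have contf : continuous f by move=> x; exact: (ck_continuous (cf 0%N p0)).
pose O0 := [set x : 'rV[R]_n | \forall y \near x, f y = 0].
have oO0 : open O0 by exact: (@open_interior _ [set x | f x = 0]).
have [chi [schi chi01 chi0 chi1]] := smooth_urysohn cG oO0 fG.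
have cchi : continuous chi by move=> x; exact: (ck_continuous (schi 0%N)).
(* The clauses serve the error bound, the agreement off V2, the use of [flat] (two of them) and the
   support. The last one holds near Y because either f = 0 around the point or chi = 1 there; near
   G, where chi = 0, it gives f (P x) = 0. *)
pose cond x y := [/\ `|f y - f x| < e x / 2, V2 x, U x,
  forall z, Z z -> enorm (x - y) <= enorm (x - z) & (chi x <= 2^-1 -> f y = 0)].
have condY a : Y a -> \forall x \near a, forall y, metric_proj Y x y -> cond x y.
  move=> Ya.
  have N1 : \forall x \near a, e a / 2 < e x by apply: (cvgr_gt _ (ce a)); have := e0 a; lra.
  have e8 : 0 < e a / 8 by rewrite divr_gt0.
  have N2 := (continuous_eps _ _).1 (contf a) _ e8.
  have N3 := near_metric_proj Ya N2.
  have : nbhs a (~` Z) by apply: open_nbhs_nbhs; split; [exact: closed_openC|exact: YZ].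
  move=> /nbhs_enormP[s s0 Hs]; have s2 : 0 < s / 2 by rewrite divr_gt0.
  have N4 := near_enorm a s2.
  have N5 : \forall x \near a, forall y, metric_proj Y x y -> chi x <= 2^-1 -> f y = 0.
    have [Oa|Oa] := pselect (O0 a).
      by apply: filterS (near_metric_proj Ya Oa) => x H y /H.
    apply: filterS (chi1 a Oa) => x -> y _; rewrite invf_ge1//; lra.
  near=> x => y yx; split.
  - have H1 : e a / 2 < e x by near: x.
    have H2 : `|f x - f a| <= e a / 8 by near: x.
    have H3 : `|f y - f a| <= e a / 8 by move: y yx; near: x.
    by have := ler_distD (f a) (f y) (f x); rewrite (distrC (f a)); lra.
  - by near: x; exact: YV2.
  - by near: x; exact: YU.
  - move=> z Zz; have xa : enorm (x - a) < s / 2 by near: x.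
    have [_ /(_ a Ya) H] := (metric_projP _ _ _).1 yx.
    have za : s <= enorm (z - a) by rewrite leNgt; apply/negP => /Hs.
    have := ler_enormB z x a; rewrite (enormB z x); lra.
  - by move: y yx; near: x.
have [V [P [oV YV PV cP lP]]] := tubular_neighborhood p1 chY condY.
have [rho [lrho rho0 rhoV]] := dist_to_complement oV.
pose d x := set_dist x Y; have ld : lipschitz_cst 1 d := set_dist_lipschitz Y0.
have d0 x : 0 <= d x by exact: set_dist_ge0.
have cd x : {for x, continuous d} := plip_continuous (lipschitz_plip x ld).
have crho x : {for x, continuous rho} := plip_continuous (lipschitz_plip x lrho).
have YP x : V x -> Y (P x) /\ enorm (x - P x) = d x.
  by move=> /PV[E _]; have : metric_proj Y x (P x) by rewrite E.
have PY a : Y a -> P a = a.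
  by move=> Ya; have [] := PV a (YV a Ya); rewrite metric_proj_id// => /seteqP[/(_ a erefl)].
have dY a : Y a -> d a = 0.
  by move=> Ya; have [_ <-] := YP a (YV a Ya); rewrite PY// subrr enorm0.
pose F0 x := f x + cutoff d rho x * (f (P x) - f x).
pose F x := if `[< V x >] then F0 x else f x.
have FV x : V x -> F x = F0 x by move=> Vx; rewrite /F asboolT.
have FC x : ~ V x -> F x = f x by move=> Vx; rewrite /F asboolF.
have nV x : V x -> nbhs x V by move=> Vx; exact: open_nbhs_nbhs.
have nFV x : V x -> \near x, F0 x = F x by move=> Vx; apply: filterS (nV x Vx) => y /FV.
have nFZ x : Z x -> \near x, F x = f x.
  move=> Zx; apply: filterS (flat x Zx) => y H.
  have [Vy|/FC//] := pselect (V y); have [E [_ _ Uy Hy _]] := PV y Vy.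
  by rewrite FV// /F0 (H Uy _ E (Hy _ Zx)) subrr mulr0 addr0.
(* A point x outside V either is in the closure of Y, hence in Z where F = f nearby, or has d x > 0
   = rho x, and then the cutoff vanishes around x. *)
have nFC x : ~ V x -> \near x, F x = f x.
  move=> Vx; have [cx|cx] := pselect (closure Y x).
    by have [/YV//|] := clY x cx; exact: nFZ.
  have dx : 0 < d x by exact: set_dist_gt0.
  have N : \forall y \near x, rho y / 2 < d y.
    have H1 : \forall y \near x, rho y < d x by apply: (cvgr_lt _ (crho x)); rewrite rhoV.
    have H2 : \forall y \near x, d x / 2 < d y by apply: (cvgr_gt _ (cd x)); lra.
    by apply: filterS2 H1 H2 => y; lra.
  apply: filterS N => y dy; have [Vy|/FC//] := pselect (V y).
  by rewrite FV// /F0 cutoff0 ?mul0r ?addr0 ?rho0// ltW.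
have nFY a : Y a -> \near a, F a = f (P a).
  move=> Ya; have Va := YV a Ya; have ra := rho0 a Va.
  have H1 : \forall x \near a, rho a / 2 < rho x by apply: (cvgr_gt _ (crho a)); lra.
  have H2 : \forall x \near a, d x < rho a / 8 by apply: (cvgr_lt _ (cd a)); rewrite dY//; lra.
  near=> x; have Vx : V x by near: x; exact: nV.
  rewrite FV// /F0 cutoff1 ?rho0//; first by rewrite mul1r addrC subrK.
  have : rho a / 2 < rho x by near: x.
  have : d x < rho a / 8 by near: x.
  lra.
have nFG x : G x -> \forall y \near x, F y = 0.
  move=> Gx; have N := chi0 x Gx; have N2 := fG x Gx; near=> y.
  have fy : f y = 0 by near: y.
  have [Vy|/FC -> //] := pselect (V y); have [_ [_ _ _ _ H]] := PV y Vy.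
  rewrite FV// /F0 fy H ?subrr ?mulr0 ?addr0//.
  have -> : chi y = 0 by near: y.
  by rewrite invr_ge0.
have fP k : le_order k p -> is_Ck k V (fun x => f (P x)).
  by move=> kp; apply: (@ck_comp R n n k V setT f P) => //; [exact: openT|exact: cP|exact: cf].
have cF : continuous F.
  move=> x; have [Vx|Vx] := pselect (V x); last first.
    by apply: near_eq_continuous (contf x); apply: filterS (nFC x Vx) => y ->.
  apply: near_eq_continuous (nFV x Vx) _.
  apply: (@continuousD _ _ _ f (fun x => cutoff d rho x * (f (P x) - f x))); first exact: contf.
  apply: (@continuousM _ _ (cutoff d rho) (fun x => f (P x) - f x)).
    by apply: cutoff_continuous => //; exact: rho0.
  apply: (@continuousB _ _ _ (fun x => f (P x)) f); last exact: contf.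
  exact: (ck_continuous (fP 0%N p0)).
have FK x : lipschitz_cst K f -> plip (5 * K) F x.
  move=> lf; have K5 : K <= 5 * K by lra.
  have pf : plip (5 * K) f x by apply: plip_le K5 _; exact: lipschitz_plip.
  have [Vx|Vx] := pselect (V x); last first.
    by apply: near_eq_plip pf; apply: filterS (nFC x Vx) => y ->.
  have rx := rho0 x Vx; have [_ dx] := YP x Vx.
  have [dr|dr] := ltP (rho x / 2) (d x).
    apply: near_eq_plip pf.
    have cdr : {for x, continuous (fun y => d y - rho y / 2)}.
      apply: (@continuousB _ _ _ d (fun y => rho y / 2)); first exact: cd.
      by apply: (@continuousM _ _ rho (fun=> 2^-1)); [exact: crho|exact: cst_continuous].
    have N : \forall y \near x, 0 < d y - rho y / 2 by apply: (cvgr_gt _ cdr); lra.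
    apply: filterS N => y dy; have [Vy|/FC->//] := pselect (V y).
    rewrite FV// /F0 cutoff0 ?mul0r ?addr0 ?rho0//; lra.
  apply: near_eq_plip (nFV x Vx) _.
  have c0 := cutoff_itv d rho x; have /andP[c00 c01] := c0.
  have K2 : 0 <= 2 * K by lra.
  have c6 : 0 <= 6 / rho x by rewrite divr_ge0// ltW.
  have pP : plip (2 * K) (fun x => f (P x)) x.
    move=> t t0; apply: filterS (lP x Vx) => y Hy.
    apply: (le_trans (lf _ _)); have H := ler_wpM2l (ltW K0) Hy.
    have := enorm_ge0 (y - x) => H'; have H2 := mulr_ge0 (ltW t0) H'; lra.
  have dd : 0 <= d x <= rho x / 2 by rewrite d0.
  have := plip_mix (ltW K0) K2 c6 c0 (lipschitz_plip x lf) pP (cutoff_plip ld lrho rx dd).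
  apply: plip_le; set c := cutoff d rho x in c00 c01 *.
  have H1 : 6 / rho x * `|f (P x) - f x| <= 3 * K.
    apply: (@le_trans _ _ (6 / rho x * (K * (rho x / 2)))).
      rewrite ler_wpM2l//; apply: (le_trans (lf _ _)); rewrite ler_wpM2l ?(ltW K0)//.
      by rewrite enormB dx.
    have -> : 6 / rho x * (K * (rho x / 2)) = 3 * K by field; rewrite gt_eqF.
    exact: lexx.
  have H2 : c * K <= 1 * K by rewrite ler_wpM2r// ltW.
  have H3 : (1 - c) * K + c * (2 * K) = K + c * K by ring.
  lra.
(* The closed set near which the final smoothing must not change F: Y for the new tangency, Z for
   the earlier ones, G for the support, the complement of V for the agreement off V2. Around each of
   its points F equals f, f o P or 0, hence is smooth. *)
have WF x : (closure Y `|` Z `|` G `|` ~` V) x -> exists B, open_nbhs x B /\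
    forall k, le_order k p -> is_Ck k B F.
  have H g B : nbhs x B -> (\near x, F x = g x) -> (forall k, le_order k p -> is_Ck k B g) ->
      exists B, open_nbhs x B /\ forall k, le_order k p -> is_Ck k B F.
    move=> nO nFg cg; have : nbhs x [set y | B y /\ F y = g y] by apply: filterI.
    rewrite nbhsE; case=> B' oO' HO'; exists B'; split=> // k kp.
    apply: (@ck_eq _ _ _ _ _ g); [by case: oO'|by move=> y /HO'[]|].
    by apply: ck_sub (cg k kp) => y /HO'[].
  have HZ : Z x -> exists B, open_nbhs x B /\ forall k, le_order k p -> is_Ck k B F.
    by move=> Zx; apply: (H f setT) => //; [exact: filterT|exact: nFZ].
  move=> [[[/clY[Yx|//]|//]|Gx]|Vx].
  - by apply: (H (fun x => f (P x)) V) => //; [exact/nV/YV|exact: nFY].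
  - apply: (H (fun=> 0) setT); [exact: filterT|exact: nFG|move=> k _; exact: ck_cst].
  - by apply: (H f setT) => //; [exact: filterT|exact: nFC].
pose W := [set x | exists B, open_nbhs x B /\ forall k, le_order k p -> is_Ck k B F].
have oW : open W.
  rewrite openE => x [B [Ox cO]]; have [oO _] := Ox.
  rewrite /interior/=; apply: filterS (open_nbhs_nbhs Ox) => y Oy.
  by exists B; split=> //; split.
have cW k : le_order k p -> is_Ck k W F.
  move=> kp; apply: ck_near => x [B [Ox cO]].
  by exists B, F; split=> //; [exact: cO|exact: near_refl].
have cC : closed (closure Y `|` Z `|` G `|` ~` V).
  apply: closedU; last exact: open_closedC.
  by apply: closedU => //; apply: closedU => //; exact: closed_closure.
have ce2 : continuous (fun x => e x / 2).
  by move=> x; apply: (@continuousM _ _ e (fun=> 2^-1)); [exact: ce|exact: cst_continuous].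
have e2 x : 0 < e x / 2 by rewrite divr_gt0.
have K6 : 0 < 6 * K by rewrite mulr_gt0.
have [h [ch hF hC lh]] := smooth_approx_rel cF cC oW WF ce2 e2 K6.
exists h; split.
- by move=> k kp; exact/ch/cW.
- move=> x; split; last first.
    move=> V2x; have Vx : ~ V x by move=> /PV[_ []].
    by have /nbhs_singleton <- := hC x (or_intror Vx); rewrite FC.
  have := ler_distD (F x) (h x) (f x); have := hF x.
  suff : `|F x - f x| < e x / 2 by lra.
  have [Vx|/FC->] := pselect (V x); last by rewrite subrr normr0.
  have [_ [H _ _ _ _]] := PV x Vx; rewrite FV// /F0 addrC addKr normrM.
  have /andP[c0 c1] := cutoff_itv d rho x; rewrite (ger0_norm c0).
  apply: le_lt_trans H; rewrite -[leRHS]mul1r ler_wpM2r//.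
- split=> x H.
    have := hC x (or_introl (or_introl (or_intror H))).
    by apply: filterS2 (nFZ x H) => y -> ->.
  have := hC x (or_introl (or_intror H)).
  by apply: filterS2 (nFG x H) => y -> ->.
- move=> a Ya; have hY y : Y y -> F y = h y.
    move=> Yy; have /nbhs_singleton// := hC y (or_introl (or_introl (or_introl (subset_closure Yy)))).
  have N1 := hC a (or_introl (or_introl (or_introl (subset_closure Ya)))).
  have N2 := nFY a Ya; have N3 := nV a (YV a Ya).
  near=> x; exists (P x); have Vx : V x by near: x.
  have [E _] := PV x Vx; split=> //; have [YPx _] := YP x Vx.
  have <- : F x = h x by near: x.
  rewrite -hY//; have -> : F x = f (P x) by near: x.
  by rewrite (nbhs_singleton (nFY _ YPx)) (PY _ YPx).
- move=> lf; have -> : 11 * K = 5 * K + 6 * K by ring.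
  have K5 : 0 <= 5 * K by lra.
  by apply: lh => //; apply: plip_lipschitz => x; exact: FK.
Unshelve. all: by end_near.
Qed.

End Stage.

(** * Stratifications *)

Section Strata.
Context {R : realType} {n : nat}.
Implicit Types (x y z a : 'rV[R]_n) (L M Y G : set 'rV[R]_n) (f h : 'rV[R]_n -> R).

Lemma near_finite (T : topologicalType) (I : choiceType) (D : set I)
    (B : I -> set T) (a : T) : finite_set D -> (forall i, D i -> nbhs a (B i)) ->
  \forall x \near a, forall i, D i -> B i x.
Proof.
move=> /finite_seqP[s ->]; elim: s => [|i s IH] H.
  by apply: (filterS _ (@filterT _ (nbhs a) _)) => x _ j; rewrite /= inE.
have H1 : nbhs a (B i) by apply: H; rewrite /= inE eqxx.
have H2 : \forall x \near a, forall j, [set` s] j -> B j x.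
  by apply: IH => j js; apply: H; rewrite /= inE [j \in s]js orbT.
apply: filterS2 H1 H2 => x Bi Bs j; rewrite /= inE => /orP[/eqP->//|]; exact: Bs.
Qed.

(** Strata treated together are projected onto through their union; this recovers the projection
    onto the stratum that contains the nearest point. *)
Lemma metric_proj_sub M Y x y : M `<=` Y -> metric_proj Y x = [set y] -> M y ->
  metric_proj M x = [set y].
Proof.
move=> MY E My; have [_ H] : Y y /\ forall q, Y q -> enorm (x - y) <= enorm (x - q).
  by apply/metric_projP; rewrite E.
apply/seteqP; split=> [q /metric_projP[Mq Hq]|_ ->]; last first.
  by apply/metric_projP; split=> // q /MY; exact: H.
rewrite -E; apply/metric_projP; split; first exact: MY.
by move=> r Yr; apply: (le_trans (Hq y My)); exact: H.
Qed.

Definition tangent_to f M := forall a, M a ->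
  \forall x \near a, exists y, metric_proj M x = [set y] /\ f x = f y.

Lemma near_eq_tangent f h M : (forall a, M a -> \near a, h a = f a) ->
  tangent_to f M -> tangent_to h M.
Proof.
move=> hf tf a Ma; have N := hf a Ma; have N2 := near_metric_proj Ma N.
have N3 := tf a Ma; near=> x.
have [y [E fxy]] : exists y, metric_proj M x = [set y] /\ f x = f y by near: x.
exists y; split=> //; have -> : h x = f x by near: x.
rewrite fxy; apply/esym; have Py : metric_proj M x y by rewrite E.
by move: y Py {E fxy}; near: x.
Unshelve. all: by end_near.
Qed.

Context (p : option nat) (Q : set 'rV[R]_n) (A : set (set 'rV[R]_n)).
Context (p1 : le_order 1 p) (hQ : closed Q) (hA : stratification (omap succn p) Q A).

Definition thin M := A M /\ exists r : nat, (r < n)%N /\ manifold (omap succn p) r M.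

Lemma stratum_neq0 M : A M -> M !=set0.
Proof. by move=> AM; have [_ [_ _ /(_ M AM)]] := hA. Qed.

Lemma stratum_disjoint L M x : A L -> A M -> L x -> M x -> L = M.
Proof. by move=> AL AM Lx Mx; have [_ [_ + _] _ _] := hA; apply=> //; exists x. Qed.

Lemma stratum_chart M a : A M -> M a -> chart (omap succn p) M a.
Proof.
move=> AM Ma; have [_ _ /(_ M AM)[r [_ /(_ a Ma)[U [F [oU cF E rF]]]]] _] := hA.
by exists (n - r)%N, U, F.
Qed.

Lemma stratum_tangent_cst c M : A M -> tangent_to (fun=> c) M.
Proof.
move=> AM a Ma.
have [B [pi [oB piP _ _]]] := local_projection p1 Ma (stratum_chart AM Ma).
by apply: filterS (open_nbhs_nbhs oB) => x /piP E; exists (pi x).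
Qed.

Lemma thick_stratum_open M : A M -> ~ thin M -> open M.
Proof.
move=> AM tM; rewrite openE => a Ma; have [_ _ /(_ M AM)[r Mr] _] := hA.
have [rn Mch] := Mr; have [U [F [oU _ E _]]] := Mch a Ma.
have nr : (n - r = 0)%N.
  apply/eqP; rewrite subn_eq0 leqNgt; apply/negP => rn'; apply: tM.
  by split=> //; exists r.
rewrite /interior/=; apply: filterS (open_nbhs_nbhs oU) => x Ux.
suff : (M `&` U) x by case.
rewrite E; split=> //; apply/rowP => i; have := ltn_ord i.
by rewrite [X in (_ < X)%N]nr.
Qed.

Lemma thick_tangent f M : A M -> ~ thin M -> tangent_to f M.
Proof.
move=> AM tM a Ma; have := open_nbhs_nbhs (conj (thick_stratum_open AM tM) Ma).
by apply: filterS => x Mx; exists x; rewrite metric_proj_id.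
Qed.

Lemma frontier L M x : A L -> A M -> L x -> closure M x -> L = M \/ strat_lt L M.
Proof.
move=> AL AM Lx cMx; have [LM|LM] := pselect (L = M); first by left.
by right; have [_ _ _] := hA; apply=> //; exists x.
Qed.

Lemma closure_stratum M x : A M -> closure M x ->
  exists L, [/\ A L, L x & L = M \/ strat_lt L M].
Proof.
move=> AM cMx; have [_ [AQ _ _] _ _] := hA.
have : Q x.
  rewrite (closure_id Q).1//; apply: closureS cMx => y My.
  by rewrite -AQ; exists M.
rewrite -AQ => -[L AL Lx]; exists L; split=> //; exact: frontier AL AM Lx cMx.
Qed.

Lemma strat_lt_thin L M : A L -> A M -> strat_lt L M -> thin L.
Proof.
move=> AL AM LM; have [//|tL] := pselect (thin L).
have [x Lx] := stratum_neq0 AL; have [cMx Mx] := LM x Lx.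
have [y [My Ly]] := cMx L (open_nbhs_nbhs (conj (thick_stratum_open AL tL) Lx)).
by have E := stratum_disjoint AL AM Ly My; rewrite E in Lx.
Qed.

(** Thin strata of height at most k, the height being the length of the longest chain ending in the
    stratum. The levels grow from the empty set, at k = 0, to all thin strata, when k is the
    depth. *)
Definition lev k M := thin M /\ forall c, strat_chain A k.+1 c -> c k <> M.

Lemma levA k M : lev k M -> A M. Proof. by case=> -[]. Qed.

Lemma lev0 M : ~ lev 0 M.
Proof. by move=> [[AM _] /(_ (fun=> M))]; apply=> //; split=> // i; rewrite ltnS. Qed.

(** A chain of k + 1 strata ending in L would be prolonged by M. *)
Lemma lev_lt k L M : lev k.+1 M -> A L -> strat_lt L M -> lev k L.
Proof.
move=> [[AM _] H] AL LM; split=> [|c [cA cl] cL]; first exact: strat_lt_thin LM.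
apply: (H (fun i => if (i <= k)%N then c i else M)); last by rewrite ltnn.
split=> i ik; first by case: ifPn => // ?; apply: cA.
rewrite !ltnS in ik; rewrite ik; move: ik; rewrite leq_eqVlt => /orP[/eqP[->]|ik].
  by rewrite ltnn cL.
by rewrite ik; exact: cl.
Qed.

Lemma levS k M : lev k M -> lev k.+1 M.
Proof.
move=> [tM H]; split=> // c [cA cl] cM; apply: (H (fun i => c i.+1)) => //.
by split=> i ik; [exact: cA|exact: cl].
Qed.

Lemma lev_depth m M : strat_depth A m -> thin M -> lev m M.
Proof. by move=> [_ Hm] tM; split=> // c /Hm; rewrite ltnn. Qed.

Lemma lev_strat_lt k L M : lev k M -> A L -> strat_lt L M -> lev k L.
Proof.
by case: k => [|k] lM AL LM; [case: (lev0 lM)|exact/levS/(lev_lt lM)].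
Qed.

Lemma finite_strata (D : set (set 'rV[R]_n)) : D `<=` A -> finite_set D.
Proof. by move=> DA; have [fA _ _ _] := hA; exact: sub_finite_set fA. Qed.

Lemma closure_union (D : set (set 'rV[R]_n)) x : D `<=` A ->
  closure (\bigcup_(M in D) M) x -> exists2 M, D M & closure M x.
Proof.
move=> DA; have cD : closed (\bigcup_(M in D) closure M).
  by apply: closed_bigcup; [exact: finite_strata|move=> M _; exact: closed_closure].
suff H : closure (\bigcup_(M in D) M) `<=` \bigcup_(M in D) closure M.
  by move=> /H[M DM cM]; exists M.
rewrite [X in _ `<=` X](closure_id _).1//; apply: closureS => y [M DM My].
by exists M => //; exact: subset_closure.
Qed.

(* Distinct strata of [new k] do not meet the closures of each other, so that
   [new k] is again a submanifold and all these strata are treated at once. *)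
Definition low k := \bigcup_(M in lev k) M.
Definition new k := \bigcup_(M in lev k.+1 `\` lev k) M.

(** As Q is closed, a limit point of a stratum M lies in M or in a stratum below M, whose level is
    no higher. *)
Lemma low_closed k : closed (low k).
Proof.
rewrite closure_id; apply/seteqP; split; first exact: subset_closure.
move=> x /closure_union[|M lM cMx]; first by move=> M /levA.
have [L [AL Lx [E|LM]]] := closure_stratum (levA lM) cMx.
  by exists M => //; rewrite -E.
by exists L => //; exact: lev_strat_lt LM.
Qed.

Lemma closure_new k : closure (new k) `<=` new k `|` low k.
Proof.
move=> x /closure_union[|M lM cMx]; first by move=> M [/levA].
have [L [AL Lx [E|LM]]] := closure_stratum (levA lM.1) cMx.
  by left; exists M => //; rewrite -E.
by right; exists L => //; exact: lev_lt lM.1 AL LM.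
Qed.

Lemma new_low k x : new k x -> ~ low k x.
Proof.
move=> [M [lM nM] Mx] [L lL Lx]; apply: nM.
by rewrite -(stratum_disjoint (levA lL) (levA lM) Lx Mx).
Qed.

(** If M met the closure of another new stratum L, the frontier condition would put M below L, hence
    into [lev k]. *)
Lemma near_new k M a : (lev k.+1 `\` lev k) M -> M a ->
  \forall x \near a, new k x -> M x.
Proof.
move=> [lM nM] Ma.
have : \forall x \near a, forall L, ((lev k.+1 `\` lev k) `\ M) L -> ~ closure L x.
  apply: near_finite; first by apply: finite_strata => L [[/levA]].
  move=> L [[lL nL] LM]; apply: open_nbhs_nbhs; split.
    exact/closed_openC/closed_closure.
  move=> cLa; have [E|ML] := frontier (levA lM) (levA lL) Ma cLa; first exact: LM.
  by apply: nM; exact: lev_lt lL (levA lM) ML.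
apply: filterS => x H [L lL Lx]; have [<-//|LM] := pselect (L = M).
by case: (H L) => //; exact: subset_closure.
Qed.

Lemma new_chart k a : new k a -> chart (omap succn p) (new k) a.
Proof.
move=> [M lM Ma]; have [d [U [F [Ua cF E rF]]]] := stratum_chart (levA lM.1) Ma.
have : nbhs a [set x | U x /\ (new k x -> M x)].
  by apply: filterI; [exact: open_nbhs_nbhs|exact: near_new].
rewrite nbhsE; case=> B oB HB; exists d, B, F; split=> //.
  apply/is_CpP => j /((is_CpP _ _ _).1 cF); apply: ck_sub => x /HB[] //.
apply/seteqP; split=> [x [nx Bx]|x [Bx Fx]].
  have [Ux /(_ nx) Mx] := HB x Bx.
  by have : (M `&` U) x by []; rewrite E => -[].
have [Ux _] := HB x Bx; have : (M `&` U) x by rewrite E.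
by move=> [Mx _]; split=> //; exists M.
Qed.

(** Let L be the stratum of z and M that of y. Then f x = f (P_L x) = f (P_L y) = f y: the outer
    equalities are the tangency of f along L, the middle one is normal flatness. The bound |x - y|
    <= |x - z| brings y near z together with x, so that the tangency applies at y and z is a limit
    point of M, that is, L lies below M. *)
Lemma near_flat k f z (VU : set 'rV[R]_n -> set 'rV[R]_n -> set 'rV[R]_n * set 'rV[R]_n) :
  (forall L M, A L -> A M -> strat_lt L M -> [/\ set_nbhs L (VU L M).1,
    set_nbhs M (VU L M).2 & forall x, (VU L M).1 x -> (VU L M).2 x ->
    metric_proj L x = \bigcup_(y in metric_proj M x) metric_proj L y]) ->
  (forall M, lev k M -> tangent_to f M) -> low k z ->
  \forall x \near z, (forall y L M, A L -> (lev k.+1 `\` lev k) M -> strat_lt L M ->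
      M y -> metric_proj (new k) x y -> (VU L M).2 x) ->
    forall y, metric_proj (new k) x = [set y] -> enorm (x - y) <= enorm (x - z) ->
    f y = f x.
Proof.
move=> VUP tf [L lL Lz]; have AL := levA lL.
pose T := [set x | exists q, metric_proj L x = [set q] /\ f x = f q].
have nT : nbhs z T by exact: tf.
have near_y (B : set 'rV[R]_n) : nbhs z B ->
    \forall x \near z, forall y, enorm (x - y) <= enorm (x - z) -> B y.
  move=> /nbhs_enormP[s s0 H]; have s2 : 0 < s / 2 by rewrite divr_gt0.
  apply: filterS (near_enorm z s2) => x xz y yx; apply: H.
  by have := ler_enormB y x z; rewrite (enormB y x); lra.
have N1 : \forall y \near z, forall M, A M -> M y -> closure M z.
  apply: near_finite; first exact: finite_strata.
  move=> M AM; have [cMz|cMz] := pselect (closure M z).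
    by apply: (filterS _ (@filterT _ (nbhs z) _)).
  have : nbhs z (~` closure M).
    by apply: open_nbhs_nbhs; split=> //; exact/closed_openC/closed_closure.
  by apply: filterS => y cMy My; case: cMy; exact: subset_closure.
have N2 : \forall x \near z, forall M, (A `&` strat_lt L) M -> (VU L M).1 x.
  apply: near_finite; first by apply: finite_strata => M [].
  by move=> M [AM LM]; have [H _ _] := VUP L M AL AM LM; exact: H.
have N1' := near_y _ N1; have nT' := near_y _ nT.
near=> x => Ux y E yx.
have [M lM My] : new k y by have : metric_proj (new k) x y by [rewrite E]; case.
have AM := levA lM.1.
have cMz : closure M z.
  suff H : forall M, A M -> M y -> closure M z by exact: H.
  by move: y yx {E My lM AM M}; near: x.
have LM : strat_lt L M.
  have [LM|//] := frontier AL AM Lz cMz; by have [_] := lM; rewrite -LM.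
have V1 : (VU L M).1 x by move: M {My lM cMz} AM LM; near: x => //; apply: filterS N2 => x H M AM LM; exact: H.
have V2 : (VU L M).2 x by apply: Ux LM My _ => //; rewrite E.
have [_ _ /(_ x V1 V2)] := VUP L M AL AM LM.
have MN : M `<=` new k by move=> u Mu; exists M.
rewrite (metric_proj_sub MN E My) bigcup_set1 => EL.
have [q [Eq ->]] : T x by near: x.
have [q' [Eq' ->]] : T y by move: y yx {E My Ux V2 EL}; near: x.
by congr f; have : [set q] q' by rewrite -Eq EL Eq'.
Unshelve. all: by end_near.
Qed.

(** The correction stage with Y = [new k] and Z = [low k]; tangency along the lower strata survives
    because the function is unchanged near them. *)
Lemma stratum_step k G (V2 : set 'rV[R]_n) f (e : 'rV[R]_n -> R) (K : R) :
  normally_flat A -> closed G -> (forall x, G x -> \forall y \near x, f y = 0) ->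
  (forall M, thin M -> set_nbhs M V2) ->
  (forall j, le_order j p -> is_Ck j setT f) ->
  continuous e -> (forall x, 0 < e x) -> 0 < K ->
  (forall M, lev k M -> tangent_to f M) ->
  exists h : 'rV[R]_n -> R, [/\ forall j, le_order j p -> is_Ck j setT h,
    forall x, `|h x - f x| < e x /\ (~ V2 x -> h x = f x),
    forall x, G x -> \forall y \near x, h y = 0,
    forall M, lev k.+1 M -> tangent_to h M &
    lipschitz_cst K f -> lipschitz_cst (11 * K) h].
Proof.
move=> hflat cG fG hV2 cf ce e0 K0 tf.
have [Y0|Y0] := pselect (new k !=set0); last first.
  exists f; split=> //.
  - by move=> x; rewrite subrr normr0.
  - move=> M lM; have [/tf//|nM] := pselect (lev k M).
    have [x Mx] := stratum_neq0 (levA lM); case: Y0; exists x; by exists M.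
  - move=> lf x y; apply: (le_trans (lf x y)); rewrite ler_wpM2r ?enorm_ge0//; lra.
have [VU VUP] : exists VU : set 'rV[R]_n -> set 'rV[R]_n -> set 'rV[R]_n * set 'rV[R]_n,
  forall L M, A L -> A M -> strat_lt L M -> [/\ set_nbhs L (VU L M).1,
    set_nbhs M (VU L M).2 & forall x, (VU L M).1 x -> (VU L M).2 x ->
    metric_proj L x = \bigcup_(y in metric_proj M x) metric_proj L y].
  suff H (LM : set 'rV[R]_n * set 'rV[R]_n) : exists VU : set 'rV[R]_n * set 'rV[R]_n, A LM.1 -> A LM.2 ->
      strat_lt LM.1 LM.2 -> [/\ set_nbhs LM.1 VU.1, set_nbhs LM.2 VU.2 &
      forall x, VU.1 x -> VU.2 x -> metric_proj LM.1 x =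
        \bigcup_(y in metric_proj LM.2 x) metric_proj LM.1 y].
    have [g gP] := choice H; exists (fun L M => g (L, M)) => L M AL AM LM.
    exact: gP (L, M) AL AM LM.
  have [[AL [AM ltLM]]|N] := pselect (A LM.1 /\ A LM.2 /\ strat_lt LM.1 LM.2).
    by have [V [U H]] := hflat _ _ AL AM ltLM; exists (V, U).
  by exists (setT, setT) => AL AM ltLM; case: N.
(* The second neighborhoods provided by normal flatness, intersected over the finitely many strata L
   below the stratum M that contains the nearest point. *)
pose U := [set x | forall y L M, A L -> (lev k.+1 `\` lev k) M -> strat_lt L M ->
      M y -> metric_proj (new k) x y -> (VU L M).2 x].
have nU a : new k a -> nbhs a U.
  move=> na; have [M lM Ma] := na; have N1 := near_metric_proj na (near_new lM Ma).
  have N2 : \forall x \near a, forall L, (A `&` [set L | strat_lt L M]) L -> (VU L M).2 x.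
    apply: near_finite; first by apply: finite_strata => L [].
    by move=> L [AL LM]; have [_ H _] := VUP L M AL (levA lM.1) LM; exact: H.
  apply: filterS2 N1 N2 => x H1 H2 y L M' AL lM' LM' M'y yx.
  have My : M y by apply: (H1 y yx); exists M'.
  have E := stratum_disjoint (levA lM.1) (levA lM'.1) My M'y.
  by rewrite -E; apply: H2; split=> //; rewrite /= E.
have nV2 a : new k a -> nbhs a V2.
  by move=> [M [[tM _] _] Ma]; exact: (hV2 M tM a Ma).
have [h [ch he [hZ hG] hY lh]] := tangential_modification p1 Y0 (@new_chart k)
  (@low_closed k) (@new_low k) (@closure_new k) cG fG nV2 nU cf ce e0
  (fun z => @near_flat k f z VU VUP tf) K0.
exists h; split=> // M lM; have [lM'|nM] := pselect (lev k M).
  apply: near_eq_tangent (tf M lM') => a Ma; apply: hZ; by exists M.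
move=> a Ma; have nMk : (lev k.+1 `\` lev k) M by [].
have na : new k a by exists M.
apply: filterS2 (hY a na) (near_metric_proj na (near_new nMk Ma)) => x [y [E hxy]] H.
have Py : metric_proj (new k) x y by rewrite E.
exists y; split=> //; apply: metric_proj_sub E _; first by move=> u Mu; exists M.
by apply: H => //; case: Py.
Qed.

End Strata.

(** * Iteration over the levels, and the conclusion in terms of [lip] *)

Section LipschitzApproximation.
Context {R : realType} {n : nat}.
Implicit Types f g : 'rV[R]_n -> R.

Lemma enorm_gt0 (x y : 'rV[R]_n) : x <> y -> 0 < enorm (x - y).
Proof.
move=> xy; rewrite lt_neqAle enorm_ge0 andbT eq_sym; apply/eqP => /enorm0_eq0/eqP.
by rewrite subr_eq0 => /eqP.
Qed.

Lemma lip_le f K : lipschitz_cst K f -> (lip f <= K%:E)%E.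
Proof.
move=> lf; apply: ge_ereal_sup => _ [[x y] /= xy <-]; rewrite lee_fin.
by rewrite ler_pdivrMr ?enorm_gt0// distrC enormB; exact: lf.
Qed.

Lemma lip_ge f x y : x <> y -> ((`|f x - f y| / enorm (x - y))%:E <= lip f)%E.
Proof. by move=> xy; apply: ereal_sup_ubound; exists (x, y). Qed.

Lemma lipschitz_lip f : (lip f < +oo)%E -> lipschitz_cst (fine (lip f)) f.
Proof.
move=> lf x y; have [->|/eqP xy] := eqVneq x y.
  by rewrite !subrr normr0 enorm0 mulr0.
have := lip_ge f xy; move: lf; case: (lip f) => [r| |]// _.
by rewrite lee_fin ler_pdivrMr// enorm_gt0.
Qed.

(** At k = 0 there is only the initial smoothing, omitted for a C^p function so that f is kept off
    V2. It is relative to G, which preserves the zeros there, and its share 10 K makes it cost the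
    factor 11 of a stage. Each step adds one eps to the error. *)
Lemma smooth_tangent_approx p (Q : set 'rV[R]_n) (A : set (set 'rV[R]_n))
    (G V2 : set 'rV[R]_n) f (eps : 'rV[R]_n -> R) (K : R) k :
  le_order 1 p -> closed Q -> stratification (omap succn p) Q A -> normally_flat A ->
  continuous f -> closed G -> (forall x, G x -> \forall y \near x, f y = 0) ->
  (forall M, thin p A M -> set_nbhs M V2) ->
  continuous eps -> (forall x, 0 < eps x) -> 0 < K ->
  exists h, [/\ forall j, le_order j p -> is_Ck j setT h,
    forall x, `|h x - f x| < k.+1%:R * eps x /\
      ((forall j, le_order j p -> is_Ck j setT f) -> ~ V2 x -> h x = f x),
    forall x, G x -> \forall y \near x, h y = 0,
    forall M, lev p A k M -> tangent_to h M &
    lipschitz_cst K f -> lipschitz_cst (11 ^+ k.+1 * K) h].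
Proof.
move=> p1 cQ hA hflat cf cG fG hV2 ce e0 K0; elim: k => [|k [h [ch hf hG ht lh]]].
  have lev0' h M : lev p A 0 M -> tangent_to h M by move=> /lev0.
  have [sf|nsf] := pselect (forall j, le_order j p -> is_Ck j setT f).
    exists f; split=> //; first by move=> x; rewrite subrr normr0 mul1r.
      exact: lev0'.
    move=> lf x y; apply: (le_trans (lf x y)); rewrite ler_wpM2r ?enorm_ge0//; lra.
  pose W := [set x : 'rV[R]_n | \forall y \near x, f y = 0].
  have oW : open W by exact: (@open_interior _ [set x | f x = 0]).
  have K10 : 0 < 10 * K by rewrite mulr_gt0.
  have [h [ch hf hG lh]] := smooth_approx_rel cf cG oW fG ce e0 K10.
  exists h; split=> //.
  - move=> j _; apply: ch; apply: (@ck_eq _ _ _ _ _ (fun=> 0)) => //; last exact: ck_cst.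
    by move=> x /nbhs_singleton.
  - by move=> x; rewrite mul1r.
  - by move=> x Gx; apply: filterS2 (hG x Gx) (fG x Gx) => y <-.
  - exact: lev0'.
  - by move=> lf; have -> : 11 ^+ 1 * K = K + 10 * K by [ring]; apply: lh => //; exact: ltW.
have K1 : 0 < 11 ^+ k.+1 * K by rewrite mulr_gt0// exprn_gt0.
have [g [cg gh gG gt lg]] := stratum_step p1 cQ hA hflat cG hG hV2 ch ce e0 K1 ht.
exists g; split=> //.
- move=> x; have [H1 H2] := gh x; have [H3 H4] := hf x; split; last first.
    by move=> sf Vx; rewrite H2// H4.
  have := ler_distD (h x) (g x) (f x); rewrite -[k.+2%:R]natr1 mulrDl mul1r.
  set c := k.+1%:R * eps x in H3 *; lra.
- by move=> /lh/lg; rewrite mulrA -exprS.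
Qed.

End LipschitzApproximation.

Theorem theorem2p8 (R : realType) (n m : nat) (p : option nat)
    (hp : p <> Some 0%N)
    (Q : set 'rV[R]_n) (hQ : closed Q)
    (A : set (set 'rV[R]_n))
    (hA : stratification (omap succn p) Q A)
    (hflat : normally_flat A)
    (hdepth : strat_depth A m)
    (f : 'rV[R]_n -> R) (hf : continuous f)
    (eps : 'rV[R]_n -> R) (heps : continuous eps)
    (eps_gt0 : forall x, 0 < eps x)
    (V1 : set 'rV[R]_n) (hV1 : set_nbhs (tsupport f) V1)
    (V2 : set 'rV[R]_n)
    (hV2 : set_nbhs
       (\bigcup_(M in [set M | A M /\
            exists r : nat, (r < n)%N /\ manifold (omap succn p) r M]) M) V2) :
  exists g : 'rV[R]_n -> R,
    (forall x, `|f x - g x| < eps x) /\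
    (is_Cp p setT g /\
    ((lip f < +oo)%E ->
                (lip g < +oo)%E /\ (lip g <= (11 ^+ m.+1)%:E * lip f)%E)) /\
    (forall M, A M -> exists U : set 'rV[R]_n, set_nbhs M U /\
                 forall x, U x ->
                   exists y, metric_proj M x = [set y] /\ g x = g y) /\
    (tsupport g `<=` V1) /\
    (is_Cp p setT f -> forall x, ~ V2 x -> g x = f x).
Proof.
have p1 : le_order 1 p by case: p hp {hA hV2} => [[|q]|].
have c0 : (0 < (11 ^+ m.+1)%:E :> \bar R)%E by rewrite lte_fin exprn_gt0.
have tangentW g M : tangent_to g M -> exists U : set 'rV[R]_n, set_nbhs M U /\
    forall x, U x -> exists y, metric_proj M x = [set y] /\ g x = g y.
  by move=> gM; exists [set x | exists y, metric_proj M x = [set y] /\ g x = g y].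
(* For constant f there is no room for smoothing, K having to be positive; f itself has all the
   properties. *)
have [fcst|] := pselect (forall x y, f x = f y).
  exists f; split; first by move=> x; rewrite subrr normr0.
  have fE : f = fun=> f 0 by apply/funext => x; exact: fcst.
  split; first split.
  - by apply/is_CpP => k _; rewrite fE; exact: ck_cst.
  - move=> lf; split=> //; have [[x [y xy]]|no] := pselect (exists x y : 'rV[R]_n, x <> y).
      have -> : lip f = 0; last by rewrite mule0.
      apply/le_anti/andP; split.
        by apply: lip_le => u v; rewrite (fcst u v) subrr normr0 mul0r.
      by have := lip_ge f xy; rewrite (fcst x y) subrr normr0 mul0r.
    (* In dimension 0 the supremum is over the empty set, hence -oo, and stays so when multiplied by
       a positive number. *)
    have -> : lip f = -oo%E; last by rewrite gt0_muleNy.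
    by apply/ereal_sup_ninfty => u [[x y] /= xy _]; case: no; exists x, y.
  split; last first.
    by split=> // x fx; apply: nbhs_singleton; exact: hV1.
  by move=> M AM; apply: tangentW; rewrite fE; exact: stratum_tangent_cst hA _ _ AM.
move=> nfcst; have lip_gt0 : (0 < lip f)%E.
  have [x [y xy]] : exists x y, f x <> f y.
    apply: contrapT => H; apply: nfcst => x y; apply: contrapT => xy.
    by apply: H; exists x, y.
  have xy' : x <> y by move=> E; apply: xy; rewrite E.
  apply: lt_le_trans (lip_ge f xy'); rewrite lte_fin divr_gt0 ?enorm_gt0//.
  by rewrite normr_gt0 subr_eq0; apply/eqP.
(* The value 1 is a default for infinite [lip f], when no Lipschitz bound is claimed. *)
pose K := if (lip f < +oo)%E then fine (lip f) else 1.
have K0 : 0 < K.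
  rewrite /K; case: ifP => // lf; apply: fine_gt0; by rewrite lip_gt0.
(* Vanishing on G puts the support of g inside V1. Around points of G, f vanishes because its
   support is closed and lies in the interior of V1. *)
pose G := ~` V1^°.
have cG : closed G by apply: open_closedC; exact: open_interior.
have fG x : G x -> \forall y \near x, f y = 0.
  move=> Gx; have : nbhs x (~` tsupport f).
    apply: open_nbhs_nbhs; split; first exact/closed_openC/closed_closure.
    by move=> /hV1.
  by apply: filterS => y fy; apply: contrapT => fy0; apply: fy; exact: subset_closure.
have hV2' M : thin p A M -> set_nbhs M V2.
  by move=> tM a Ma; apply: hV2; exists M.
(* The initial smoothing and the m stages share the error equally. *)
have m0 : 0 < m.+1%:R^-1 :> R by rewrite invr_gt0.
have ce : continuous (fun x => eps x * m.+1%:R^-1).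
  by move=> x; apply: (@continuousM _ _ eps (fun=> m.+1%:R^-1)); [exact: heps|exact: cst_continuous].
have e0 x : 0 < eps x * m.+1%:R^-1 by rewrite mulr_gt0.
have [g [cg gf gG gt lg]] :=
  smooth_tangent_approx m p1 hQ hA hflat hf cG fG hV2' ce e0 K0.
exists g; split.
  move=> x; have [+ _] := gf x; rewrite distrC mulrC -mulrA mulVf ?mulr1//.
split; first split.
- exact/is_CpP.
- move=> lf; have EK : lip f = K%:E.
    by rewrite /K lf fineK// ge0_fin_numE// ltW.
  have := lip_le (lg _); rewrite EK -EFinM => H.
  have {}H : (lip g <= (11 ^+ m.+1 * K)%:E)%E.
    by apply: H; rewrite /K lf; exact: lipschitz_lip.
  by split=> //; apply: le_lt_trans H _; rewrite ltry.
split; last split.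
- move=> M AM; apply: tangentW; have [tM|tM] := pselect (thin p A M).
    by apply: gt; exact: lev_depth.
  exact: (thick_tangent hA).
- move=> x gx; apply: contrapT => V1x.
  have Gx : G x by move=> /nbhs_singleton.
  by have [y [gy gy0]] := gx _ (gG x Gx).
- by move=> /is_CpP sf x; have [_ H] := gf x; exact: H.
Qed.
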